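(* For every $s\in I$ and every $f\in C_b(\mathbb{R}^d)$ there exists a unique bounded classical solution $u$ of the Cauchy problem $$u_t(t,x)=\mathcal{A}(t)u(t,x),\quad (t,x)\in(s,+\infty)\times\mathbb{R}^d,\qquad u(s,x)=f(x),\quad x\in\mathbb{R}^d,$$ i.e. a unique function $u\in C_b([s,+\infty)\times\mathbb{R}^d)\cap C^{1,2}((s,+\infty)\times\mathbb{R}^d)$ satisfying these equations. Furthermore, $$\|u(t,\cdot)\|_\infty\le\|f\|_\infty,\qquad t\ge s.$$
   Context: $d\ge 1$ is an integer and $I\subset\mathbb{R}$ is an interval which is either $\mathbb{R}$ or a right halfline. For $t\in I$ and smooth $\varphi:\mathbb{R}^d\to\mathbb{R}$, $$(\mathcal{A}(t)\varphi)(x)=\sum_{i,j=1}^d q_{ij}(t,x)D_{ij}\varphi(x)+\sum_{i=1}^d b_i(t,x)D_i\varphi(x),$$ with $Q=(q_{ij})$, $b=(b_i)$; it acts on the space variable of functions of $(t,x)$. Standing assumptions: (1) for some $\alpha\in(0,1)$, all $q_{ij},b_i$ belong to $C^{\alpha/2,\alpha}_{\rm loc}(I\times\mathbb{R}^d)$, i.e. they are $\alpha$-Hölder continuous with respect to the parabolic distance on every compact subset of $I\times\mathbb{R}^d$; (2) for every $(t,x)\in I\times\mathbb{R}^d$ the matrix $Q(t,x)$ is symmetric, and there is a function $\eta:I\times\mathbb{R}^d\to\mathbb{R}$ with $0<\eta_0:=\inf_{I\times\mathbb{R}^d}\eta$ and $\langle Q(t,x)\xi,\xi\rangle\ge\eta(t,x)|\xi|^2$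 for all $\xi\in\mathbb{R}^d$, $(t,x)\in I\times\mathbb{R}^d$; (3) for every bounded interval $J\subset I$ there exist $\varphi=\varphi_J\in C^2(\mathbb{R}^d)$ and $\lambda=\lambda_J>0$ such that $\lim_{|x|\to+\infty}\varphi(x)=+\infty$ and $(\mathcal{A}(t)\varphi)(x)-\lambda\varphi(x)\le0$ for $(t,x)\in J\times\mathbb{R}^d$. $C_b$ denotes bounded continuous real functions, with sup-norm $\|\cdot\|_\infty$. *)

(* Defs.v *)
From HB Require Import structures.
From mathcomp Require Import all_boot all_order all_algebra.
From mathcomp Require Import all_classical all_reals all_analysis.

Set Implicit Arguments.
Unset Strict Implicit.
Unset Printing Implicit Defensive.

Import Order.TTheory GRing.Theory Num.Theory.
Import numFieldNormedType.Exports.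

Local Open Scope classical_set_scope.
Local Open Scope ring_scope.

(* R^d is 'rV[R]_d; a function of (t, x) is a function on R * 'rV[R]_d. *)

Section definitions.
Context {R : realType} {d : nat}.
Implicit Types (phi f : 'rV[R]_d -> R) (g u : R * 'rV[R]_d -> R) (s : R).
Implicit Types (I J : set R) (Q : R * 'rV[R]_d -> 'M[R]_d)
  (b : R * 'rV[R]_d -> 'rV[R]_d).

Definition dotp (x y : 'rV[R]_d) : R := \sum_i x 0 i * y 0 i.

(* The library norm `|x| on row vectors is the maximum norm. *)
Definition enorm (x : 'rV[R]_d) : R := Num.sqrt (dotp x x).

Definition supnorm f : R := sup (range (fun x => `|f x|)).

Definition Cb f : Prop := continuous f /\ bounded_fun f.

Definition unbounded_interval I : Prop :=
  I = setT \/ exists a : R, I = `[a, +oo[%classic \/ I = `]a, +oo[%classic.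

Definition D (i : 'I_d) phi : 'rV[R]_d -> R :=
  fun x => derive phi x (delta_mx 0 i).

Definition has_D (i : 'I_d) phi (x : 'rV[R]_d) : Prop :=
  derivable phi x (delta_mx 0 i).

Definition D2 (i j : 'I_d) phi : 'rV[R]_d -> R := D i (D j phi).

Definition C2 phi : Prop :=
  [/\ continuous phi,
      forall i, (forall x, has_D i phi x) /\ continuous (D i phi)
    & forall i j, (forall x, has_D i (D j phi) x) /\ continuous (D2 i j phi)].

Definition Dt u : R * 'rV[R]_d -> R :=
  fun p => derive1 (fun t => u (t, p.2)) p.1.

Definition has_Dt u (p : R * 'rV[R]_d) : Prop :=
  derivable (fun t => u (t, p.2)) p.1 1.

Definition slice u (t : R) : 'rV[R]_d -> R := fun x => u (t, x).

Definition closed_slab s : set (R * 'rV[R]_d) := [set p | s <= p.1].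

Definition open_slab s : set (R * 'rV[R]_d) := [set p | s < p.1].

Definition C12 s u : Prop :=
  [/\ {within open_slab s, continuous u},
      (forall p, open_slab s p -> has_Dt u p) /\
        {within open_slab s, continuous (Dt u)},
      forall i,
        (forall p, open_slab s p -> has_D i (slice u p.1) p.2) /\
        {within open_slab s, continuous (fun p => D i (slice u p.1) p.2)}
    & forall i j,
        (forall p, open_slab s p -> has_D i (D j (slice u p.1)) p.2) /\
        {within open_slab s, continuous (fun p => D2 i j (slice u p.1) p.2)}].

Definition A Q b (t : R) phi : 'rV[R]_d -> R := fun x =>
  \sum_i \sum_j Q (t, x) i j * D2 i j phi x + \sum_i b (t, x) 0 i * D i phi x.

Definition parabolic_dist (p q : R * 'rV[R]_d) : R :=
  enorm (p.2 - q.2) + Num.sqrt `|p.1 - q.1|.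

Definition parabolic_holder_on (alpha : R) (K : set (R * 'rV[R]_d)) g : Prop :=
  exists C : R, forall p q, K p -> K q ->
    `|g p - g q| <= C * parabolic_dist p q `^ alpha.

Definition parabolic_holder_loc (alpha : R) I g : Prop :=
  forall K : set (R * 'rV[R]_d), compact K -> K `<=` I `*` setT ->
    parabolic_holder_on alpha K g.

Definition holder_coefficients I Q b : Prop :=
  exists alpha : R, [/\ 0 < alpha < 1,
    forall i j, parabolic_holder_loc alpha I (fun p => Q p i j)
    & forall i, parabolic_holder_loc alpha I (fun p => b p 0 i)].

(* The library's real inf is 0 on a set that is not bounded below, so that
   0 < inf forces eta to be bounded below by a positive constant.
   xi *m (Q p)^T is the row vector of Q(p) xi. *)
Definition elliptic I Q : Prop :=
  (forall p, (I `*` setT) p -> (Q p)^T = Q p) /\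
  exists eta : R * 'rV[R]_d -> R,
    0 < inf (eta @` (I `*` setT)) /\
    forall p (xi : 'rV[R]_d), (I `*` setT) p ->
      eta p * enorm xi ^+ 2 <= dotp (xi *m (Q p)^T) xi.

Definition cvg_pinfty_at_infinity phi : Prop :=
  forall M : R, exists r : R, forall x, r < enorm x -> M < phi x.

Definition lyapunov I Q b : Prop :=
  forall J, is_interval J -> bounded_set J -> J `<=` I ->
    exists phi (lambda : R),
      [/\ C2 phi, 0 < lambda, cvg_pinfty_at_infinity phi
        & forall t x, J t -> A Q b t phi x - lambda * phi x <= 0].

Definition bounded_classical_solution Q b s f u : Prop :=
  [/\ {within closed_slab s, continuous u} /\
        [bounded u p | p in closed_slab s],
      C12 s u,
      forall t x, s < t -> Dt u (t, x) = A Q b t (slice u t) x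
    & forall x, u (s, x) = f x].

End definitions.

(* Main.v *)
Require Import Defs.
From HB Require Import structures.
From mathcomp Require Import all_boot all_order all_algebra.
From mathcomp Require Import all_classical all_reals all_analysis.
From mathcomp Require Import ring lra.
Set Implicit Arguments.
Unset Strict Implicit.
Unset Printing Implicit Defensive.
Import Order.TTheory GRing.Theory Num.Theory.
Import numFieldNormedType.Exports.
Local Open Scope classical_set_scope.
Local Open Scope ring_scope.

(* The whole argument rests on the maximum principle.  Doubling a space variable, i.e. comparing
   w(t, x + r e_n) - w(t, x - r e_n) with a barrier concave in r, gives a Lipschitz bound for
   solutions; applied to second-order difference quotients v(x + k e_i + k e_j) - ..., on which the
   coefficients can be frozen, it shows that the Holder seminorm of D^2 v is at most a small multiple
   of itself plus lower-order terms.  With a weight vanishing at the boundary this yields Schauder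
   estimates, both global and interior.  The equation with the Laplacian is solved by letting the
   step of a semidiscrete scheme tend to 0, and the method of continuity then solves it for bounded
   globally Holder coefficients.  Finally the coefficients are clamped outside [s, s + n] x [-n, n]^d:
   the Lyapunov function makes the solutions of the clamped problems Cauchy locally uniformly, the
   interior estimates make their derivatives Cauchy as well, and the limit is the solution.
   Uniqueness and the sup bound come from the same Lyapunov barrier. *)

(** The gain in the Schauder estimate comes from separated lengths. To compare second derivatives at
    points [2 * a] apart, differences are taken with step [mu * a] and the doubling is done at
    radius [N * a]. At that radius the Hessian oscillates by a multiple of [(N * a) ^ al], while the
    Lipschitz bound recovers a factor [1 / N]. What comes back is of order [N ^ (al - 1)], small for
    large [N] because [al < 1]; a small [mu] keeps difference quotients close to derivatives.
    Absorption only works on a seminorm known to be finite. So every solution treated comes with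
    some Holder bound on its Hessian, whose size never enters the result. Coefficients are frozen at
    a centre in space but for each time separately. Hence the estimates need no regularity in time,
    and the function spaces ask for Holder continuity in [x] only. No heat kernel appears. Smoothing
    is done by averaging along coordinate directions, and for bounded coefficients limits are taken
    in the sup norm inside a ball of solutions, where interpolation makes the derivatives converge
    too. *)

Section calculus.
Context {R : realType}.
Implicit Types (f g : R -> R) (r t u x y e h a b c l : R).

(** Multiplying the difference quotient by [h] gives an inequality that also holds at [h = 0], so
    derivatives can be added, shifted and passed to the limit without punctured neighbourhoods. *)
Lemma is_derive_epsP (V : normedModType R) (f : V -> R) (x v : V) (l : R) :
  is_derive x v f l <->
  forall e : R, 0 < e -> exists2 dl : R, 0 < dl &
    forall h : R, `|h| < dl -> `|f (x + h *: v) - f x - h * l| <= e * `|h|.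
Proof.
have E (h : R) : h != 0 -> `|l - h^-1 *: ((f \o shift x) (h *: v) - f x)| * `|h| =
    `|f (x + h *: v) - f x - h * l|.
  move=> h0; rewrite -normrM distrC mulrBl /= [_ + x]addrC [l * h]mulrC.
  by rewrite {1}/GRing.scale /= mulrAC mulVf// mul1r.
split.
- move=> [dv ev] e e0.
  have /cvgrPdist_le/(_ e e0) : h^-1 *: ((f \o shift x) (h *: v) - f x)
    @[h --> 0^'] --> l by rewrite -ev; exact: dv.
  rewrite near_withinE => /nbhs_norm0P[dl/= dl0 H].
  exists dl => // h hd; have [->|h0] := eqVneq h 0.
    by rewrite scale0r addr0 subrr mul0r subr0 normr0 mulr0.
  by rewrite -E// ler_wpM2r//; apply: H.
- move=> H.
  have C : h^-1 *: ((f \o shift x) (h *: v) - f x) @[h --> 0^'] --> l.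
    apply/cvgrPdist_le => e e0; have [dl dl0 Hd] := H e e0.
    near=> h; have h0 : h != 0 by near: h; exact: nbhs_dnbhs_neq.
    have hd : `|h| < dl by near: h; exact: dnbhs0_lt.
    by rewrite -(ler_pM2r (_ : 0 < `|h|)) ?normr_gt0// E//; apply: Hd.
  by split; [apply/cvg_ex; exists l | apply: cvg_lim].
Unshelve. all: by end_near.
Qed.

Lemma is_derive_continuous1 f (x l : R) : is_derive x 1 f l -> {for x, continuous f}.
Proof. by move=> [/derivable1_diffP/differentiable_continuous]. Qed.

Lemma is_derive_derive1 f x l :
  derivable f x 1 -> (f^`())%classic x = l -> is_derive x 1 f l.
Proof. by move=> d1 <-; apply: DeriveDef d1 _; rewrite derive1E. Qed.

Lemma mvt_real f (f' : R -> R) (a b : R) : a <= b ->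
  (forall x, a <= x <= b -> is_derive x 1 f (f' x)) ->
  exists2 c, a <= c <= b & f b - f a = f' c * (b - a).
Proof.
move=> ab H.
have D x : x \in `]a, b[ -> is_derive x 1 f (f' x).
  by rewrite in_itv/= => /andP[/ltW ax /ltW xb]; apply: H; rewrite ax.
have C : {within `[a, b], continuous f}.
  apply: continuous_in_subspaceT => x /set_mem; rewrite /= in_itv /= => xab.
  exact: is_derive_continuous1 (H _ xab).
by have [c + ->] := MVT_segment ab D C; rewrite in_itv/= => cab; exists c.
Qed.

(** One-sided, because a maximum over a closed time interval may sit at the final time. *)
Lemma left_derivative_ge0 f (t l rho : R) : 0 < rho -> is_derive t 1 f l ->
  (forall u, t - rho <= u <= t -> f u <= f t) -> 0 <= l.
Proof.
move=> r0 /is_derive_epsP H M; rewrite leNgt; apply/negP => l0.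
have [dl d0 Hd] := H (- l / 2) ltac:(lra).
pose h := - (Num.min dl rho / 2).
have m0 : 0 < Num.min dl rho by rewrite lt_min d0.
have m1 : Num.min dl rho <= dl by rewrite ge_min lexx.
have m2 : Num.min dl rho <= rho by rewrite ge_min lexx orbT.
have hn : `|h| = - h by rewrite ler0_norm// /h; lra.
have := Hd h; rewrite hn => /(_ ltac:(rewrite /h; lra)).
have := M (t + h *: 1); rewrite /GRing.scale/= mulr1 => /(_ ltac:(rewrite /h; lra)) ? /ler_normlP[? ?].
have : 0 < l * h by rewrite nmulr_rgt0// /h; lra.
nra.
Qed.

(** If [f2 > 0], then [f1], which vanishes at the maximum, is positive just to the right of 0, and
    [f] increases there. *)
Lemma second_derivative_test f (f1 : R -> R) (f2 rho : R) : 0 < rho ->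
  (forall r, `|r| < rho -> is_derive r 1 f (f1 r)) -> is_derive (0:R) 1 f1 f2 ->
  (forall r, `|r| < rho -> f r <= f 0) -> f2 <= 0.
Proof.
move=> r0 H1 H2 M; rewrite leNgt; apply/negP => f20.
have f10 : f1 0 = 0.
  have H0 : is_derive (0:R) 1 f (f1 0) by apply: H1; rewrite normr0.
  have A : is_derive (0:R) 1 f 0.
    apply: (@derive1_at_max _ f (- rho) rho 0).
    - lra.
    - by move=> t; rewrite in_itv/= => t0; have [] := H1 t ltac:(rewrite ltr_norml; lra).
    - by rewrite in_itv/=; lra.
    - by move=> t; rewrite in_itv/= => t0; apply: M; rewrite ltr_norml; lra.
  by rewrite -(@derive_val _ _ _ _ _ _ _ H0) (@derive_val _ _ _ _ _ _ _ A).
move/is_derive_epsP : H2 => /(_ (f2 / 2) ltac:(lra))[dl d0 Hd].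
pose h := Num.min dl rho / 2.
have m0 : 0 < Num.min dl rho by rewrite lt_min d0.
have m1 : Num.min dl rho <= dl by rewrite ge_min lexx.
have m2 : Num.min dl rho <= rho by rewrite ge_min lexx orbT.
have [h0 hd hr] : [/\ 0 < h, h < dl & h < rho] by rewrite /h; split; lra.
have [c /[!in_itv]/= /andP[c0 ch] cE] := @MVT R f f1 0 h h0
  ltac:(move=> x /[!in_itv]/= ?; apply: H1; rewrite ger0_norm; lra)
  ltac:(apply: continuous_in_subspaceT => x /set_mem /=; rewrite in_itv/= => ?;
    apply: is_derive_continuous1; apply: H1; rewrite ger0_norm; lra).
have := Hd c; rewrite gtr0_norm// f10 subr0 add0r /GRing.scale/= mulr1 => /(_ ltac:(lra)).
move/ler_normlP => [? ?].
have : 0 < f1 c by nra.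
have := M h; rewrite gtr0_norm// => /(_ hr).
nra.
Qed.

Lemma cvg_le_bound (u : nat -> R) l b : u n @[n --> \oo] --> l ->
  (\forall n \near \oo, u n <= b) -> l <= b.
Proof.
move=> ul H; rewrite -(cvg_lim (@Rhausdorff R) ul); apply: limr_le => //.
by apply/cvg_ex; exists l.
Qed.

(** The mean value theorem for [fn n - fn N] turns closeness of derivatives into closeness of
    difference quotients, uniformly in the increment; one fixed [N] then controls the quotient of
    the limit. *)
Lemma limit_derivative (fn gn : nat -> R -> R) f (g : R -> R) (rho : R) : 0 < rho ->
  (forall n r, `|r| < rho -> is_derive r 1 (fn n) (gn n r)) ->
  (forall r, `|r| < rho -> fn n r @[n --> \oo] --> f r) ->
  (forall e, 0 < e -> \forall n \near \oo,
     forall r, `|r| < rho -> `|gn n r - g r| <= e) ->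
  is_derive (0:R) 1 f (g 0).
Proof.
move=> r0 H Hf Hg; apply/is_derive_epsP => e e0.
have [N _ HN] := Hg (e / 5) ltac:(lra).
have := H N 0 ltac:(by rewrite normr0) => /is_derive_epsP/(_ (e / 5) ltac:(lra)).
move=> [dl d0 Hd]; exists (Num.min dl rho); first by rewrite lt_min d0.
move=> h; rewrite lt_min => /andP[h1 h2].
rewrite add0r /GRing.scale/= mulr1.
have := Hd h h1; rewrite add0r /GRing.scale/= mulr1 => A.
have B : `|gn N 0 - g 0| <= e / 5 by apply: HN; rewrite ?normr0 /=.
suff C : `|(f h - f 0) - (fn N h - fn N 0)| <= 2 * (e / 5) * `|h|.
  move: C A; set u := f h - f 0; set w := fn N h - fn N 0 => C A.
  rewrite (_ : _ - _ = (u - w) + (w - h * gn N 0) + h * (gn N 0 - g 0)); last by ring.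
  apply: (le_trans (ler_normD _ _)); rewrite normrM.
  have := ler_normD (u - w) (w - h * gn N 0) => D.
  have : `|h| * `|gn N 0 - g 0| <= `|h| * (e / 5) by rewrite ler_wpM2l.
  by have := normr_ge0 h; nra.
have K n : (N <= n)%N -> `|(fn n h - fn n 0) - (fn N h - fn N 0)| <= 2 * (e / 5) * `|h|.
  move=> Nn; pose k r := fn n r - fn N r.
  have dk r : `|r| < rho -> is_derive r 1 k (gn n r - gn N r).
    by move=> ?; apply: is_deriveB; apply: H.
  have bk r : `|r| < rho -> `|gn n r - gn N r| <= 2 * (e / 5).
    move=> ?; rewrite (_ : _ - _ = (gn n r - g r) - (gn N r - g r)); last by ring.
    by apply: (le_trans (ler_normB _ _)); rewrite mulr2n mulrDl mul1r; apply: lerD; apply: HN => //=.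
  rewrite (_ : _ - _ = k h - k 0); last by rewrite /k; ring.
  have [h0|h0] := leP 0 h.
    have [c cc ->] := mvt_real h0 (fun x (hx : 0 <= x <= h) => dk x
      ltac:(move: h2 hx; rewrite !ltr_norml; lra)).
    rewrite subr0 normrM ler_wpM2r// bk//; move: h2 cc; rewrite !ltr_norml; lra.
  have [c cc cE] := mvt_real (ltW h0) (fun x (hx : h <= x <= 0) => dk x
      ltac:(move: h2 hx; rewrite !ltr_norml; lra)).
  rewrite -normrN opprB cE sub0r normrM normrN ler_wpM2r// bk//; move: h2 cc; rewrite !ltr_norml; lra.
have L : `|(fn n h - fn n 0) - (fn N h - fn N 0)| @[n --> \oo] --> `|(f h - f 0) - (fn N h - fn N 0)|.
  apply: cvg_norm; apply: cvgB; last exact: cvg_cst.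
  by apply: cvgB; apply: Hf; rewrite ?normr0.
by apply: (cvg_le_bound L); exists N.
Qed.

Lemma exists_primitive f : continuous f ->
  exists F : R -> R, forall x, -1 < x -> is_derive x 1 F (f x).
Proof.
(* The base point [-1] lies strictly to the left of 0, so that the primitive is differentiable at 0
   as well. *)
move=> cf; exists (fun x => \int[lebesgue_measure]_(t in `[-1, x]) f t)%R => x x1.
have I : lebesgue_measure.-integrable `[-1, x + 1] (EFin \o f).
  apply: continuous_compact_integrable; first exact: segment_compact.
  exact: continuous_subspaceT.
have [d1 d2] := @continuous_FTC1 R f (BLeft (-1)) x (x + 1) ltac:(lra) I ltac:(by rewrite lte_fin) (cf x).
exact: is_derive_derive1 d1 d2.
Qed.

End calculus.

(** The derivatives are carried as explicit functions, so that linear combinations, shifts and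
    limits act on formulas. [Hphi i j] differentiates [dphi j] in direction [i]; symmetry is not
    part of the data. *)
Definition is_C2 {R : realType} {d : nat} (phi : 'rV[R]_d -> R)
    (dphi : 'I_d -> 'rV[R]_d -> R) (Hphi : 'I_d -> 'I_d -> 'rV[R]_d -> R) :=
  [/\ forall i x, is_derive x (delta_mx 0 i) phi (dphi i x),
      forall i, continuous (dphi i),
      forall i j x, is_derive x (delta_mx 0 i) (dphi j) (Hphi i j x)
    & forall i j, continuous (Hphi i j)].

Definition psd {R : realType} {d : nat} (Q : 'M[R]_d) :=
  forall x : 'rV[R]_d, 0 <= \sum_i \sum_j Q i j * (x 0 i * x 0 j).

(** * Directional derivatives from continuous partial derivatives *)

Section row_vectors.
Context {R : realType} {d : nat}.
Local Notation E := 'rV[R]_d.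
Local Notation e i := (delta_mx 0 i : 'rV[R]_d).
Implicit Types (x y v : E) (i j : 'I_d) (r c k : R) (phi : E -> R).

Lemma coord_le_norm x i : `|x 0 i| <= `|x|.
Proof.
rewrite [`|x|]/Num.norm/= mx_normrE.
exact: (@le_bigmax _ _ _ 0 (fun ij : 'I_1 * 'I_d => `|x ij.1 ij.2|) (0, i)).
Qed.

Lemma norm_le_coord x c : 0 <= c -> (forall i, `|x 0 i| <= c) -> `|x| <= c.
Proof.
move=> c0 H; rewrite [`|x|]/Num.norm/= mx_normrE.
by apply/bigmax_leP; split=> // -[a i] _ /=; rewrite (ord1 a).
Qed.

Lemma delta_coord i j : e i 0 j = (i == j)%:R.
Proof. by rewrite mxE eqxx /= eq_sym. Qed.

Lemma norm_delta_le r i : `|r *: e i| <= `|r|.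
Proof.
apply: norm_le_coord => // j; rewrite mxE delta_coord.
by case: eqP => _; rewrite ?mulr1 ?mulr0 ?normr0.
Qed.

Lemma is_derive_line phi x v r l :
  is_derive (x + r *: v) v phi l <-> is_derive r 1 (fun u => phi (x + u *: v)) l.
Proof.
split=> /is_derive_epsP H; apply/is_derive_epsP => c /H[dl dl0 Hd];
  exists dl => // h /Hd; by rewrite [h *: 1]mulr1 scalerDl addrA.
Qed.

Lemma is_derive_line0 phi x v l :
  is_derive x v phi l <-> is_derive (0:R) 1 (fun u => phi (x + u *: v)) l.
Proof. by rewrite -is_derive_line scale0r addr0. Qed.

Lemma continuous_epsP (V : normedModType R) (f : V -> R) (x : V) :
  {for x, continuous f} <->
  forall c, 0 < c -> exists2 dl : R, 0 < dl & forall y : V, `|y - x| < dl -> `|f y - f x| <= c.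
Proof.
split.
- move=> /cvgrPdist_le H c /H /nbhs_normP[dl/= dl0 Hd].
  by exists dl => // y yx; rewrite distrC; apply: Hd; rewrite /= distrC.
- move=> H; apply/cvgrPdist_le => c /H [dl dl0 Hd].
  by apply/nbhs_normP; exists dl => //= y yx; rewrite distrC; apply: Hd; rewrite distrC.
Qed.

Lemma sum_delta x : x = \sum_i x 0 i *: e i.
Proof.
apply/rowP => j; rewrite summxE (bigD1 j)//= mxE delta_coord eqxx mulr1.
by rewrite big1 ?addr0// => i ij; rewrite mxE delta_coord (negbTE ij) mulr0.
Qed.

(** The displacement along [v] is made one coordinate at a time. Each move is a mean value
    increment, at a point where the partial derivative is within [c / (S + 1)] of its value at
    [x]. *)
Lemma is_derive_C1 phi (dphi : 'I_d -> E -> R) x v :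
  (forall i y, is_derive y (e i) phi (dphi i y)) ->
  (forall i, continuous (dphi i)) ->
  is_derive x v phi (\sum_i v 0 i * dphi i x).
Proof.
move=> H C; apply/is_derive_epsP => c c0.
pose S := \sum_i `|v 0 i|.
have S0 : 0 <= S by apply: sumr_ge0.
have [dl dl0 Hd] : exists2 dl : R, 0 < dl & forall i y, `|y - x| < dl -> `|dphi i y - dphi i x| <= c / (S + 1).
  have : forall i, exists dl : R, 0 < dl /\ forall y, `|y - x| < dl -> `|dphi i y - dphi i x| <= c / (S + 1).
    move=> i; have [|dl ? ?] := (continuous_epsP _ _).1 (C i x) (c / (S + 1)); last by exists dl.
    by rewrite divr_gt0//; lra.
  move=> /choice[f Hf]; exists (\big[Num.min/1]_i f i).
    by elim/big_ind : _ => // [a b a0 b0|i _]; [rewrite lt_min a0 | have [] := Hf i].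
  move=> i y yx; apply: (Hf i).2; apply: (lt_le_trans yx).
  exact: bigmin_le_cond.
(* Stated for a list of coordinates with arbitrary increments, so that induction on the list
   applies. *)
have K (s : seq 'I_d) (u : 'I_d -> R) : \sum_(i <- s) `|u i| < dl ->
    `|phi (x + \sum_(i <- s) u i *: e i) - phi x - \sum_(i <- s) u i * dphi i x|
      <= c / (S + 1) * \sum_(i <- s) `|u i|.
  elim: s => [|i s IH]; first by rewrite !big_nil addr0 !subrr normr0 mulr0.
  rewrite !big_cons => Hs.
  have ss : \sum_(j <- s) `|u j| < dl by apply: le_lt_trans Hs; rewrite lerDr.
  have := IH ss; set z := \sum_(j <- s) u j *: e j => {}IH.
  have nz : `|z| <= \sum_(j <- s) `|u j|.
    apply: (le_trans (ler_norm_sum _ _ _)); apply: ler_sum => j _.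
    exact: norm_delta_le.
  have [w wE nw] : exists2 w : R, phi (x + (u i *: e i + z)) - phi (x + z) = dphi i (x + z + w *: e i) * u i & `|w| <= `|u i|.
    have D r : is_derive r 1 (fun t => phi (x + z + t *: e i)) (dphi i (x + z + r *: e i)).
      by apply: (is_derive_line _ _ _ _ _).1.
    have [u0|/ltW u0] := leP 0 (u i).
      have [w wb] := mvt_real u0 (fun r _ => D r).
      rewrite scale0r addr0 subr0 => wE; exists w; last by rewrite !ger0_norm//; lra.
      by rewrite -wE [u i *: _ + z]addrC addrA.
    have [w wb] := mvt_real u0 (fun r _ => D r).
    rewrite scale0r addr0 sub0r => wE; exists w; last by rewrite !ler0_norm//; lra.
    apply/eqP; rewrite -eqr_opp opprB -mulrN -wE; apply/eqP; congr (_ - phi _).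
    by rewrite -addrA [z + _]addrC.
  have := Hd i (x + z + w *: e i).
  rewrite -[x + z + _]addrA [_ - x]addrC addKr => /(_ _)/wrap[].
    apply: le_lt_trans Hs; apply: (le_trans (ler_normD _ _)); rewrite addrC lerD//.
    exact: le_trans (norm_delta_le _ _) nw.
  move=> Hp.
  rewrite (_ : _ - _ = (phi (x + z) - phi x - \sum_(j <- s) u j * dphi j x)
    + (dphi i (x + z + w *: e i) - dphi i x) * u i).
    rewrite mulrDr [leRHS]addrC; apply: (le_trans (ler_normD _ _)); rewrite lerD//.
    by rewrite normrM ler_wpM2r// -addrA.
  rewrite mulrBl -wE; ring.
exists (dl / (S + 1)) => [|h hd]; first by rewrite divr_gt0//; lra.
have hS : \sum_i `|h * v 0 i| = `|h| * S.
  by rewrite /S mulr_sumr; apply: eq_bigr => i _; rewrite normrM.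
have := K (index_enum _) (fun i => h * v 0 i); rewrite hS.
rewrite ltr_pdivlMr in hd; last lra.
move=> /(_ _)/wrap[]; first by have := normr_ge0 h; nra.
have -> : \sum_i (h * v 0 i) *: e i = h *: v.
  by rewrite [v in RHS]sum_delta scaler_sumr; apply: eq_bigr => i _; rewrite scalerA.
have -> : \sum_i h * v 0 i * dphi i x = h * \sum_i v 0 i * dphi i x.
  by rewrite mulr_sumr; apply: eq_bigr => i _; rewrite mulrA.
move=> /le_trans; apply; rewrite mulrCA mulrC ler_wpM2r// mulrAC ler_pdivrMr; nra.
Qed.

End row_vectors.

(** * Hessians at a maximum, tested against positive semidefinite matrices *)

Section C2_functions.
Context {R : realType} {d : nat}.
Local Notation E := 'rV[R]_d.
Local Notation e i := (delta_mx 0 i : 'rV[R]_d).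
Implicit Types (x y v : E) (i j k : 'I_d) (r c : R) (phi psi : E -> R)
  (dphi dpsi : 'I_d -> E -> R) (Hphi Hpsi : 'I_d -> 'I_d -> E -> R).

Lemma is_derive_big (V : normedModType R) (I : Type) (s : seq I)
    (F : I -> V -> R) (l : I -> R) (x v : V) :
  (forall a : I, is_derive x v (F a) (l a)) ->
  is_derive x v (fun y : V => \sum_(a <- s) F a y) (\sum_(a <- s) l a).
Proof.
move=> H; elim: s => [|a s IH].
  rewrite big_nil; under eq_fun do rewrite big_nil; exact: is_derive_cst.
by rewrite big_cons; under eq_fun do rewrite big_cons; exact: is_deriveD.
Qed.

Lemma is_deriveMl (V : normedModType R) (f : V -> R) (x v : V) c l :
  is_derive x v f l -> is_derive x v (fun y : V => c * f y) (c * l).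
Proof. exact: is_deriveZ. Qed.

Lemma is_C2_line phi dphi Hphi x v r : is_C2 phi dphi Hphi ->
  is_derive r 1 (fun u => phi (x + u *: v)) (\sum_i v 0 i * dphi i (x + r *: v)).
Proof. by case=> H1 H2 _ _; apply/is_derive_line; exact: is_derive_C1. Qed.

Lemma is_C2_line2 phi dphi Hphi x v : is_C2 phi dphi Hphi ->
  is_derive (0 : R) 1 (fun u => \sum_i v 0 i * dphi i (x + u *: v))
    (\sum_i \sum_j Hphi i j x * (v 0 i * v 0 j)).
Proof.
case=> _ _ H3 H4.
rewrite exchange_big /=; apply: is_derive_big => j.
rewrite (_ : \sum_i _ = v 0 j * \sum_i v 0 i * Hphi i j x).
  by apply: is_deriveMl; apply/is_derive_line0; exact: is_derive_C1.
by rewrite mulr_sumr; apply: eq_bigr => i _; ring.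
Qed.

Lemma C2_local_max phi dphi Hphi x v (rho : R) : is_C2 phi dphi Hphi -> 0 < rho ->
  (forall y, `|y - x| < rho -> phi y <= phi x) ->
  \sum_i \sum_j Hphi i j x * (v 0 i * v 0 j) <= 0.
Proof.
move=> H r0 M; have v0 := normr_ge0 v.
have rv0 : 0 < rho / (`|v| + 1) by rewrite divr_gt0//; lra.
apply: (second_derivative_test rv0 (fun r _ => is_C2_line x v r H) (is_C2_line2 x v H)).
move=> r; rewrite ltr_pdivlMr; last by lra.
rewrite scale0r addr0 => rr; apply: M; rewrite addrC addKr normrZ.
by have := normr_ge0 r; nra.
Qed.

Definition qform (Q : 'M[R]_d) x := \sum_i \sum_j Q i j * (x 0 i * x 0 j).

Lemma qform_add_delta (Q : 'M[R]_d) x k c : Q^T = Q ->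
  qform Q (x + c *: e k) = qform Q x + 2 * c * (\sum_j Q k j * x 0 j) + c ^+ 2 * Q k k.
Proof.
move=> sQ; have sym i j : Q i j = Q j i by rewrite -{1}sQ mxE.
have dE i : (x + c *: e k) 0 i = x 0 i + c * (i == k)%:R by rewrite !mxE eqxx.
have T1 (f : 'I_d -> R) : \sum_i f i * (i == k)%:R = f k.
  by rewrite (bigD1 k)//= eqxx mulr1 big1 ?addr0// => i /negbTE->; rewrite mulr0.
transitivity (qform Q x + c * (\sum_i (\sum_j Q i j * x 0 j) * (i == k)%:R)
      + c * (\sum_i x 0 i * (\sum_j Q i j * (j == k)%:R))
      + c ^+ 2 * (\sum_i (\sum_j Q i j * (j == k)%:R) * (i == k)%:R)).
  rewrite /qform !mulr_sumr -!big_split /=; apply: eq_bigr => i _.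
  rewrite !mulr_suml !mulr_sumr -!big_split /=; apply: eq_bigr => j _.
  by rewrite !dE; ring.
rewrite !T1; under [X in _ + c * X + _]eq_bigr do rewrite T1.
have -> : \sum_i x 0 i * Q i k = \sum_j Q k j * x 0 j.
  by apply: eq_bigr => i _; rewrite sym mulrC.
ring.
Qed.

Lemma qform_delta (Q : 'M[R]_d) k : Q^T = Q -> qform Q (e k) = Q k k.
Proof.
move=> sQ; have := qform_add_delta 0 k 1 sQ.
rewrite scale1r add0r => ->; rewrite [qform _ _]big1 => [|i _]; last first.
  by rewrite big1// => j _; rewrite mxE mul0r mulr0.
by rewrite [X in _ * X]big1 => [|j _]; [ring | rewrite mxE mulr0].
Qed.

(** Along [e i + a *: e k] the form is affine in [a], so a nonzero slope would make it negative
    somewhere. *)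
Lemma psd_row0 (Q : 'M[R]_d) k i : Q^T = Q -> psd Q -> Q k k = 0 -> Q k i = 0.
Proof.
move=> sQ pQ Q0; apply/eqP; apply: contraT => n0.
have F (a : R) : 0 <= 2 * a * Q k i + Q i i.
  have := pQ (e i + a *: e k); rewrite -/(qform _ _) qform_add_delta// qform_delta// Q0.
  rewrite (bigD1 i)//= big1 => [|j ji]; last by rewrite delta_coord eq_sym (negbTE ji) mulr0.
  by rewrite delta_coord eqxx mulr1; lra.
have := F (- (Q i i + 1) / (2 * Q k i)).
by rewrite (_ : 2 * _ * _ = - (Q i i + 1)); [lra|field].
Qed.

(** Completing the square in the coordinate [k]: subtracting the rank-one matrix built on row [k]
    leaves a positive semidefinite [Q'] whose support no longer contains [k]. The induction is
    therefore on a list containing the support. A zero pivot has a zero row by [psd_row0]. *)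
Lemma psd_sum_squares (s : seq 'I_d) (Q : 'M[R]_d) : Q^T = Q -> psd Q ->
  (forall i j, Q i j != 0 -> i \in s) ->
  exists l : seq E, forall i j, Q i j = \sum_(v <- l) v 0 i * v 0 j.
Proof.
elim: s Q => [|k s IH] Q sQ pQ S.
  by exists [::] => i j; rewrite big_nil; apply/eqP; apply: contraT => /S.
have sym i j : Q i j = Q j i by rewrite -{1}sQ mxE.
have [Q0|Q0] := eqVneq (Q k k) 0.
  apply: IH => // i j nz; have := S i j nz; rewrite inE => /orP[/eqP ik|//].
  by rewrite ik (psd_row0 _ sQ pQ Q0) eqxx in nz.
have Qp : 0 < Q k k.
  by rewrite lt_neqAle eq_sym Q0 /= -qform_delta//; exact: pQ.
pose Q' := \matrix_(i, j) (Q i j - Q k i * Q k j / Q k k) : 'M[R]_d.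
have [|x||l lE] := IH Q'.
- by apply/matrixP => i j; rewrite !mxE sym; ring.
- pose a := \sum_j Q k j * x 0 j.
  (* This shift along [e k] minimises the form of [Q] in that direction; the minimum is the form of
     [Q'] at [x]. *)
  have := pQ (x + (- (a / Q k k)) *: e k); rewrite -/(qform _ _) qform_add_delta// -/a.
  rewrite (_ : _ + _ = qform Q x - a ^+ 2 / Q k k); last by field.
  suff -> : \sum_i \sum_j Q' i j * (x 0 i * x 0 j) = \sum_i \sum_j Q i j * (x 0 i * x 0 j) - a ^+ 2 / Q k k by [].
  rewrite expr2 {1}/a mulr_suml mulr_suml -sumrB; apply: eq_bigr => i _.
  rewrite /a mulr_sumr mulr_suml -sumrB; apply: eq_bigr => j _.
  by rewrite mxE; field.
- move=> i j; rewrite mxE; have [ik|/negbTE ik] := eqVneq i k.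
    by rewrite ik mulrC mulKf// subrr eqxx.
  move=> nz; have [q0|q0] := eqVneq (Q i j) 0; last by have := S i j q0; rewrite inE ik.
  have [q1|q1] := eqVneq (Q i k) 0; last by have := S i k q1; rewrite inE ik.
  by rewrite q0 sym q1 !mul0r subr0 eqxx in nz.
exists ((\row_j (Q k j / Num.sqrt (Q k k))) :: l) => i j; rewrite big_cons -lE !mxE.
by rewrite mulf_div -expr2 sqr_sqrtr ?ltW//; ring.
Qed.

(** With [Q] written as a sum of squares, the contraction becomes a sum of values of the quadratic
    form of [H]. *)
Lemma mxdot_nonpos (Q : 'M[R]_d) (H : 'I_d -> 'I_d -> R) : Q^T = Q -> psd Q ->
  (forall v, \sum_i \sum_j H i j * (v 0 i * v 0 j) <= 0) ->
  \sum_i \sum_j Q i j * H i j <= 0.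
Proof.
move=> sQ pQ nH; have [|l lE] := @psd_sum_squares (enum 'I_d) Q sQ pQ.
  by move=> i j _; rewrite mem_enum.
have -> : \sum_i \sum_j Q i j * H i j = \sum_(v <- l) \sum_i \sum_j H i j * (v 0 i * v 0 j).
  rewrite [RHS]exchange_big /=; apply: eq_bigr => i _.
  rewrite [RHS]exchange_big /=; apply: eq_bigr => j _.
  by rewrite lE mulr_suml; apply: eq_bigr => v _; rewrite mulrC.
by apply: sumr_le0 => v _.
Qed.

Lemma continuous_lin (T : topologicalType) (f g : T -> R) (a b : R) (x : T) :
  {for x, continuous f} -> {for x, continuous g} ->
  {for x, continuous (fun y : T => a * f y + b * g y)}.
Proof. by move=> cf cg; exact: (cvgD (cvgM (cvg_cst a) cf) (cvgM (cvg_cst b) cg)). Qed.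

Lemma is_C2_lin (a b : R) phi dphi Hphi psi dpsi Hpsi :
  is_C2 phi dphi Hphi -> is_C2 psi dpsi Hpsi ->
  is_C2 (fun y => a * phi y + b * psi y) (fun i y => a * dphi i y + b * dpsi i y)
    (fun i j y => a * Hphi i j y + b * Hpsi i j y).
Proof.
move=> [A1 A2 A3 A4] [B1 B2 B3 B4]; split=> [i x|i x|i j x|i j x].
- by apply: is_deriveD; apply: is_deriveMl.
- by apply: continuous_lin; [apply: A2|apply: B2].
- by apply: is_deriveD; apply: is_deriveMl.
- by apply: continuous_lin; [apply: A4|apply: B4].
Qed.

Lemma is_derive_shiftr (V : normedModType R) (f : V -> R) (x v z : V) l :
  is_derive (x + z) v f l -> is_derive x v (fun y : V => f (y + z)) l.
Proof.
move=> /is_derive_epsP H; apply/is_derive_epsP => c /H[dl d0 Hd].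
by exists dl => // h /Hd; rewrite [x + z + _]addrAC.
Qed.

Lemma continuous_shiftr (V W : normedModType R) (f : V -> W) (z : V) :
  continuous f -> continuous (fun y : V => f (y + z)).
Proof.
move=> cf x; apply: (@continuous_comp _ _ _ (fun y : V => y + z) f); last exact: cf.
by apply: cvgD; [exact: cvg_id|exact: cvg_cst].
Qed.

Lemma is_C2_shift phi dphi Hphi z : is_C2 phi dphi Hphi ->
  is_C2 (fun y => phi (y + z)) (fun i y => dphi i (y + z)) (fun i j y => Hphi i j (y + z)).
Proof.
case=> [A1 A2 A3 A4]; split=> [i x|i|i j x|i j]; try exact: is_derive_shiftr;
exact: continuous_shiftr.
Qed.

Lemma is_C2_cst c : is_C2 (fun=> c : R) (fun _ (_ : E) => 0) (fun _ _ _ => 0).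
Proof. by split=> [i x|i|i j x|i j]; [exact: is_derive_cst|exact: cst_continuous|exact: is_derive_cst|exact: cst_continuous]. Qed.

Lemma is_C2_sqr x0 : is_C2 (fun y : E => \sum_k (y 0 k - x0 0 k) ^+ 2)
  (fun i y => 2 * (y 0 i - x0 0 i)) (fun i j y => 2 * (i == j)%:R).
Proof.
split.
- move=> i x; apply/is_derive_epsP => c c0; exists c => // h hc.
  suff -> : \sum_k ((x + h *: e i) 0 k - x0 0 k) ^+ 2 - \sum_k (x 0 k - x0 0 k) ^+ 2 - h * (2 * (x 0 i - x0 0 i)) = h ^+ 2.
    by rewrite normrX expr2 ler_wpM2r// ltW.
  rewrite (bigD1 i)//= [X in _ - X - _](bigD1 i)//=.
  under eq_bigr => k ki do rewrite !mxE (negbTE ki) andbF mulr0 addr0.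
  by rewrite !mxE !eqxx mulr1; ring.
- move=> i x; exact: (cvgM (cvg_cst _) (cvgB (@coord_continuous _ _ _ 0 i x) (cvg_cst _))).
- move=> i j x; apply/is_derive_epsP => c c0; exists 1 => // h _.
  rewrite !mxE eqxx eq_sym (_ : _ - _ = 0); last by case: eqP => _ /=; ring.
  by rewrite normr0 mulr_ge0// ltW.
- by move=> i j; exact: cst_continuous.
Qed.

End C2_functions.

(** * Interpolation inequalities and the maximum principle on a cylinder *)

Section maximum_principles.
Context {R : realType} {d : nat}.
Local Notation E := 'rV[R]_d.
Local Notation e i := (delta_mx 0 i : 'rV[R]_d).
Implicit Types (x y v : E) (i j k n : 'I_d) (r c t : R) (phi psi : E -> R).

(** The mean value theorem is applied in direction [e j] to the increment in [e i], then in
    direction [e i]. The outcome is an exact second derivative at a nearby point, with no remainder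
    term. *)
Lemma mixed_difference phi dphi Hphi x i j (h : R) : is_C2 phi dphi Hphi -> 0 <= h ->
  exists a b : R, [/\ 0 <= a <= h, 0 <= b <= h &
    phi (x + h *: e i + h *: e j) - phi (x + h *: e i) - (phi (x + h *: e j) - phi x)
    = h ^+ 2 * Hphi i j (x + b *: e j + a *: e i)].
Proof.
move=> [H1 _ H3 _] h0.
have D r : is_derive r 1 (fun u => phi (x + h *: e i + u *: e j) - phi (x + u *: e j))
    (dphi j (x + h *: e i + r *: e j) - dphi j (x + r *: e j)).
  by apply: is_deriveB; apply: (is_derive_line _ _ _ _ _).1; exact: H1.
have [b b0] := mvt_real h0 (fun r _ => D r).
have D' r : is_derive r 1 (fun u => dphi j (x + b *: e j + u *: e i)) (Hphi i j (x + b *: e j + r *: e i)).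
  by apply: (is_derive_line _ _ _ _ _).1; exact: H3.
have [a a0] := mvt_real h0 (fun r _ => D' r).
rewrite !scale0r !addr0 !subr0 [x + b *: e j + _]addrAC => A Bd.
exists a, b; split=> //; rewrite addrAC opprB addrA addrAC in Bd *.
rewrite expr2 -mulrA [h * Hphi _ _ _]mulrC -A mulrC -Bd; ring.
Qed.

Lemma norm_shift2 x i j (a b h : R) : 0 <= a <= h -> 0 <= b <= h ->
  `|x + b *: e j + a *: e i - x| <= 2 * h.
Proof.
move=> ah bh; rewrite -[x + _ + _]addrA [_ - x]addrC addKr; apply: (le_trans (ler_normD _ _)).
have := norm_delta_le a i; have := norm_delta_le b j; rewrite !ger0_norm; lra.
Qed.

Lemma norm_shift1 x i (a h : R) : 0 <= a <= h -> `|x + a *: e i - x| <= h.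
Proof.
by move=> ah; rewrite [_ - x]addrC addKr; apply: (le_trans (norm_delta_le _ _)); rewrite ger0_norm; lra.
Qed.

(** The mixed difference expresses the Hessian at some point within [2 * h] by four values of [phi];
    [m] pays for moving that point to [x]. *)
Lemma interpolation_hessian phi dphi Hphi x i j (h S m : R) : is_C2 phi dphi Hphi -> 0 < h ->
  (forall y, `|y - x| <= 2 * h -> `|phi y| <= S) ->
  (forall y, `|y - x| <= 2 * h -> `|Hphi i j y - Hphi i j x| <= m) ->
  `|Hphi i j x| <= 4 * S / h ^+ 2 + m.
Proof.
move=> H h0 HS Hm; have [a [b [ah bh mE]]] := mixed_difference x i j H (ltW h0).
have N (a' b' : R) : 0 <= a' <= h -> 0 <= b' <= h -> `|x + a' *: e i + b' *: e j - x| <= 2 * h.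
  by move=> *; exact: norm_shift2.
have hh : 0 <= h <= h by lra.
have h00 : 0 <= (0 : R) <= h by rewrite lexx ltW.
have s1 := HS _ (N _ _ hh hh).
have s2 := HS _ (N _ _ hh h00); have s3 := HS _ (N _ _ h00 hh); have s4 := HS _ (N _ _ h00 h00).
rewrite !scale0r !addr0 in s2 s3 s4.
have {}Hm := Hm _ (norm_shift2 x i j ah bh).
have A : `|Hphi i j (x + b *: e j + a *: e i)| <= 4 * S / h ^+ 2.
  rewrite ler_pdivlMr ?exprn_gt0// -[X in _ * X](ger0_norm (sqr_ge0 h)) -normrM mulrC -mE.
  apply: (le_trans (ler_normB _ _)).
  have := ler_normB (phi (x + h *: e i + h *: e j)) (phi (x + h *: e i)).
  have := ler_normB (phi (x + h *: e j)) (phi x); lra.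
rewrite -[Hphi i j x](subKr (Hphi i j (x + b *: e j + a *: e i))).
by apply: (le_trans (ler_normB _ _)); lra.
Qed.

Lemma interpolation_gradient phi dphi Hphi x i (h S M : R) : is_C2 phi dphi Hphi -> 0 < h ->
  (forall y, `|y - x| <= h -> `|phi y| <= S) ->
  (forall y, `|y - x| <= h -> `|Hphi i i y| <= M) ->
  `|dphi i x| <= 2 * S / h + h * M.
Proof.
move=> [H1 _ H3 _] h0 HS HM.
have D r : is_derive r 1 (fun u => phi (x + u *: e i)) (dphi i (x + r *: e i)).
  by apply: (is_derive_line _ _ _ _ _).1; exact: H1.
have [c ch] := mvt_real (ltW h0) (fun r _ => D r).
have D' r : is_derive r 1 (fun u => dphi i (x + u *: e i)) (Hphi i i (x + r *: e i)).
  by apply: (is_derive_line _ _ _ _ _).1; exact: H3.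
have c0 : 0 <= c by lra.
have [a ac] := mvt_real c0 (fun r _ => D' r).
rewrite scale0r addr0 !subr0 => A B.
have s1 := HS (x + h *: e i) (norm_shift1 x i (ltac:(lra) : 0 <= h <= h)).
have s2 := HS x ltac:(by rewrite subrr normr0 ltW).
have s3 : `|Hphi i i (x + a *: e i)| <= M by apply: HM; apply: norm_shift1; lra.
have A2 : `|dphi i (x + c *: e i)| <= 2 * S / h.
  rewrite ler_pdivlMr// -[X in _ * X](gtr0_norm h0) -normrM -B.
  by apply: (le_trans (ler_normB _ _)); lra.
rewrite -[dphi i x](subKr (dphi i (x + c *: e i))) A.
apply: (le_trans (ler_normB _ _)); rewrite normrM (ger0_norm c0).
apply: lerD => //; rewrite mulrC; apply: ler_pM => //; lra.
Qed.

(** As the norm is the maximum norm, this is a closed cube, hence a product of segments. *)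
Definition box x0 c : set E := [set x | `|x - x0| <= c].

Lemma compact_box x0 c : 0 <= c -> compact (box x0 c).
Proof.
move=> c0; rewrite (_ : box x0 c = [set v : E | forall i, `[x0 0 i - c, x0 0 i + c]%classic (v ord0 i)]).
  exact: (@rV_compact _ _ (fun i => `[x0 0 i - c, x0 0 i + c]%classic) (fun i => @segment_compact _ _ _)).
apply/seteqP; split=> x /= H.
  move=> i; rewrite in_itv/=.
  have := le_trans (coord_le_norm (x - x0) i) H; rewrite !mxE ler_norml; lra.
apply: norm_le_coord => // i; have := H i; rewrite in_itv/= !mxE ler_norml => ?; lra.
Qed.

Lemma C2_local_max_gradient phi dphi Hphi x i (rho : R) : is_C2 phi dphi Hphi -> 0 < rho ->
  (forall y, `|y - x| < rho -> phi y <= phi x) -> dphi i x = 0.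
Proof.
move=> [H1 _ _ _] r0 M.
have D r : is_derive r 1 (fun u => phi (x + u *: e i)) (dphi i (x + r *: e i)).
  by apply: (is_derive_line _ _ _ _ _).1; exact: H1.
have A : is_derive (0:R) 1 (fun u => phi (x + u *: e i)) 0.
  apply: (@derive1_at_max _ _ (- rho) rho 0).
  - lra.
  - by move=> t _; have [] := D t.
  - by rewrite in_itv/=; lra.
  - move=> t; rewrite in_itv/= scale0r addr0 => t0; apply: M.
    by rewrite addrC addKr; apply: (le_lt_trans (norm_delta_le _ _)); rewrite ltr_norml.
by rewrite -(@derive_val _ _ _ _ _ _ _ A) (@derive_val _ _ _ _ _ _ _ (D 0)) scale0r addr0.
Qed.

Definition cylinder (a b : R) x0 c : set (R * E) := `[a, b] `*` box x0 c.

Lemma cylinder_compact (a b : R) x0 c : 0 <= c -> compact (cylinder a b x0 c).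
Proof. by move=> c0; apply: compact_setX; [exact: segment_compact|exact: compact_box]. Qed.

(* w is only required to be smooth after the initial time a. *)
Lemma box_max_principle (a b : R) x0 c (w wt : R * E -> R)
    (dw : 'I_d -> R * E -> R) (Hw : 'I_d -> 'I_d -> R * E -> R)
    (q : R * E -> 'M[R]_d) (bb : R * E -> E) :
  {within cylinder a b x0 c, continuous w} ->
  (forall t, a < t <= b ->
     is_C2 (fun x => w (t, x)) (fun i x => dw i (t, x)) (fun i j x => Hw i j (t, x))) ->
  (forall t x, a < t <= b -> `|x - x0| < c -> is_derive t 1 (fun s => w (s, x)) (wt (t, x))) ->
  (forall t x, a < t <= b -> `|x - x0| < c -> (q (t, x))^T = q (t, x) /\ psd (q (t, x))) ->
  (forall x, `|x - x0| <= c -> w (a, x) <= 0) ->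
  (forall t x, a <= t <= b -> `|x - x0| = c -> w (t, x) <= 0) ->
  (forall t x, a < t <= b -> `|x - x0| < c -> 0 < w (t, x) ->
     wt (t, x) <= \sum_i \sum_j q (t, x) i j * Hw i j (t, x) + \sum_i bb (t, x) 0 i * dw i (t, x)) ->
  forall t x, a <= t <= b -> `|x - x0| <= c -> w (t, x) <= 0.
Proof.
move=> cw H2 Ht Hq W0 W1 Hw0 t x tab xc; rewrite leNgt; apply/negP => wp.
(* With this [ep] the tilt costs at most half of [w (t, x)], so the maximum of [w - ep * (t - a)]
   still sits where [w > 0], hence off the parabolic boundary. *)
pose ep := w (t, x) / (2 * (b - a + 1)).
have ep0 : 0 < ep by rewrite divr_gt0//; lra.
have epE : ep * (2 * (b - a + 1)) = w (t, x) by rewrite /ep divfK// lt0r_neq0//; lra.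
have c0 : 0 <= c by apply: le_trans xc.
have [[s y] /set_mem [/= sab yc] Hmax] : exists2 p, p \in cylinder a b x0 c &
    forall p', p' \in cylinder a b x0 c -> w p' - ep * (p'.1 - a) <= w p - ep * (p.1 - a).
  apply: compact_EVT_max; first by exists (t, x); split=> //=; rewrite in_itv.
    exact: cylinder_compact.
  move=> p; apply: cvgB; first exact: cw.
  apply: cvgM; first exact: cvg_cst.
  apply: cvgB; last exact: cvg_cst.
  by apply: continuous_subspaceT => -[? ?]; exact: cvg_fst.
rewrite in_itv/= in sab; rewrite /box/= in yc.
have wsy : 0 < w (s, y).
  have /= := Hmax (t, x) ltac:(by rewrite inE; split; rewrite /= ?in_itv).
  have : ep * (t - a) <= ep * (b - a) by rewrite ler_pM2l//; lra.
  have : 0 <= ep * (s - a) by rewrite mulr_ge0//; lra.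
  nra.
have sa : a < s <= b.
  rewrite lt_neqAle; case/andP: sab => -> ->; rewrite !andbT; apply/eqP => sE.
  by have := W0 y yc; rewrite sE; lra.
have yc' : `|y - x0| < c.
  rewrite lt_neqAle yc andbT; apply/eqP => yE.
  by have := W1 s y sab yE; lra.
(* The tilt forces a strictly positive time derivative, whereas at the maximum the gradient vanishes
   and the second-order part is nonpositive. *)
have le_wt : ep <= wt (s, y).
  have D : is_derive s 1 (fun u => w (u, y) - ep * (u - a)) (wt (s, y) - ep * (1 - 0)).
    exact: (is_deriveB (Ht s y sa yc') (is_deriveMl ep (is_deriveB (is_derive_id s 1) (is_derive_cst a s 1)))).
  have r0 : 0 < s - a by lra.
  have := left_derivative_ge0 r0 D; rewrite subr0 mulr1 subr_ge0; apply => u us.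
  by have /= := Hmax (u, y); apply; rewrite inE; split; rewrite //= in_itv/=; lra.
have LM z : `|z - y| < c - `|y - x0| -> w (s, z) <= w (s, y).
  move=> zy; have /= := Hmax (s, z); rewrite lerD2r; apply.
  rewrite inE; split; rewrite /= ?in_itv//= /box/=.
  rewrite (_ : z - x0 = (z - y) + (y - x0)); last by rewrite addrA subrK.
  by apply: (le_trans (ler_normD _ _)); lra.
have rp : 0 < c - `|y - x0| by lra.
have := Hw0 s y sa yc' wsy.
rewrite [X in _ + X]big1 => [|i _]; last first.
  by rewrite (C2_local_max_gradient i (H2 s sa) rp LM) mulr0.
have [sq pq] := Hq s y sa yc'.
have := mxdot_nonpos sq pq (fun v => C2_local_max v (H2 s sa) rp LM).
lra.
Qed.

End maximum_principles.

(** * Lipschitz bounds by doubling a space variable *)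

Section doubling.
Context {R : realType} {d : nat}.
Local Notation E := 'rV[R]_d.
Local Notation e i := (delta_mx 0 i : 'rV[R]_d).
Implicit Types (x y v : E) (i j k n : 'I_d) (r c t : R) (phi psi : E -> R).

Definition elliptic_mx (lam : R) (q : 'M[R]_d) :=
  q^T = q /\ forall v : E, lam * \sum_i v 0 i ^+ 2 <= qform q v.

Lemma elliptic_psd lam (q : 'M[R]_d) : 0 <= lam -> elliptic_mx lam q -> psd q.
Proof.
move=> l0 [_ H] v; apply: le_trans (H v); rewrite mulr_ge0// sumr_ge0// => i _.
exact: sqr_ge0.
Qed.

Lemma continuous_big_sum (T : topologicalType) (I : Type) (s : seq I)
    (F : I -> T -> R) (p : T) : (forall a, {for p, continuous (F a)}) ->
  {for p, continuous (fun y : T => \sum_(a <- s) F a y)}.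
Proof.
move=> H; rewrite /prop_for /continuous_at; elim: s => [|a s IH].
  by rewrite big_nil; under eq_fun do rewrite big_nil; exact: cst_continuous.
by rewrite big_cons; under eq_fun do rewrite big_cons; exact: (cvgD (H a) IH).
Qed.

Lemma is_derive_oppv (V : normedModType R) (f : V -> R) (x v : V) (l : R) :
  is_derive x v f l -> is_derive x (- v) f (- l).
Proof.
move=> /is_derive_epsP H; apply/is_derive_epsP => c /H[dl d0 Hd]; exists dl => // h.
by move: (Hd (- h)); rewrite normrN scaleNr scalerN mulNr mulrN.
Qed.

Lemma continuous_pair (T U V : topologicalType) (f : T -> U) (g : T -> V) (p : T) :
  {for p, continuous f} -> {for p, continuous g} ->
  {for p, continuous (fun z : T => (f z, g z))}.
Proof. by move=> cf cg; exact: (cvg_pair cf cg). Qed.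

Lemma is_C2_ext phi dphi Hphi psi dpsi Hpsi : @is_C2 R d phi dphi Hphi ->
  (forall y, phi y = psi y) -> (forall i y, dphi i y = dpsi i y) ->
  (forall i j y, Hphi i j y = Hpsi i j y) -> is_C2 psi dpsi Hpsi.
Proof.
move=> H /funext <- H1 H2; rewrite (_ : dpsi = dphi).
  rewrite (_ : Hpsi = Hphi)//.
  by apply/funext => i; apply/funext => j; apply/funext => y.
by apply/funext => i; apply/funext => y.
Qed.

Lemma is_C2_diff phi dphi Hphi x z z' c : is_C2 phi dphi Hphi ->
  is_C2 (fun y => (phi (y + z) - phi (y + z')) - c * \sum_k (y 0 k - x 0 k) ^+ 2)
    (fun i y => (dphi i (y + z) - dphi i (y + z')) - c * (2 * (y 0 i - x 0 i)))
    (fun i j y => (Hphi i j (y + z) - Hphi i j (y + z')) - c * (2 * (i == j)%:R)).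
Proof.
move=> H; have A := is_C2_lin 1 (-1) (is_C2_shift z H) (is_C2_shift z' H).
apply: (is_C2_ext (is_C2_lin 1 (- c) A (is_C2_sqr x))) => *;
by rewrite !mul1r !mulN1r mulNr.
Qed.

(* The function V(t,x,r) = w(t,x+r e_n) - w(t,x-r e_n) satisfies V_rr = V_{x_n x_n}, so the
   part lam D_nn of the operator can be moved to the variable r, where the barrier is concave. *)
Lemma doubling_estimate (a b rr B K lam L P : R) x0 n (w wt : R * E -> R)
    (dw : 'I_d -> R * E -> R) (Hw : 'I_d -> 'I_d -> R * E -> R) (q : R -> 'M[R]_d) :
  0 < rr -> 0 <= B -> 0 < lam -> a < b -> continuous w ->
  (forall t, a < t <= b ->
     is_C2 (fun x => w (t, x)) (fun i x => dw i (t, x)) (fun i j x => Hw i j (t, x))) ->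
  (forall t x, a < t <= b -> `|x - x0| < 2 * rr -> is_derive t 1 (fun s => w (s, x)) (wt (t, x))) ->
  (forall t, a < t <= b -> elliptic_mx lam (q t) /\ \tr (q t) <= L) ->
  (forall t x r, a < t <= b -> `|x - x0| < rr -> 0 < r < rr ->
     wt (t, x + r *: e n) - wt (t, x - r *: e n) <=
       \sum_i \sum_j q t i j * (Hw i j (t, x + r *: e n) - Hw i j (t, x - r *: e n)) + K) ->
  (forall t x r, a <= t <= b -> `|x - x0| <= rr -> 0 <= r <= rr ->
     w (t, x + r *: e n) - w (t, x - r *: e n) <= B) ->
  (forall x r, `|x - x0| <= rr -> 0 <= r <= rr ->
     w (a, x + r *: e n) - w (a, x - r *: e n) <= 0) \/ rr ^+ 2 <= b - a ->
  B <= P -> B + 2 * L * B + K * rr ^+ 2 < 2 * lam * P ->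
  forall r, 0 <= r <= rr -> w (b, x0 + r *: e n) - w (b, x0 - r *: e n) <= 2 * P * r / rr.
Proof.
move=> rr0 B0 lam0 ab cw H2 Ht Hq Heq HB Ha BP HP r rrr; rewrite leNgt; apply/negP => Vp.
pose S x : R := \sum_k (x 0 k - x0 0 k) ^+ 2.
have S0 x : 0 <= S x by apply: sumr_ge0 => i _; exact: sqr_ge0.
pose B' := B / rr ^+ 2; pose P' := P / rr ^+ 2.
(* On each face one term alone dominates [B]: the first for [|x - x0| = rr], the second at time [a]
   if [rr ^+ 2 <= b - a], the third for [u = rr] since [B <= P]. At [u = 0] the doubled function
   vanishes. At [t = b] and [x = x0] only the third term is left, and it is linear in [u] up to a
   negative square. *)
pose bar (t : R) x (u : R) := B' * S x + B' * (b - t) + P' * (2 * rr * u - u ^+ 2).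
pose g (p : R * E * R) := w (p.1.1, p.1.2 + p.2 *: e n) - w (p.1.1, p.1.2 - p.2 *: e n) - bar p.1.1 p.1.2 p.2.
have rr2 : 0 < rr ^+ 2 by rewrite exprn_gt0.
have Brr : B' * rr ^+ 2 = B by rewrite /B' divfK// lt0r_neq0.
have Prr : P' * rr ^+ 2 = P by rewrite /P' divfK// lt0r_neq0.
have B1 : 0 <= B' by rewrite divr_ge0// ltW.
have P1 : 0 <= P' by exact: divr_ge0 (le_trans B0 BP) (ltW rr2).
clearbody B' P'.
have cg : continuous g.
  have cS : continuous S.
    move=> x; apply: continuous_big_sum => k.
    have ck : {for x, continuous (fun y : E => y 0 k - x0 0 k)}.
      exact: (continuousB (@coord_continuous _ _ _ 0 k x) (@cst_continuous _ _ _ x)).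
    exact: (continuousM ck ck).
  move=> p.
  have c1 : {for p, continuous (fun p : R * E * R => p.1.1)} by apply: cvg_comp; [exact: cvg_fst|exact: cvg_fst].
  have c2 : {for p, continuous (fun p : R * E * R => p.1.2)} by apply: cvg_comp; [exact: cvg_fst|exact: cvg_snd].
  have c3 : {for p, continuous (fun p : R * E * R => p.2)} by exact: cvg_snd.
  have c4 : {for p, continuous (fun p : R * E * R => p.2 *: e n)} by exact: (continuousZr_tmp c3).
  have cc (c : R) : {for p, continuous (fun=> c : R)} by exact: cst_continuous.
  have d1 : {for p, continuous (fun p : R * E * R => w (p.1.1, p.1.2 + p.2 *: e n))}.
    exact: (continuous_comp (continuous_pair c1 (continuousD c2 c4)) (cw _)).
  have d2 : {for p, continuous (fun p : R * E * R => w (p.1.1, p.1.2 - p.2 *: e n))}.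
    exact: (continuous_comp (continuous_pair c1 (continuousB c2 c4)) (cw _)).
  have d3 : {for p, continuous (fun p : R * E * R => S p.1.2)} by exact: (continuous_comp c2 (cS _)).
  exact: (continuousB (continuousB d1 d2) (continuousD (continuousD (continuousM (cc B') d3)
    (continuousM (cc B') (continuousB (cc b) c1)))
    (continuousM (cc P') (continuousB (continuousM (cc (2 * rr)) c3) (continuousM c3 c3))))).
pose KK : set (R * E * R) := cylinder a b x0 rr `*` `[0, rr]%classic.
have Kin t x (u : R) : a <= t <= b -> `|x - x0| <= rr -> 0 <= u <= rr -> (t, x, u) \in KK.
  by move=> ? ? ?; rewrite inE; split; [split|]; rewrite /= ?in_itv.
have [[[t y] u] /set_mem [[/= tab yr] ur] Hmax] : exists2 p : R * E * R, p \in KK & forall p' : R * E * R, p' \in KK -> g p' <= g p.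
  apply: compact_EVT_max.
  - exists (b, x0, 0); apply/set_mem; apply: Kin; rewrite ?subrr ?normr0 ?lexx ?ltW//.
  - by apply: compact_setX; [apply: cylinder_compact; exact: ltW|exact: segment_compact].
  - exact: continuous_subspaceT.
rewrite !in_itv/= in tab ur; rewrite /box/= in yr.
have gp : 0 < g (t, y, u).
  apply: lt_le_trans (Hmax (b, x0, r) _); last by apply: Kin => //; [rewrite lexx ltW|rewrite subrr normr0 ltW].
  rewrite /g /bar /= subrr mulr0 addr0.
  rewrite (_ : S x0 = 0); last by rewrite /S big1// => i _; rewrite subrr expr0n.
  have E1 : 2 * P * r / rr = P' * (2 * rr * r) by rewrite -Prr; field; rewrite lt0r_neq0.
  have : 0 <= P' * r ^+ 2 by rewrite mulr_ge0// sqr_ge0.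
  by move: Vp; rewrite E1; lra.
have VB := HB t y u tab yr ur.
have P'u : 0 <= P' * (2 * rr * u - u ^+ 2) by rewrite mulr_ge0//; nra.
have B't : 0 <= B' * (b - t) by rewrite mulr_ge0//; lra.
have B'S : 0 <= B' * S y by rewrite mulr_ge0.
rewrite /g /bar /= in gp.
have u0 : 0 < u.
  rewrite lt_neqAle; case/andP: ur => -> _; rewrite andbT; apply/eqP => uE.
  by move: gp P'u; rewrite -uE scale0r addr0 subr0 subrr => ? ?; lra.
have ulr : u < rr.
  rewrite lt_neqAle; case/andP: ur => _ ->; rewrite andbT; apply/eqP => uE.
  have : P' * (2 * rr * u - u ^+ 2) = P by rewrite uE -Prr; ring.
  by move=> ?; lra.
have yr' : `|y - x0| < rr.
  rewrite lt_neqAle yr andbT; apply/eqP => yE.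
  have : rr ^+ 2 <= S y.
    rewrite leNgt; apply/negP => Sr.
    have: `|y - x0| < rr.
      have: exists2 c, 0 <= c < rr & forall i, `|(y - x0) 0 i| <= c.
        exists (Num.sqrt (S y)); first by rewrite sqrtr_ge0 /= -[ltRHS](ger0_norm (ltW rr0)) -sqrtr_sqr ltr_sqrt.
        move=> i; rewrite -sqrtr_sqr ler_sqrt// /S (bigD1 i)//= !mxE lerDl sumr_ge0// => j _.
        exact: sqr_ge0.
      by move=> [c /andP[c0 cr] Hc]; apply: le_lt_trans cr; exact: norm_le_coord.
    by rewrite yE ltxx.
  move=> rS; have : B' * rr ^+ 2 <= B' * S y by rewrite ler_wpM2l.
  by lra.
have ta : a < t <= b.
  rewrite lt_neqAle; case/andP: tab => -> ->; rewrite !andbT; apply/eqP => tE.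
  case: Ha => [Ha|Ha]; first by have := Ha y u yr ur; rewrite tE; lra.
  have : B' * rr ^+ 2 <= B' * (b - t) by rewrite -tE ler_wpM2l.
  by lra.
have nyu (s : R) : `|s| < rr -> `|y + s *: e n - x0| < 2 * rr.
  move=> sr; rewrite addrAC; apply: (le_lt_trans (ler_normD _ _)).
  by move: (norm_delta_le s n) sr yr; clear; lra.
have le_wt : - B' <= wt (t, y + u *: e n) - wt (t, y - u *: e n).
  have nu1 : `|u| < rr by rewrite gtr0_norm.
  have nu2 : `|- u| < rr by rewrite normrN gtr0_norm.
  have := Ht t _ ta (nyu _ nu1); have := Ht t _ ta (nyu _ nu2); rewrite scaleNr => D2 D1.
  have D := is_deriveB (is_deriveB D1 D2) (is_deriveMl B' (is_deriveB (is_derive_cst b t 1) (is_derive_id t 1))).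
  have t0 : 0 < t - a by move: ta; clear; lra.
  have := left_derivative_ge0 t0 D; rewrite sub0r mulrN1 opprK => LD.
  rewrite -subr_ge0 opprK; apply: LD => s ss.
  have sab : a <= s <= b by move: ss ta; clear; lra.
  change (w (s, y + u *: e n) - w (s, y - u *: e n) - B' * (b - s) <=
          w (t, y + u *: e n) - w (t, y - u *: e n) - B' * (b - t)).
  by move: (Hmax (s, y, u) (Kin _ _ _ sab yr ur)); rewrite /g /bar /=; clear; lra.
pose HD i j : R := Hw i j (t, y + u *: e n) - Hw i j (t, y - u *: e n).
(* In [u] the doubled function has second derivative [HD n n] and the barrier [- 2 * P']. *)
have radial : HD n n + 2 * P' <= 0.
  pose f (s : R) := w (t, y + u *: e n + s *: e n) - w (t, y - u *: e n + s *: (- e n)) - P' * (2 * rr * (u + s) - (u + s) ^+ 2).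
  pose f1 (s : R) := (dw n (t, y + u *: e n + s *: e n) + dw n (t, y - u *: e n + s *: (- e n))) - P' * (2 * rr - 2 * (u + s)).
  have [A1 A2 A3 A4] := H2 t ta.
  have N1 z m (s : R) : is_derive s 1 (fun s => w (t, z + s *: (- e m))) (- dw m (t, z + s *: (- e m))).
    by apply: (is_derive_line (fun x => w (t, x)) _ _ _ _).1; apply: is_derive_oppv; exact: A1.
  have N2 z m i (s : R) : is_derive s 1 (fun s => dw i (t, z + s *: (- e m))) (- Hw m i (t, z + s *: (- e m))).
    by apply: (is_derive_line (fun x => dw i (t, x)) _ _ _ _).1; apply: is_derive_oppv; exact: A3.
  have Dq (s : R) : is_derive s 1 (fun s => P' * (2 * rr * (u + s) - (u + s) ^+ 2)) (P' * (2 * rr - 2 * (u + s))).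
    apply: is_deriveMl; apply/is_derive_epsP => c c0; exists c => // h hc.
    rewrite /GRing.scale/= mulr1 (_ : _ - _ = - h ^+ 2); last by ring.
    by rewrite normrN normrX expr2 ler_wpM2r// ltW.
  have [rho rho0 rhoP] : exists2 rho : R, 0 < rho & forall s : R, `|s| < rho -> 0 <= u + s <= rr.
    exists (Num.min u (rr - u)); first by rewrite lt_min u0 subr_gt0.
    by move=> s; rewrite lt_min !ltr_norml; clear; lra.
  have T1 (s : R) : `|s| < rho -> is_derive s 1 f (f1 s).
    move=> _; have D1 : is_derive s 1 (fun s => w (t, y + u *: e n + s *: e n)) (dw n (t, y + u *: e n + s *: e n)).
      by apply: (is_derive_line (fun x => w (t, x)) _ _ _ _).1; exact: A1.
    have := is_deriveB (is_deriveB D1 (N1 (y - u *: e n) n s)) (Dq s).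
    by rewrite opprK; exact.
  have T2 : is_derive (0:R) 1 f1 (HD n n - P' * (- 2)).
    have D1 : is_derive (0:R) 1 (fun s => dw n (t, y + u *: e n + s *: e n)) (Hw n n (t, y + u *: e n)).
      by apply: (is_derive_line0 (fun x => dw n (t, x)) _ _ _).1; exact: A3.
    have D2 := N2 (y - u *: e n) n n 0; rewrite scale0r addr0 in D2.
    have D3 : is_derive (0:R) 1 (fun s => P' * (2 * rr - 2 * (u + s))) (P' * (- 2)).
      apply: is_deriveMl; apply/is_derive_epsP => c c0; exists 1 => // h _.
      rewrite /GRing.scale/= mulr1 (_ : _ - _ = 0); last by ring.
      by rewrite normr0 mulr_ge0// ltW.
    exact: (is_deriveB (is_deriveD D1 D2) D3).
  have T3 (s : R) : `|s| < rho -> f s <= f 0.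
    move=> sr; move: (Hmax (t, y, u + s) (Kin _ _ _ tab yr (rhoP s sr))).
    by rewrite /g /bar /f /= !scale0r !addr0 !scalerN scalerDl opprD !addrA; clear; lra.
  by move: (second_derivative_test rho0 T1 T2 T3); clear; lra.
(* What is left of [q t] is still positive semidefinite, by ellipticity. It is tested against the
   Hessian in [x], where the barrier costs [2 * B'] times the trace. *)
pose q' := q t - lam *: delta_mx n n.
have [[sq eq_q] trq] := Hq t ta.
have sq' : q'^T = q'.
  by rewrite /q' linearB linearZ /= sq trmx_delta.
have qE (f : 'I_d -> 'I_d -> R) : \sum_i \sum_j q t i j * f i j = \sum_i \sum_j q' i j * f i j + lam * f n n.
  have -> : lam * f n n = \sum_i \sum_j (lam *: delta_mx n n : 'M[R]_d) i j * f i j.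
    rewrite (bigD1 n)//= (bigD1 n)//= !mxE !eqxx mulr1 !big1 ?addr0//.
      by move=> i ni; rewrite big1// => j _; rewrite !mxE (negbTE ni) mulr0 mul0r.
    by move=> i ni; rewrite !mxE (negbTE ni) andbF mulr0 mul0r.
  rewrite -big_split; apply: eq_bigr => i _; rewrite -big_split; apply: eq_bigr => j _ /=.
  by rewrite -mulrDl /q' !mxE subrK.
have pq' : psd q'.
  move=> v; have := eq_q v; rewrite /qform (qE (fun i j => v 0 i * v 0 j)).
  rewrite (bigD1 n)//= mulrDr -expr2.
  have : 0 <= lam * \sum_(i < d | i != n) v 0 i ^+ 2.
    by rewrite mulr_ge0 ?(ltW lam0)// sumr_ge0// => i _; exact: sqr_ge0.
  by clear; lra.
have trq' : \sum_i \sum_j q' i j * (B' * (2 * (i == j)%:R)) <= 2 * L * B'.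
  have -> : \sum_i \sum_j q' i j * (B' * (2 * (i == j)%:R)) = 2 * B' * \tr q'.
    rewrite /mxtrace mulr_sumr; apply: eq_bigr => i _; rewrite (bigD1 i)//= eqxx big1 ?addr0.
      by rewrite mulr1; ring.
    by move=> j ji; rewrite eq_sym (negbTE ji) !mulr0.
  have -> : \tr q' = \tr (q t) - lam.
    rewrite /q' raddfB /= mxtraceZ; congr (_ - _); rewrite /mxtrace (bigD1 n)//= mxE !eqxx big1 ?addr0 ?mulr1// => i ni.
    by rewrite mxE (negbTE ni).
  by move: trq lam0 B1; clear; nra.
have rp : 0 < rr - `|y - x0| by rewrite subr_gt0.
pose F z := w (t, z + u *: e n) - w (t, z - u *: e n) - B' * \sum_k (z 0 k - x0 0 k) ^+ 2.
have LM z : `|z - y| < rr - `|y - x0| -> F z <= F y.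
  move=> zy; have zr : `|z - x0| <= rr.
    rewrite (_ : z - x0 = (z - y) + (y - x0)); last by rewrite addrA subrK.
    by apply: (le_trans (ler_normD _ _)); move: zy; clear; lra.
  move: (Hmax (t, z, u) (Kin _ _ _ tab zr ur)).
  by rewrite /g /bar /F /= -/(S z) -/(S y); clear; lra.
have HF := is_C2_diff x0 (u *: e n) (- (u *: e n)) B' (H2 t ta).
move: (mxdot_nonpos sq' pq' (fun v => C2_local_max v HF rp LM)).
under eq_bigr do (under eq_bigr do rewrite mulrBr; rewrite sumrB).
rewrite sumrB => trH.
have {}trH : \sum_i \sum_j q' i j * HD i j - \sum_i \sum_j q' i j * (B' * (2 * (i == j)%:R)) <= 0 := trH.
have := Heq t y u ta yr'; rewrite u0 ulr => /(_ isT); rewrite -/HD (qE HD) => He.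
have lHD : lam * (HD n n) <= lam * (- (2 * P')) by rewrite ler_pM2l//; move: radial; clear; lra.
(* Multiplied by [rr ^+ 2], this contradicts the strict inequality assumed for [P]. *)
have FF : - B' <= 2 * L * B' - 2 * lam * P' + K by move: le_wt He trH trq' lHD; clear; lra.
have : (- B') * rr ^+ 2 <= (2 * L * B' - 2 * lam * P' + K) * rr ^+ 2 by rewrite ler_wpM2r// ltW.
rewrite (_ : (_ + _) * _ = 2 * L * (B' * rr ^+ 2) - 2 * lam * (P' * rr ^+ 2) + K * rr ^+ 2); last by ring.
by rewrite mulNr Brr Prr; move: HP; clear; lra.
Qed.

End doubling.

(** * Oscillation of the equation with frozen leading coefficients *)

Section frozen_coefficients.
Context {R : realType} {d : nat}.
Local Notation E := 'rV[R]_d.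
Local Notation e i := (delta_mx 0 i : 'rV[R]_d).
Implicit Types (x y z v : E) (i j k n : 'I_d) (r c t : R) (phi psi : E -> R).

Lemma powR_le (al a b : R) : 0 <= al -> 0 <= a -> a <= b -> a `^ al <= b `^ al.
Proof. by move=> al0 a0 ab; apply: ge0_ler_powR; rewrite ?nnegrE//; apply: le_trans ab. Qed.

Lemma powR_small (al ep : R) : 0 < al -> 0 < ep -> exists2 h : R, 0 < h & h `^ al <= ep.
Proof.
move=> a0 e0; exists (ep `^ (al^-1)); first by rewrite powR_gt0.
by rewrite -powRrM mulVf ?gt_eqF// powRr1// ltW.
Qed.

(** For [N = m ^ (1 / (1 - al))] one has [N = N ^ al * m], and [m] is taken above [c ^ al / ep].
    This is how [al < 1] makes a large doubling radius profitable. *)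
Lemma powR_sublinear (al c ep : R) : 0 < al < 1 -> 0 < c -> 0 < ep ->
  exists2 N : R, 1 <= N & (c * N) `^ al <= ep * N.
Proof.
move=> /andP[a0 a1] c0 e0.
pose m := Num.max 1 (c `^ al / ep).
have m1 : 1 <= m by rewrite le_max lexx.
have m0 : 0 < m by apply: lt_le_trans m1.
have b0 : 0 < 1 - al by rewrite subr_gt0.
exists (m `^ ((1 - al)^-1)).
  have i0 : 0 <= (1 - al)^-1 by rewrite invr_ge0 ltW.
  by have := powR_le i0 ler01 m1; rewrite powR1.
set N := m `^ _; have N0 : 0 < N by rewrite powR_gt0.
have E1 : N `^ (1 - al) = m by rewrite -powRrM mulVf ?gt_eqF// powRr1// ltW.
have E2 : N = N `^ al * m.
  rewrite -[m in RHS]E1 -powRD ?(gt_eqF N0) ?implybT//.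
  by rewrite addrC subrK powRr1// ltW.
rewrite powRM ?(ltW c0) ?(ltW N0)// [N in X in _ <= X]E2 mulrCA mulrC ler_wpM2l ?powR_ge0//.
by rewrite -ler_pdivrMl// mulrC le_max lexx orbT.
Qed.

Lemma sum_le_const (F : 'I_d -> R) (c : R) : (forall i, `|F i| <= c) -> `|\sum_i F i| <= d%:R * c.
Proof.
move=> H; apply: (le_trans (ler_norm_sum _ _ _)).
rewrite -[X in _ <= X%:R * _](card_ord d) -sum1_card natr_sum mulr_suml.
by apply: ler_sum => i _; rewrite mul1r.
Qed.

Lemma box_convex x y x0 c r : `|x - x0| <= c -> `|y - x0| <= c -> 0 <= r <= 1 ->
  `|x + r *: (y - x) - x0| <= c.
Proof.
move=> xc yc /andP[r0 r1].
rewrite (_ : _ - x0 = (1 - r) *: (x - x0) + r *: (y - x0)); last first.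
  by apply/rowP => i; rewrite !mxE; ring.
apply: (le_trans (ler_normD _ _)); rewrite !normrZ (ger0_norm r0) ger0_norm; last by rewrite subr_ge0.
have : (1 - r) * `|x - x0| <= (1 - r) * c by rewrite ler_wpM2l// subr_ge0.
have : r * `|y - x0| <= r * c by rewrite ler_wpM2l.
lra.
Qed.

Lemma lipschitz_of_gradient phi (dphi : 'I_d -> E -> R) x0 c (M : R) x y :
  (forall i z, is_derive z (e i) phi (dphi i z)) -> (forall i, continuous (dphi i)) ->
  (forall i z, `|z - x0| <= c -> `|dphi i z| <= M) ->
  `|x - x0| <= c -> `|y - x0| <= c -> `|phi y - phi x| <= d%:R * `|y - x| * M.
Proof.
move=> H C HM xc yc.
have D r : is_derive r 1 (fun u => phi (x + u *: (y - x))) (\sum_i (y - x) 0 i * dphi i (x + r *: (y - x))).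
  by apply: (is_derive_line _ _ _ _ _).1; exact: is_derive_C1.
have [r r01] := mvt_real ler01 (fun r _ => D r).
rewrite scale0r scale1r addr0 [x + (y - x)]addrC subrK subr0 mulr1 => ->.
rewrite -mulrA; apply: sum_le_const => i; rewrite normrM ler_pM//; first exact: coord_le_norm.
by apply: HM; exact: box_convex.
Qed.

(** Of the two terms [d ^+ 2 * La], one comes from the variation of [q], the other from [b] times an
    increment of the gradient. The term [d * La] comes from the variation of [b], and [d] from the
    damping term. *)
Definition frozen_const (La : R) := 2 * d%:R ^+ 2 * La + d%:R * La + d%:R.

(** [F] is the right-hand side of the equation less its second-order part frozen at [x0]. Lipschitz
    increments of order [rho] fit under [rho ^ al] because [rho <= 1]. *)
Lemma frozen_rhs_oscillation phi dphi Hphi (q : E -> 'M[R]_d) (b : E -> E) (g : E -> R)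
    x0 (al rho La M1 M2 G : R) : is_C2 phi dphi Hphi ->
  0 < al <= 1 -> 0 <= rho <= 1 -> 0 <= La -> 0 <= M1 -> 0 <= M2 ->
  (forall y, `|y - x0| <= rho -> [/\ forall i j, `|q y i j - q x0 i j| <= La * rho `^ al,
      forall i, `|b y 0 i - b x0 0 i| <= La * rho `^ al, forall i, `|b y 0 i| <= La &
      `|g y - g x0| <= G * rho `^ al]) ->
  (forall y, `|y - x0| <= rho -> (forall i, `|dphi i y| <= M1) /\ forall i j, `|Hphi i j y| <= M2) ->
  let F y := (\sum_i \sum_j q y i j * Hphi i j y + \sum_i b y 0 i * dphi i y) - phi y + g y
    - \sum_i \sum_j q x0 i j * Hphi i j y in
  forall y, `|y - x0| <= rho -> `|F y - F x0| <= rho `^ al * (frozen_const La * (M1 + M2) + G).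
Proof.
move=> [H1 H2 H3 H4] /andP[a0 a1] /andP[r0 r1] L0 M10 M20 Hq HM F y yr.
have x0r : `|x0 - x0| <= rho by rewrite subrr normr0.
have [q1 b1 b2 g1] := Hq y yr; have [d1 h1] := HM y yr; have [_ _ b3 _] := Hq x0 x0r.
set p := rho `^ al in q1 b1 g1 *.
have p0 : 0 <= p by exact: powR_ge0.
have rp : rho <= p.
  have [->|rn] := eqVneq rho 0; first exact: powR_ge0.
  by apply: ger1_powR => //; rewrite lt_neqAle eq_sym rn r0.
have FE : F y - F x0 = \sum_i \sum_j (q y i j - q x0 i j) * Hphi i j y
   + \sum_i ((b y 0 i - b x0 0 i) * dphi i y + b x0 0 i * (dphi i y - dphi i x0))
   - (phi y - phi x0) + (g y - g x0).
  have -> : \sum_i \sum_j (q y i j - q x0 i j) * Hphi i j y =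
    \sum_i \sum_j q y i j * Hphi i j y - \sum_i \sum_j q x0 i j * Hphi i j y.
    rewrite -sumrB; apply: eq_bigr => i _; rewrite -sumrB; apply: eq_bigr => j _.
    by rewrite mulrBl.
  have -> : \sum_i ((b y 0 i - b x0 0 i) * dphi i y + b x0 0 i * (dphi i y - dphi i x0)) =
    \sum_i b y 0 i * dphi i y - \sum_i b x0 0 i * dphi i x0.
    by rewrite -sumrB; apply: eq_bigr => i _; ring.
  by rewrite /F; ring.
have n1 : `|\sum_i \sum_j (q y i j - q x0 i j) * Hphi i j y| <= d%:R * (d%:R * (La * p * M2)).
  apply: sum_le_const => i; apply: sum_le_const => j; rewrite normrM; exact: ler_pM.
have n2 : `|\sum_i ((b y 0 i - b x0 0 i) * dphi i y + b x0 0 i * (dphi i y - dphi i x0))|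
    <= d%:R * (La * p * M1 + La * (d%:R * p * M2)).
  apply: sum_le_const => i; apply: (le_trans (ler_normD _ _)); rewrite !normrM lerD ?ler_pM//.
  have := @lipschitz_of_gradient (dphi i) (fun j => Hphi j i) x0 rho M2 x0 y
    (fun j z => H3 j i z) (fun j => H4 j i) (fun j z zr => (HM z zr).2 j i) x0r yr.
  move=> /le_trans; apply; rewrite ler_wpM2r// ler_wpM2l//.
  exact: le_trans yr rp.
have n3 : `|phi y - phi x0| <= d%:R * p * M1.
  have := lipschitz_of_gradient H1 H2 (fun i z zr => (HM z zr).1 i) x0r yr.
  move=> /le_trans; apply; rewrite ler_wpM2r// ler_wpM2l//.
  exact: le_trans yr rp.
rewrite FE; apply: (le_trans (ler_normD _ _)).
apply: (@le_trans _ _ (d%:R * (d%:R * (La * p * M2)) + d%:R * (La * p * M1 + La * (d%:R * p * M2)) + d%:R * p * M1 + G * p)).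
  apply: lerD => //; apply: (le_trans (ler_normB _ _)); apply: lerD => //.
  by apply: (le_trans (ler_normD _ _)); apply: lerD.
rewrite -subr_ge0 /frozen_const.
have dn : 0 <= d%:R :> R by exact: ler0n.
suff : 0 <= p * (d%:R ^+ 2 * La * M1 * 2 + d%:R * La * M2 + d%:R * M2) by lra.
by rewrite mulr_ge0// !addr_ge0// !mulr_ge0// ?exprn_ge0.
Qed.

End frozen_coefficients.

(** * Parabolic cylinders and second-order differences *)

Section local_estimate.
Context {R : realType} {d : nat}.
Local Notation E := 'rV[R]_d.
Local Notation e i := (delta_mx 0 i : 'rV[R]_d).
Implicit Types (x y z : E) (i j k n : 'I_d) (r c t h : R) (U : set (R * E)).
Implicit Types (f g v : R * E -> R) (dv : 'I_d -> R * E -> R)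
  (Hv : 'I_d -> 'I_d -> R * E -> R) (q : R * E -> 'M[R]_d) (b : R * E -> E).

(* dv i and Hv i j stand for the first and second space derivatives of v. *)
Definition C2_slices v dv Hv := forall t,
  is_C2 (fun x => v (t, x)) (fun i x => dv i (t, x)) (fun i j x => Hv i j (t, x)).

Definition op q b dv Hv (p : R * E) :=
  \sum_i \sum_j q p i j * Hv i j p + \sum_i b p 0 i * dv i p.

Definition bounded_on U c f := forall p, U p -> `|f p| <= c.

Definition holder_on U al c f := forall t x y, U (t, x) -> U (t, y) ->
  `|f (t, x) - f (t, y)| <= c * `|x - y| `^ al.

(* The damping term - v makes sup |g| a bound for v uniformly in time; a factor exp t removes it. *)
Definition solves_on U q b g v dv Hv := forall t x, U (t, x) ->
  is_derive t 1 (fun s => v (s, x)) (op q b dv Hv (t, x) - v (t, x) + g (t, x)).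

Definition coefs_on U al lam La q b :=
  [/\ forall p, U p -> elliptic_mx lam (q p),
      forall i j, bounded_on U La (fun p => q p i j) /\ holder_on U al La (fun p => q p i j)
    & forall i, bounded_on U La (fun p => b p 0 i) /\ holder_on U al La (fun p => b p 0 i)].

(** A backward parabolic cylinder, cut at the initial time since the equation is only known
    afterwards. *)
Definition cyl t0 x0 c : set (R * E) :=
  [set p | [/\ 0 < p.1, t0 - c ^+ 2 <= p.1 <= t0 & `|p.2 - x0| <= c]].

Lemma is_C2_opp (phi : E -> R) dphi Hphi : is_C2 phi dphi Hphi ->
  is_C2 (fun x => - phi x) (fun i x => - dphi i x) (fun i j x => - Hphi i j x).
Proof. by move=> H; apply: (is_C2_ext (is_C2_lin (-1) 0 H H)) => *; ring. Qed.

Lemma doubling_estimate_abs (a0 b0 rr B K lam L P : R) x0 n (w wt : R * E -> R) dw Hw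
    (q : R -> 'M[R]_d) :
  0 < rr -> 0 <= B -> 0 < lam -> a0 < b0 -> continuous w -> C2_slices w dw Hw ->
  (forall t x, a0 < t <= b0 -> `|x - x0| < 2 * rr -> is_derive t 1 (fun s => w (s, x)) (wt (t, x))) ->
  (forall t, a0 < t <= b0 -> elliptic_mx lam (q t) /\ \tr (q t) <= L) ->
  (forall t x r, a0 < t <= b0 -> `|x - x0| < rr -> 0 < r < rr ->
     `|wt (t, x + r *: e n) - wt (t, x - r *: e n) -
       \sum_i \sum_j q t i j * (Hw i j (t, x + r *: e n) - Hw i j (t, x - r *: e n))| <= K) ->
  (forall t x r, a0 <= t <= b0 -> `|x - x0| <= rr -> 0 <= r <= rr ->
     `|w (t, x + r *: e n) - w (t, x - r *: e n)| <= B) ->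
  (forall x, w (a0, x) = 0) \/ rr ^+ 2 <= b0 - a0 ->
  B <= P -> B + 2 * L * B + K * rr ^+ 2 < 2 * lam * P ->
  forall r, 0 <= r <= rr -> `|w (b0, x0 + r *: e n) - w (b0, x0 - r *: e n)| <= 2 * P * r / rr.
Proof.
move=> rr0 B0 lam0 ab cw H2 Ht Hq Heq HB Ha BP HP r rrr.
rewrite ler_norml lerNl opprB; apply/andP; split.
- pose w' p := - w p; pose wt' p := - wt p.
  have -> : w (b0, x0 - r *: e n) - w (b0, x0 + r *: e n) = w' (b0, x0 + r *: e n) - w' (b0, x0 - r *: e n).
    by rewrite /w' opprK addrC.
  apply: (@doubling_estimate R d a0 b0 rr B K lam L P x0 n w' wt' (fun i p => - dw i p)
    (fun i j p => - Hw i j p) q) => //.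
  + by move=> p; apply: cvgN; exact: cw.
  + by move=> t _; exact: is_C2_opp.
  + by move=> t x tb xr; exact: is_deriveN (Ht t x tb xr).
  + move=> t x u tb xr ur; have := Heq t x u tb xr ur; rewrite ler_norml => /andP[+ _].
    rewrite /wt'; under [X in _ <= X + K]eq_bigr do
      (under eq_bigr do rewrite -opprD mulrN; rewrite sumrN).
    by rewrite sumrN; clear; lra.
  + by move=> t x u tb xr ur; have := HB t x u tb xr ur; rewrite ler_norml /w' => /andP[+ _]; clear; lra.
  + by case: Ha => [Ha|Ha]; [left=> x u _ _; rewrite /w' !Ha subrr|right].
- apply: (@doubling_estimate R d a0 b0 rr B K lam L P x0 n w wt dw Hw q) => //.
  + move=> t x u tb xr ur; have := Heq t x u tb xr ur; rewrite ler_norml => /andP[_].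
    by clear; lra.
  + by move=> t x u tb xr ur; have := HB t x u tb xr ur; rewrite ler_norml => /andP[].
  + by case: Ha => [Ha|Ha]; [left=> x u _ _; rewrite !Ha subrr|right].
Qed.

(** The difference is left undivided and the factor [h ^+ 2] is carried along. It commutes with an
    operator whose coefficients depend on [t] only, which is why freezing in space suffices. *)
Definition ddiff i j h f (p : R * E) :=
  f (p.1, p.2 + h *: e i + h *: e j) - f (p.1, p.2 + h *: e i)
  - (f (p.1, p.2 + h *: e j) - f (p.1, p.2)).

Lemma ddiff_C2 i j h v dv Hv : C2_slices v dv Hv ->
  C2_slices (ddiff i j h v) (fun k => ddiff i j h (dv k)) (fun k l => ddiff i j h (Hv k l)).
Proof.
move=> H t; have Ht := H t.
apply: (is_C2_ext (is_C2_lin 1 (-1) (is_C2_lin 1 (-1) (is_C2_shift (h *: e i + h *: e j) Ht)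
  (is_C2_shift (h *: e i) Ht)) (is_C2_lin 1 (-1) (is_C2_shift (h *: e j) Ht) Ht))) => *;
by rewrite /ddiff /= !mul1r !mulN1r addrA.
Qed.

Lemma continuous_shift_snd f z : continuous f -> continuous (fun p : R * E => f (p.1, p.2 + z)).
Proof.
move=> cf p; have c1 : {for p, continuous (fun p : R * E => p.1)} by exact: cvg_fst.
have c2 : {for p, continuous (fun p : R * E => p.2)} by exact: cvg_snd.
have c3 : {for p, continuous (fun=> z : E)} by exact: cst_continuous.
exact: (continuous_comp (continuous_pair c1 (continuousD c2 c3)) (cf _)).
Qed.

Lemma continuous_slice f t x : {for (t, x), continuous f} -> {for x, continuous (fun y => f (t, y))}.
Proof.
move=> cf; have c1 : {for x, continuous (fun=> t : R)} by exact: cst_continuous.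
have c2 : {for x, continuous (fun y : E => y)} by exact: cvg_id.
exact: (continuous_comp (continuous_pair c1 c2) cf).
Qed.

Lemma ddiff_continuous i j h f : continuous f -> continuous (ddiff i j h f).
Proof.
move=> cf p; have C z := @continuous_shift_snd f z cf p.
rewrite (_ : ddiff i j h f = fun p => f (p.1, p.2 + (h *: e i + h *: e j)) - f (p.1, p.2 + h *: e i)
  - (f (p.1, p.2 + h *: e j) - f (p.1, p.2 + 0))).
  exact: (continuousB (continuousB (C _) (C _)) (continuousB (C _) (C _))).
by apply/funext => s; rewrite addr0 addrA.
Qed.

Lemma ddiff_derive i j h f f' t x :
  (forall y, `|y - x| <= 2 * `|h| -> is_derive t 1 (fun s => f (s, y)) (f' (t, y))) ->
  is_derive t 1 (fun s => ddiff i j h f (s, x)) (ddiff i j h f' (t, x)).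
Proof.
move=> H.
have N1 k : `|h *: e k| <= `|h| by exact: norm_delta_le.
have n0 : `|x - x| <= 2 * `|h| by rewrite subrr normr0 mulr_ge0.
have n1 k : `|x + h *: e k - x| <= 2 * `|h|.
  by rewrite [_ - x]addrC addKr; have := N1 k; have := normr_ge0 h; lra.
have n2 : `|x + h *: e i + h *: e j - x| <= 2 * `|h|.
  rewrite -[x + _ + _]addrA [_ - x]addrC addKr.
  by apply: (le_trans (ler_normD _ _)); have := N1 i; have := N1 j; lra.
exact: (is_deriveB (is_deriveB (H _ n2) (H _ (n1 i))) (is_deriveB (H _ (n1 j)) (H _ n0))).
Qed.

Lemma ddiff_mixed i j h v dv Hv t x : C2_slices v dv Hv -> 0 <= h ->
  exists2 y, `|y - x| <= 2 * h & ddiff i j h v (t, x) = h ^+ 2 * Hv i j (t, y).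
Proof.
move=> H h0; have [a [c [ah ch mE]]] := mixed_difference x i j (H t) h0.
by exists (x + c *: e j + a *: e i); [exact: norm_shift2|rewrite /ddiff /= mE].
Qed.

End local_estimate.

(* Proves 0 <= e by following the syntax of e. *)
Ltac pos := repeat match goal with
  | H : is_true (@Order.le _ _ _ ?x) |- is_true (@Order.le _ _ _ ?x) => exact H
  | H : is_true (@Order.lt _ _ _ ?x) |- is_true (@Order.le _ _ _ ?x) => exact (ltW H)
  | |- is_true (@Order.le _ _ _ (GRing.natmul _ _)) => exact: ler0n
  | |- is_true (@Order.le _ _ _ (GRing.one _)) => exact: ler01
  | |- is_true (@Order.le _ _ _ (Num.norm _)) => exact: normr_ge0
  | |- is_true (@Order.le _ _ _ (powR _ _)) => exact: powR_ge0
  | |- is_true (@Order.le _ _ _ (GRing.exp _ 2)) => exact: sqr_ge0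
  | |- is_true (@Order.le _ _ _ (GRing.exp _ _)) => apply: exprn_ge0
  | |- is_true (@Order.le _ _ _ (GRing.mul _ _)) => apply: mulr_ge0
  | |- is_true (@Order.le _ _ _ (GRing.inv _)) => rewrite invr_ge0
  | |- is_true (@Order.le _ _ _ (@Algebra.add _ _ _)) => apply: addr_ge0
  end.

(** * Comparison of second derivatives at two points *)

Section local_step.
Context {R : realType} {d : nat}.
Local Notation E := 'rV[R]_d.
Local Notation e i := (delta_mx 0 i : 'rV[R]_d).
Implicit Types (x y z : E) (i j k n : 'I_d) (r c t h : R) (U : set (R * E)).
Implicit Types (f g v : R * E -> R) (dv : 'I_d -> R * E -> R)
  (Hv : 'I_d -> 'I_d -> R * E -> R) (q : R * E -> 'M[R]_d) (b : R * E -> E).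

Lemma ddiff_bound i j h f t x x0 c w : `|x - x0| + 2 * `|h| <= c ->
  (forall y, `|y - x0| <= c -> `|f (t, y) - f (t, x0)| <= w) -> `|ddiff i j h f (t, x)| <= 4 * w.
Proof.
move=> xc H.
have T z y : z - x0 = (z - y) + (y - x0) by rewrite addrA subrK.
have N1 k : `|h *: e k| <= `|h| by exact: norm_delta_le.
have h0 := normr_ge0 h.
have n0 : `|f (t, x) - f (t, x0)| <= w by apply: H; move: xc h0; clear; lra.
have n1 k : `|f (t, x + h *: e k) - f (t, x0)| <= w.
  apply: H; rewrite (T _ x) [_ - x]addrC addKr; apply: (le_trans (ler_normD _ _)).
  by move: (N1 k) xc h0; clear; lra.
have n2 : `|f (t, x + h *: e i + h *: e j) - f (t, x0)| <= w.
  apply: H; rewrite (T _ x) -[x + _ + _]addrA [_ - x]addrC addKr.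
  apply: (le_trans (ler_normD _ _)).
  have := ler_normD (h *: e i) (h *: e j).
  by move: (N1 i) (N1 j) xc h0; clear; lra.
rewrite /ddiff /= (_ : _ - _ = ((f (t, x + h *: e i + h *: e j) - f (t, x0)) - (f (t, x + h *: e i) - f (t, x0)))
  - ((f (t, x + h *: e j) - f (t, x0)) - (f (t, x) - f (t, x0)))); last by ring.
apply: (le_trans (ler_normB _ _)).
have := ler_normB (f (t, x + h *: e i + h *: e j) - f (t, x0)) (f (t, x + h *: e i) - f (t, x0)).
have := ler_normB (f (t, x + h *: e j) - f (t, x0)) (f (t, x) - f (t, x0)).
by move: n0 n2 (n1 i) (n1 j); clear; lra.
Qed.

Lemma ddiff_sum i j h (a : 'M[R]_d) Hv t x :
  ddiff i j h (fun p => \sum_k \sum_l a k l * Hv k l p) (t, x)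
  = \sum_k \sum_l a k l * ddiff i j h (Hv k l) (t, x).
Proof.
rewrite /ddiff /= -!sumrB; apply: eq_bigr => k _; rewrite -!sumrB; apply: eq_bigr => l _.
by ring.
Qed.

Lemma local_step (al lam La S G m dl N mu eta t0 : R) x0 q b g v dv Hv i j n (a : R) :
  0 < al < 1 -> 0 < lam -> 0 <= La -> 0 < dl <= 1 -> 0 < t0 -> 1 <= N -> 0 < mu <= 1 ->
  0 < eta <= 4^-1 -> 0 < m -> 0 <= S -> 0 <= G ->
  continuous v -> C2_slices v dv Hv -> solves_on (cyl t0 x0 dl) q b g v dv Hv ->
  coefs_on (cyl t0 x0 dl) al lam La q b -> bounded_on (cyl t0 x0 dl) S v ->
  holder_on (cyl t0 x0 dl) al G g ->
  (forall k l t x y, 0 <= t -> t0 - dl ^+ 2 <= t <= t0 -> `|x - x0| <= dl -> `|y - x0| <= dl ->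
    `|Hv k l (t, x) - Hv k l (t, y)| <= m * `|x - y| `^ al) ->
  dl ^+ 2 <= t0 \/ (forall x, v (0, x) = 0) ->
  0 < a -> 16 * N * a <= dl ->
  let M2 := 4 * S / (eta * dl) ^+ 2 + m * (2 * (eta * dl)) `^ al in
  let M1 := 8 * S / dl + M2 in
  let om := (4 * N * a) `^ al * (frozen_const (d:=d) La * (M1 + M2) + G) in
  let B := (mu * a) ^+ 2 * (m * (8 * N * a) `^ al) in
  let P := ((1 + 2 * (d%:R * La)) * B + 8 * om * (N * a) ^+ 2) / lam + B in
  `|Hv i j (t0, x0 + a *: e n) - Hv i j (t0, x0 - a *: e n)|
    <= 2 * P / (N * (mu * a) ^+ 2) + 2 * (m * (2 * (mu * a)) `^ al).
Proof.
move=> /andP[al0 al1] lam0 La0 /andP[dl0 dl1] t00 N1 /andP[mu0 mu1] /andP[eta0 eta1] m0 S0 G0.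
move=> cv H2 Hs Hc Hb Hg Hh Hin a_gt0 aN; cbv zeta.
set k : R := mu * a; set rr : R := N * a; set rho : R := 4 * N * a.
set M2 : R := 4 * S / (eta * dl) ^+ 2 + m * (2 * (eta * dl)) `^ al.
set M1 : R := 8 * S / dl + M2.
set om : R := rho `^ al * (frozen_const (d:=d) La * (M1 + M2) + G).
set B : R := k ^+ 2 * (m * (8 * N * a) `^ al).
set P : R := ((1 + 2 * (d%:R * La)) * B + 8 * om * rr ^+ 2) / lam + B.
have T z y : z - x0 = (z - y) + (y - x0) by rewrite addrA subrK.
have al0' := ltW al0.
have rhoE : rho = 4 * rr by rewrite /rho /rr mulrA.
have k0 : 0 < k by rewrite mulr_gt0.
have kr : k <= rr by rewrite /k /rr ler_pM2r//; exact: le_trans N1.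
have ar : a <= rr by rewrite /rr ler_peMl// ltW.
have rr0 : 0 < rr by exact: lt_le_trans kr.
have rd : rho <= dl / 4 by rewrite rhoE /rr; move: aN; clear; lra.
have ed : 0 < eta * dl by rewrite mulr_gt0.
have ed4 : eta * dl <= dl / 4 by rewrite mulrC ler_pM2l.
have M20 : 0 <= M2.
  by rewrite /M2; pos.
have M10 : 0 <= M1 by rewrite /M1; pos.
have rho0 : 0 < rho by rewrite rhoE mulr_gt0.
have om0 : 0 <= om.
  by rewrite /om /frozen_const; pos.
have B0 : 0 < B by rewrite !mulr_gt0// ?exprn_gt0// ?powR_gt0// !mulr_gt0//; exact: lt_le_trans N1.
have Hbd t y (k1 l1 : 'I_d) : 0 < t -> t0 - dl ^+ 2 <= t <= t0 -> `|y - x0| <= dl / 2 -> `|Hv k1 l1 (t, y)| <= M2.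
  move=> tp tt yd.
  have yz z : `|z - y| <= 2 * (eta * dl) -> `|z - x0| <= dl.
    move=> zy; rewrite (T z y); apply: (le_trans (ler_normD _ _)); move: zy ed4 yd; clear; lra.
  apply: (interpolation_hessian (H2 t) ed) => z zy; first by apply: Hb; split=> //; exact: yz.
  apply: (le_trans (Hh k1 l1 t z y (ltW tp) tt (yz z zy) _)); last by rewrite ler_wpM2l ?(ltW m0)// powR_le.
  by move: yd dl0; clear; lra.
have Dbd t y (k1 : 'I_d) : 0 < t -> t0 - dl ^+ 2 <= t <= t0 -> `|y - x0| <= dl / 4 -> `|dv k1 (t, y)| <= M1.
  move=> tp tt yd; have d4 : 0 < dl / 4 by rewrite divr_gt0.
  have yz z : `|z - y| <= dl / 4 -> `|z - x0| <= dl / 2.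
    move=> zy; rewrite (T z y); apply: (le_trans (ler_normD _ _)); move: zy yd; clear; lra.
  apply: (le_trans (@interpolation_gradient _ _ _ _ _ y k1 (dl / 4) S M2 (H2 t) d4 _ _)) => [z zy|z zy|].
  - by apply: Hb; split=> //=; apply: (le_trans (yz z zy)); move: dl0; clear; lra.
  - by apply: Hbd => //; exact: yz.
  rewrite /M1 (_ : 2 * S / (dl / 4) = 8 * S / dl); last by field; rewrite gt_eqF.
  by rewrite lerD2l; move: dl1 dl0 M20; clear; nra.
pose rhs p := op q b dv Hv p - v p + g p.
pose FF p := rhs p - \sum_k1 \sum_l1 q (p.1, x0) k1 l1 * Hv k1 l1 p.
have c0 : `|x0 - x0| <= dl by rewrite subrr normr0 ltW.
have Fosc t y : 0 < t -> t0 - dl ^+ 2 <= t <= t0 -> `|y - x0| <= rho -> `|FF (t, y) - FF (t, x0)| <= om.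
  move=> tp tt yr.
  have al01 : 0 < al <= 1 by rewrite al0 ltW.
  have rho01 : 0 <= rho <= 1 by rewrite (ltW rho0) /=; move: rd dl1; clear; lra.
  have [C1 C2 C3] := Hc.
  have inU z : `|z - x0| <= rho -> cyl t0 x0 dl (t, z).
    by move=> zr; split=> //=; apply: (le_trans zr); move: rd dl0; clear; lra.
  have U0 : cyl t0 x0 dl (t, x0) by split.
  apply: (@frozen_rhs_oscillation _ _ _ _ _ (fun z => q (t, z)) (fun z => b (t, z))
    (fun z => g (t, z)) x0 al rho La M1 M2 G (H2 t)) => //.
  - move=> z zr; have Uz := inU z zr.
    have pz : `|z - x0| `^ al <= rho `^ al by apply: powR_le.
    split=> [k1 l1|k1|k1|].
    + by apply: (le_trans ((C2 k1 l1).2 t z x0 Uz U0)); rewrite ler_wpM2l.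
    + by apply: (le_trans ((C3 k1).2 t z x0 Uz U0)); rewrite ler_wpM2l.
    + exact: (C3 k1).1.
    + by apply: (le_trans (Hg t z x0 Uz U0)); rewrite ler_wpM2l.
  - move=> z zr; have z4 := le_trans zr rd.
    split=> [k1|k1 l1]; first exact: Dbd.
    by apply: Hbd => //; apply: (le_trans z4); move: dl0; clear; lra.
have rr_dl : rr ^+ 2 <= dl ^+ 2.
  by rewrite ler_sqr ?nnegrE ?(ltW rr0) ?(ltW dl0)//; move: rd rr0; rewrite rhoE; clear; lra.
(* The doubling starts [rr ^+ 2] before [t0] if that time is not negative. Otherwise it starts at 0,
   where [v] vanishes, because [t0 < rr ^+ 2 <= dl ^+ 2] excludes the other alternative. *)
have [a0 [a00 a0t a0d Ha0]] : exists a0 : R, [/\ 0 <= a0, a0 < t0, t0 - dl ^+ 2 <= a0 &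
    (forall x, v (a0, x) = 0) \/ rr ^+ 2 <= t0 - a0].
  have [rt|rt] := leP (rr ^+ 2) t0.
    exists (t0 - rr ^+ 2); split; [by rewrite subr_ge0|by rewrite ltrBlDr ltrDl exprn_gt0|by rewrite lerB|right].
    by rewrite opprB addrC subrK.
  exists 0; split=> //; first by move: rt rr_dl; clear; lra.
  by left; case: Hin => // dt; move: rt rr_dl dt; clear; lra.
have near_in y z : `|y - x0| <= 2 * rr -> `|z - y| <= 2 * k -> `|z - x0| <= rho.
  by move=> yr zy; rewrite (T z y) rhoE; apply: (le_trans (ler_normD _ _)); move: yr zy kr; clear; lra.
have pm x r : `|x - x0| <= rr -> 0 <= r <= rr -> `|x + r *: e n - x0| <= 2 * rr /\ `|x - r *: e n - x0| <= 2 * rr.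
  move=> xr /andP[r0 rrr]; have := norm_delta_le r n; rewrite (ger0_norm r0) => nr.
  split; rewrite addrAC; [apply: (le_trans (ler_normD _ _))|apply: (le_trans (ler_normB _ _))];
  by move: xr nr rrr; clear; lra.
have rhodl : rho <= dl by move: rd dl0; clear; lra.
have ab_k : `|k| = k by rewrite gtr0_norm.
have est : `|ddiff i j k v (t0, x0 + a *: e n) - ddiff i j k v (t0, x0 - a *: e n)| <= 2 * P * a / rr.
  apply: (@doubling_estimate_abs R d a0 t0 rr B (8 * om) lam (d%:R * La) P x0 n (ddiff i j k v) (ddiff i j k rhs)
    (fun l => ddiff i j k (dv l)) (fun l l' => ddiff i j k (Hv l l')) (fun t => q (t, x0))) => //.
  - exact: ltW.
  - exact: ddiff_continuous.
  - exact: ddiff_C2.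
  - move=> t x /andP[ta tb] xr; apply: ddiff_derive => y; rewrite ab_k => yx; apply: Hs; split => //=.
    + exact: le_lt_trans ta.
    + by rewrite tb andbT; apply: (le_trans a0d); exact: ltW.
    + exact: le_trans (near_in _ _ (ltW xr) yx) rhodl.
  - move=> t /andP[ta tb]; have U0 : cyl t0 x0 dl (t, x0).
      by split=> //=; [exact: le_lt_trans ta|rewrite tb andbT; apply: (le_trans a0d); exact: ltW].
    have [C1 C2 _] := Hc; split; first exact: C1.
    by apply: (le_trans (ler_norm _)); apply: sum_le_const => l; exact: (C2 l l).1.
  - move=> t x r /andP[ta tb] xr /andP[r0 rrr].
    have tp : 0 < t by exact: le_lt_trans ta.
    have tt : t0 - dl ^+ 2 <= t <= t0 by rewrite tb andbT; apply: (le_trans a0d); exact: ltW.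
    have [p1 p2] := pm x r (ltW xr) ltac:(by rewrite !ltW).
    have FE y : ddiff i j k rhs (t, y) = \sum_k1 \sum_l1 q (t, x0) k1 l1 * ddiff i j k (Hv k1 l1) (t, y) + ddiff i j k FF (t, y).
      by rewrite -ddiff_sum /ddiff /FF /=; clear; ring.
    have Fb y : `|y - x0| <= 2 * rr -> `|ddiff i j k FF (t, y)| <= 4 * om.
      move=> yr; apply: (@ddiff_bound i j k FF t y x0 rho om); last by move=> z zr; exact: Fosc.
      by rewrite ab_k rhoE; move: yr kr; clear; lra.
    rewrite !FE; under [X in _ - X]eq_bigr do (under eq_bigr do rewrite mulrBr; rewrite sumrB).
    rewrite sumrB; set s1 := \sum_k1 _; set s2 := \sum_k1 _.
    rewrite (_ : _ - _ = ddiff i j k FF (t, x + r *: e n) - ddiff i j k FF (t, x - r *: e n)); last by clear; ring.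
    by apply: (le_trans (ler_normB _ _)); move: (Fb _ p1) (Fb _ p2); clear; lra.
  - move=> t x r /andP[ta tb] xr rrr.
    have tp : 0 <= t by exact: le_trans ta.
    have tt : t0 - dl ^+ 2 <= t <= t0 by rewrite tb andbT; exact: (le_trans a0d).
    have [p1 p2] := pm x r xr rrr.
    have [z1 n1 ->] := ddiff_mixed i j t (x + r *: e n) H2 (ltW k0).
    have [z2 n2 ->] := ddiff_mixed i j t (x - r *: e n) H2 (ltW k0).
    (* Both mean value points lie within [rho] of [x0], so their distance is at most
       [2 * rho = 8 * N * a]. *)
    rewrite -mulrBr normrM (ger0_norm (sqr_ge0 k)) /B ler_wpM2l ?sqr_ge0//.
    have r1 := near_in _ _ p1 n1; have r2 := near_in _ _ p2 n2.
    apply: (le_trans (Hh i j t z1 z2 tp tt (le_trans r1 rhodl) (le_trans r2 rhodl))).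
    rewrite ler_wpM2l ?(ltW m0)// powR_le//.
    rewrite (_ : z1 - z2 = (z1 - x0) - (z2 - x0)); last by rewrite opprB addrA subrK.
    by apply: (le_trans (ler_normB _ _)); move: r1 r2; rewrite /rho; clear; lra.
  - case: Ha0 => [Ha0|]; [left=> x|by right].
    by rewrite /ddiff /= !Ha0; clear; ring.
  - by rewrite /P lerDr; pos.
  - rewrite /P mulrDr (_ : 2 * lam * (_ / lam) = 2 * ((1 + 2 * (d%:R * La)) * B + 8 * om * rr ^+ 2)); last by field; rewrite gt_eqF.
    have : 0 <= d%:R * La * B by pos.
    have : 0 <= om * rr ^+ 2 by pos.
    have : 0 < lam * B by rewrite mulr_gt0.
    by move: B0; clear; lra.
  - by rewrite ar ltW.
have ttt : t0 - dl ^+ 2 <= t0 <= t0 by rewrite lexx andbT lerBlDr lerDl sqr_ge0.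
have r0r : 0 <= a <= rr by rewrite ar ltW.
have x00 : `|x0 - x0| <= rr by rewrite subrr normr0 ltW.
have [p1 p2] := pm x0 a x00 r0r.
have [z1 n1 E1] := ddiff_mixed i j t0 (x0 + a *: e n) H2 (ltW k0).
have [z2 n2 E2] := ddiff_mixed i j t0 (x0 - a *: e n) H2 (ltW k0).
have r1 := near_in _ _ p1 n1; have r2 := near_in _ _ p2 n2.
have rr2dl : 2 * rr <= dl by move: rhodl rr0; rewrite rhoE; clear; lra.
have D1 : `|Hv i j (t0, z1) - Hv i j (t0, z2)| <= 2 * P / (N * k ^+ 2).
  have k2 : 0 < k ^+ 2 by rewrite exprn_gt0.
  rewrite -(ler_pM2l k2) -{1}(ger0_norm (ltW k2)) -normrM mulrBr -E1 -E2.
  apply: (le_trans est); rewrite /rr le_eqVlt; apply/orP; left; apply/eqP; field.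
  by rewrite !gt_eqF//; exact: lt_le_trans N1.
have near2 y z : `|z - y| <= 2 * k -> `|y - x0| <= 2 * rr -> `|z - x0| <= rho ->
    `|Hv i j (t0, z) - Hv i j (t0, y)| <= m * (2 * k) `^ al.
  move=> zy yr zr; apply: (le_trans (Hh i j t0 z y (ltW t00) ttt (le_trans zr rhodl) (le_trans yr rr2dl))).
  by rewrite ler_wpM2l ?(ltW m0)// powR_le.
have D2 := near2 _ _ n1 p1 r1; have D3 := near2 _ _ n2 p2 r2.
(* The mean value points [z1] and [z2] are moved to the two given points; each move costs
   [m * (2 * k) ^ al]. *)
rewrite (_ : _ - _ = (Hv i j (t0, z1) - Hv i j (t0, z2)) - (Hv i j (t0, z1) - Hv i j (t0, x0 + a *: e n))
  + (Hv i j (t0, z2) - Hv i j (t0, x0 - a *: e n))); last by clear; ring.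
apply: (le_trans (ler_normD _ _)); apply: (le_trans (lerD (ler_normB _ _) (lexx _))).
by move: D1 D2 D3; clear; lra.
Qed.

End local_step.

(** * Choice of the scales *)

Section local_improvement.
Context {R : realType} {d : nat}.
Local Notation E := 'rV[R]_d.
Local Notation e i := (delta_mx 0 i : 'rV[R]_d).

(* The point is that th is arbitrary: the Holder constant m of Hv comes back with a small factor. *)
Lemma local_improvement (al lam La th : R) : 0 < al < 1 -> 0 < lam -> 0 <= La -> 0 < th ->
  exists C kap : R, [/\ 0 <= C, 0 < kap & forall (S G m dl t0 : R) (x0 : E) q b g
      (v : R * E -> R) dv Hv i j n (a : R),
    0 < dl <= 1 -> 0 < t0 -> 0 < m -> 0 <= S -> 0 <= G ->
    continuous v -> C2_slices v dv Hv -> solves_on (cyl t0 x0 dl) q b g v dv Hv ->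
    coefs_on (cyl t0 x0 dl) al lam La q b -> bounded_on (cyl t0 x0 dl) S v ->
    holder_on (cyl t0 x0 dl) al G g ->
    (forall k l (t : R) (x y : E), 0 <= t -> t0 - dl ^+ 2 <= t <= t0 -> `|x - x0| <= dl -> `|y - x0| <= dl ->
      `|Hv k l (t, x) - Hv k l (t, y)| <= m * `|x - y| `^ al) ->
    dl ^+ 2 <= t0 \/ (forall x, v (0, x) = 0) ->
    0 < a -> a <= kap * dl ->
    `|Hv i j (t0, x0 + a *: e n) - Hv i j (t0, x0 - a *: e n)|
      <= (th * m + C * (S / dl ^+ 2 + G)) * a `^ al].
Proof.
move=> al01 lam0 La0 th0; have /andP[al0 al1] := al01; have al0' := ltW al0.
pose L : R := d%:R * La; have L0 : 0 <= L by rewrite /L; pos.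
(* With this constant, [P = C3 * B + 8 * om * rr ^+ 2 / lam]. *)
pose C3 : R := (1 + 2 * L) / lam + 1.
have C30 : 0 < C3 by rewrite /C3 ltr_wpDl// divr_ge0 ?(ltW lam0)//; pos.
pose fc : R := frozen_const (d:=d) La; have fc0 : 0 <= fc by rewrite /fc /frozen_const; pos.
have C36 : 0 < th / (6 * C3) by rewrite divr_gt0// mulr_gt0.
(* The parameters are fixed in the order [N], [mu], [eta], each answering for one third of [th]. The
   last has to beat [W], which depends on the other two. *)
have [N N1 HN] := @powR_sublinear R al 8 (th / (6 * C3)) al01 (ltr0n _ 8) C36.
have N0 : 0 < N by exact: lt_le_trans N1.
have [h h0 Hh] := @powR_small R al (th / 6) al0 (divr_gt0 th0 (ltr0n _ 6)).
pose mu := Num.min 1 (h / 2).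
have mu0 : 0 < mu by rewrite lt_min ltr01 divr_gt0.
have mu1 : mu <= 1 by rewrite ge_min lexx.
have mu2 : 2 * mu <= h.
  have : mu <= h / 2 by rewrite ge_min lexx orbT.
  by clear; lra.
have Hmu : (2 * mu) `^ al <= th / 6 by apply: le_trans Hh; apply: powR_le => //; pos.
(* [W * a ^ al] is the factor with which [fc * (M1 + M2) + G] enters the conclusion of
   [local_step]. *)
pose W : R := 16 * N / (lam * mu ^+ 2) * (4 * N) `^ al.
have W0 : 0 <= W by rewrite /W; apply: mulr_ge0; [apply: divr_ge0|]; pos.
have WF : 0 < 6 * (W * fc + 1) by rewrite mulr_gt0// ltr_wpDl// mulr_ge0.
have [h' h'0 Hh'] := @powR_small R al (th / (6 * (W * fc + 1))) al0 (divr_gt0 th0 WF).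
pose eta := Num.min 4^-1 (h' / 2).
have eta0 : 0 < eta by rewrite lt_min invr_gt0 ltr0n divr_gt0.
have eta1 : eta <= 4^-1 by rewrite ge_min lexx.
have eta2 : 2 * eta <= h'.
  have : eta <= h' / 2 by rewrite ge_min lexx orbT.
  by clear; lra.
have Heta : (2 * eta) `^ al <= th / (6 * (W * fc + 1)) by apply: le_trans Hh'; apply: powR_le => //; pos.
exists (W * fc * (8 + 8 / eta ^+ 2) + W), ((16 * N)^-1); split.
- by apply: addr_ge0 => //; apply: mulr_ge0; [pos|apply: addr_ge0 => //; apply: divr_ge0 => //; pos].
- by rewrite invr_gt0 mulr_gt0.
move=> S G m dl t0 x0 q b g v dv Hv i j n a dl01 t00 m0 S0 G0 cv H2 Hs Hc Hb Hg Hm Hin a0 ak.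
have /andP[dl0 dl1] := dl01.
have aN : 16 * N * a <= dl by rewrite mulrC -ler_pdivlMr ?mulr_gt0// mulrC.
apply: (le_trans (@local_step R d al lam La S G m dl N mu eta t0 x0 q b g v dv Hv i j n a al01 lam0 La0 dl01
  t00 N1 _ _ m0 S0 G0 cv H2 Hs Hc Hb Hg Hm Hin a0 aN)); rewrite ?mu0 ?eta0//.
set M2 := 4 * S / (eta * dl) ^+ 2 + _.
pose p := a `^ al; have p0 : 0 < p by rewrite powR_gt0.
rewrite !powRM; try by [pos]; rewrite -/p -/L -/fc.
have M2le : 8 * S / dl + 2 * M2 <= (8 + 8 / eta ^+ 2) * (S / dl ^+ 2) + 2 * m * (2 * eta) `^ al.
  have i1 : S / dl <= S / dl ^+ 2.
    rewrite ler_wpM2l// lef_pV2 ?posrE ?exprn_gt0// expr2 -[leRHS]mulr1 ler_wpM2l//; exact: ltW.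
  have i2 : (2 * (eta * dl)) `^ al <= (2 * eta) `^ al.
    by apply: powR_le; [pos|pos|rewrite ler_wpM2l// -[leRHS]mulr1 ler_wpM2l//; exact: ltW].
  have i3 : m * (2 * (eta * dl)) `^ al <= m * (2 * eta) `^ al by rewrite ler_wpM2l// ltW.
  rewrite /M2 (_ : 4 * S / (eta * dl) ^+ 2 = 4 / eta ^+ 2 * (S / dl ^+ 2)); last first.
    by field; rewrite !gt_eqF.
  have e1 : 8 * S / dl = 8 * (S / dl) by rewrite mulrA.
  have e2 : 8 / eta ^+ 2 = 2 * (4 / eta ^+ 2) by ring.
  rewrite e1 e2.
  by move: i1 i3; clear; lra.
set om := _ * p * (fc * _ + G).
have omle : om <= (4 * N) `^ al * p * (fc * ((8 + 8 / eta ^+ 2) * (S / dl ^+ 2) + 2 * m * (2 * eta) `^ al) + G).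
  rewrite /om -powRM//; try by [pos].
  rewrite ler_wpM2l//; first by pos.
  rewrite lerD2r ler_wpM2l//; move: M2le; clear; lra.
rewrite (_ : 2 * _ / _ = 2 * C3 * (8 `^ al * N `^ al / N) * m * p + 16 * N / (lam * mu ^+ 2) * om); last first.
  by rewrite /C3; field; rewrite !gt_eqF.
have A1 : 2 * C3 * (8 `^ al * N `^ al / N) <= th / 3.
  rewrite -powRM//; last exact: ltW.
  have : (8 * N) `^ al / N <= th / (6 * C3) by rewrite ler_pdivrMr.
  rewrite -(ler_pM2l (_ : 0 < 2 * C3)) ?mulr_gt0// => /le_trans; apply.
  by rewrite le_eqVlt; apply/orP; left; apply/eqP; field; rewrite gt_eqF.
have A2 : 16 * N / (lam * mu ^+ 2) * om <= p * (W * fc * (8 + 8 / eta ^+ 2) * (S / dl ^+ 2) + 2 * W * fc * (2 * eta) `^ al * m + W * G).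
  have w0 : 0 <= 16 * N / (lam * mu ^+ 2) by apply: divr_ge0; pos.
  apply: (le_trans (ler_wpM2l w0 omle)); rewrite /W le_eqVlt; apply/orP; left; apply/eqP; ring.
have A3 : 2 * W * fc * (2 * eta) `^ al <= th / 3.
  have wf : 0 <= 2 * W * fc by pos.
  apply: (le_trans (ler_wpM2l wf Heta)).
  rewrite mulrA ler_pdivrMr//; move: th0 (mulr_ge0 W0 fc0); clear; nra.
have A4 : 0 <= S / dl ^+ 2 by apply: divr_ge0; pos.
have B1 : 2 * C3 * (8 `^ al * N `^ al / N) * m * p <= th / 3 * m * p by rewrite !ler_wpM2r// ltW.
have B2 : 2 * W * fc * (2 * eta) `^ al * m * p <= th / 3 * m * p by rewrite !ler_wpM2r// ltW.
have B3 : 2 * (m * (2 `^ al * (mu `^ al * p))) <= th / 3 * m * p.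
  rewrite (_ : 2 * _ = 2 * (2 `^ al * mu `^ al) * m * p); last by ring.
  rewrite -powRM//; last exact: ltW.
  by rewrite !ler_wpM2r//; try exact: ltW; move: Hmu; clear; lra.
have B4 : 0 <= W * fc * (8 + 8 / eta ^+ 2) * G * p.
  by apply: mulr_ge0; [apply: mulr_ge0 => //; apply: mulr_ge0; [pos|apply: addr_ge0 => //; apply: divr_ge0 => //; pos]|exact: ltW].
have B5 : 0 <= W * (S / dl ^+ 2) * p by pos.
set X := W * fc * (8 + 8 / eta ^+ 2) in A2 B4 *; set Y := S / dl ^+ 2 in A2 A4 B5 *.
by move: A2 B1 B2 B3 B4 B5; clear; lra.
Qed.

End local_improvement.

(** * Absorption of the Holder seminorm with a weight *)

Section weighted_schauder.
Context {R : realType} {d : nat}.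
Local Notation E := 'rV[R]_d.
Local Notation e i := (delta_mx 0 i : 'rV[R]_d).
Implicit Types (x y z : E) (i j n : 'I_d).

(** The local estimate compares only points symmetric about a centre in a coordinate direction. So
    [x] is carried to [y] by changing one coordinate at a time, with [c] the midpoint of a move. *)
Lemma coordinate_path (f : E -> R) x y (B : R) : 0 <= B ->
  (forall c n (a : R), `|c - x| <= `|y - x| -> 0 < a -> 2 * a <= `|y - x| ->
     `|f (c + a *: e n) - f (c - a *: e n)| <= B) ->
  `|f y - f x| <= d%:R * B.
Proof.
move=> B0 H.
pose z k : E := \row_j (if (j < k)%N then y 0 j else x 0 j).
suff K k : (k <= d)%N -> `|f (z k) - f x| <= k%:R * B.
  by rewrite (_ : y = z d) ?K//; apply/rowP => j; rewrite mxE ltn_ord.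
elim: k => [|k IH] kd.
  by rewrite (_ : z 0%N = x) ?subrr ?normr0 ?mul0r//; apply/rowP => j; rewrite mxE.
rewrite -(subrK (f (z k)) (f (z k.+1))) -addrA -natr1 mulrDl mul1r addrC.
apply: (le_trans (ler_normD _ _)); apply: lerD; first exact: IH (ltnW kd).
pose n := Ordinal kd.
have kn (j : 'I_d) : j != n -> (j < k.+1)%N = (j < k)%N.
  by move=> jn; rewrite ltnS leq_eqVlt; case: eqP => // jk; case/eqP: jn; apply/val_inj.
have xyn : `|y 0 n - x 0 n| <= `|y - x|.
  by have := coord_le_norm (y - x) n; rewrite !mxE.
pose c : E := \row_j (if j == n then (x 0 n + y 0 n) / 2 else z k 0 j).
have cE (u : R) : c + u *: e n = \row_j (if j == n then (x 0 n + y 0 n) / 2 + u else z k 0 j).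
  by apply/rowP => j; rewrite !mxE /=; case: (eqVneq j n) => _ /=; rewrite ?mulr1 ?mulr0 ?addr0.
have z1 : z k.+1 = \row_j (if j == n then y 0 n else z k 0 j).
  apply/rowP => j; rewrite !mxE; have [->|nj] := eqVneq j n; first by rewrite ltnSn.
  by rewrite kn.
have z0 : z k = \row_j (if j == n then x 0 n else z k 0 j).
  apply/rowP => j; rewrite [RHS]mxE; have [->|nj//] := eqVneq j n; by rewrite mxE ltnn.
have cx : `|c - x| <= `|y - x|.
  apply: norm_le_coord => // j; rewrite !mxE; have [->|nj] := eqVneq j n.
    rewrite (_ : _ - _ = (y 0 n - x 0 n) / 2); last by field.
    by rewrite normrM [X in _ * X]gtr0_norm ?invr_gt0//; have := normr_ge0 (y 0 n - x 0 n); lra.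
  case: ifP => _; last by rewrite subrr normr0.
  by have := coord_le_norm (y - x) j; rewrite !mxE.
have [xy|xy|xy] := ltgtP (x 0 n) (y 0 n).
- have := H c n ((y 0 n - x 0 n) / 2) cx; rewrite -scaleNr !cE.
  rewrite (_ : _ / 2 + _ / 2 = y 0 n); last by field.
  rewrite (_ : _ / 2 + - (_ / 2) = x 0 n); last by field.
  rewrite -z1 -z0; apply; first by lra.
  by move: xyn; rewrite gtr0_norm ?subr_gt0// => ?; lra.
- have := H c n ((x 0 n - y 0 n) / 2) cx; rewrite -scaleNr !cE.
  rewrite (_ : _ / 2 + _ / 2 = x 0 n); last by field.
  rewrite (_ : _ / 2 + - (_ / 2) = y 0 n); last by field.
  rewrite -z1 -z0 => HH; rewrite distrC; apply: HH; first by lra.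
  by move: xyn; rewrite ltr0_norm ?subr_lt0// => ?; lra.
- by rewrite (_ : z k.+1 = z k) ?subrr ?normr0// z1 -xy -z0.
Qed.

Lemma pow2_dominates (a ep : R) : 0 <= a -> 0 < ep -> exists k : nat, a < ep * 2 ^+ k.
Proof.
move=> a0 ep0; exists (Num.bound (a / ep)); rewrite mulrC -ltr_pdivrMr//.
have b0 : 0 <= a / ep by apply: divr_ge0; pos.
apply: (lt_le_trans (archi_boundP b0)).
by rewrite -natrX ler_nat; apply: ltnW; apply: ltn_expl.
Qed.

Lemma hessian_eq0 (v : R * E -> R) dv Hv (t : R) : C2_slices v dv Hv -> (forall x, v (t, x) = 0) ->
  forall i j x, Hv i j (t, x) = 0.
Proof.
move=> H v0 i j x; have [H1 _ H3 _] := H t.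
have dv0 k y : dv k (t, y) = 0.
  have A := H1 k y; have v0' : (fun x => v (t, x)) = cst 0 by apply/funext => z; exact: v0.
  rewrite v0' in A; have B := is_derive_cst (0 : R) y (e k).
  by rewrite -(@derive_val _ _ _ _ _ _ _ A) (@derive_val _ _ _ _ _ _ _ B).
have A := H3 i j x; have v0' : (fun x => dv j (t, x)) = cst 0 by apply/funext => z; exact: dv0.
rewrite v0' in A; have B := is_derive_cst (0 : R) x (e i).
by rewrite -(@derive_val _ _ _ _ _ _ _ A) (@derive_val _ _ _ _ _ _ _ B).
Qed.

(* dd behaves like a parabolic distance to the boundary of U. *)
Definition weight_on (U : set (R * E)) (dd : R -> E -> R) :=
  [/\ forall t x, dd t x <= 1,
      forall t x s y, 0 < t -> 0 < dd t x -> 0 <= s -> t - (dd t x / 8) ^+ 2 <= s <= t ->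
        `|y - x| <= dd t x / 2 -> dd t x / 2 <= dd s y
    & forall t x s y, 0 < t -> 0 < dd t x -> 0 < s -> t - (dd t x / 8) ^+ 2 <= s <= t ->
        `|y - x| <= dd t x / 2 -> U (s, y)].

(** A weighted Holder bound [P M] improves to [P (M / 2 + C1 * (S + G))]. The iteration starts from
    the crude bound provided by [M0] and halves its contribution at each round, so the final
    constant does not depend on [M0]. *)
Lemma weighted_schauder (al lam La : R) : 0 < al < 1 -> 0 < lam -> 0 <= La ->
  exists2 C : R, 0 <= C & forall U dd (S G M0 : R) q b g (v : R * E -> R) dv Hv,
    weight_on U dd -> 0 <= S -> 0 <= G ->
    continuous v -> C2_slices v dv Hv -> solves_on U q b g v dv Hv ->
    coefs_on U al lam La q b -> bounded_on U S v -> holder_on U al G g ->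
    (forall i j t x y, `|Hv i j (t, x) - Hv i j (t, y)| <= M0 * `|x - y| `^ al) ->
    (forall x, v (0, x) = 0) \/ (forall t x, 0 < t -> 0 < dd t x -> dd t x ^+ 2 <= t) ->
    forall i j t x y, 0 < t -> 0 < dd t x -> `|y - x| <= dd t x / 4 ->
      dd t x ^+ 2 * dd t x `^ al * `|Hv i j (t, y) - Hv i j (t, x)| <= C * (S + G) * `|y - x| `^ al.
Proof.
move=> al01 lam0 La0; have /andP[al0 al1] := al01; have al0' := ltW al0.
pose dn : R := d%:R; have dn0 : 0 <= dn by exact: ler0n.
(* The [d] coordinate moves and the factor 8 in [m] below still leave [d * th * 8 <= 1 / 2]. *)
pose th : R := (16 * (dn + 1))^-1; have th0 : 0 < th by rewrite invr_gt0 mulr_gt0// ltr_wpDl.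
have [C0 [kap [C00 kap0 LI]]] := @local_improvement R d al lam La th al01 lam0 La0 th0.
pose ka := Num.min 8^-1 (kap / 16).
have ka0 : 0 < ka by rewrite lt_min invr_gt0 ltr0n divr_gt0.
have ka1 : ka <= 8^-1 by rewrite ge_min lexx.
have ka2 : ka <= kap / 16 by rewrite ge_min lexx orbT.
have kap0' : 0 < ka `^ al by rewrite powR_gt0.
have [h h0 Hh] := @powR_small R al (ka `^ al / 32) al0 (divr_gt0 kap0' (ltr0n _ 32)).
pose eta := Num.min 32^-1 (h / 2).
have eta0 : 0 < eta by rewrite lt_min invr_gt0 ltr0n divr_gt0.
have eta1 : eta <= 32^-1 by rewrite ge_min lexx.
have Heta : (2 * eta) `^ al <= ka `^ al / 32.
  apply: le_trans Hh; apply: powR_le => //; first by pos.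
  have : eta <= h / 2 by rewrite ge_min lexx orbT.
  by clear; lra.
(* [1024] is the square of 32, from cylinders of radius [D / 32]; as a variable it stays opaque to
   the arithmetic. *)
have [k10 k10E] : exists k : R, k = 1024 by exists 1024.
have k100 : 0 <= k10 by rewrite k10E ler0n.
have k101 : 1 <= k10 by rewrite k10E ler1n.
pose C1 : R := dn * C0 * k10 + 8 / eta ^+ 2 / ka `^ al.
have X0 : 0 <= 8 / eta ^+ 2 / ka `^ al by apply: divr_ge0; [apply: divr_ge0|]; pos.
have Y0 : 0 <= dn * C0 * k10 by pos.
have C10 : 0 <= C1 by rewrite /C1 addr_ge0.
exists (2 * C1); first by pos.
move=> U dd S G M0 q b g v dv Hv [dd1 ddv ddU] S0 G0 cv H2 Hs Hc Hb Hg HM0 Hin.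
have SG0 : 0 <= S + G by pos.
pose P (M : R) := forall i j (t : R) x y, 0 < t -> 0 < dd t x -> `|y - x| <= dd t x / 4 ->
  dd t x ^+ 2 * dd t x `^ al * `|Hv i j (t, y) - Hv i j (t, x)| <= M * `|y - x| `^ al.
have step (M : R) : 0 < M -> P M -> P (M / 2 + C1 * (S + G)).
  move=> M0' PM i j t x y t0 D0 yx; set D := dd t x in D0 yx *.
  have D1 : D <= 1 by exact: dd1.
  have p0 : 0 < D `^ al by rewrite powR_gt0.
  have p1 : D `^ al <= 1 by have := powR_le al0' (ltW D0) D1; rewrite powR1.
  pose W := D ^+ 2 * D `^ al; have W0 : 0 < W by rewrite mulr_gt0// exprn_gt0.
  (* Near [x] the weight is at least [D / 2], which costs a factor [2 ^ 2 * 2 ^ al <= 8]. *)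
  pose m : R := 8 * M / W; have m0 : 0 < m by rewrite divr_gt0// mulr_gt0.
  have D2 : (D / 32) ^+ 2 <= (D / 8) ^+ 2 by rewrite ler_sqr ?nnegrE; try (by pos); move: D0; clear; lra.
  have Hm k l (s : R) z z' : 0 <= s -> t - (D / 32) ^+ 2 <= s <= t -> `|z - x| <= D / 2 ->
      `|z' - z| <= D / 8 -> `|Hv k l (s, z') - Hv k l (s, z)| <= m * `|z' - z| `^ al.
    move=> s0 /andP[st1 st2] zx zz.
    have dsz : D / 2 <= dd s z by apply: ddv => //; rewrite st2 andbT; move: D2 st1; rewrite -/D; clear; lra.
    have [sp|sE] := ltP 0 s.
      have ds0 : 0 < dd s z by apply: lt_le_trans dsz; rewrite divr_gt0.
      have zz4 : `|z' - z| <= dd s z / 4 by move: zz dsz; clear; lra.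
      have := PM k l s z z' sp ds0 zz4.
      have Wle : W / 8 <= dd s z ^+ 2 * dd s z `^ al.
        apply: (@le_trans _ _ ((D / 2) ^+ 2 * (D / 2) `^ al)); last first.
          by apply: ler_pM; [pos|pos|rewrite ler_sqr ?nnegrE; pos|apply: powR_le; pos].
        rewrite powRM; try by pos.
        have : 2^-1 <= (2^-1 : R) `^ al by apply: ger1_powR; [rewrite invr_gt0 ltr0n invf_le1 ?ltr0n// ler1n|exact: ltW].
        rewrite /W exprMn => h2; have w2 : 0 <= D ^+ 2 * D `^ al by pos.
        move: h2 w2; set Q := D ^+ 2; set T := D `^ al; set u := _ `^ al; clear; nra.
      move=> A; have : W / 8 * `|Hv k l (s, z') - Hv k l (s, z)| <= M * `|z' - z| `^ al.
        by apply: le_trans A; rewrite ler_wpM2r.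
      rewrite /m -ler_pdivlMl ?divr_gt0// => /le_trans; apply.
      by rewrite le_eqVlt; apply/orP; left; apply/eqP; field; rewrite gt_eqF.
    (* At the initial time the Hessian vanishes with [v]; under the other alternative the cylinder
       cannot reach time 0. *)
    have {}sE : s = 0 by apply/eqP; rewrite eq_le s0 sE.
    case: Hin => [v0|Hin].
      by rewrite sE !(hessian_eq0 H2 v0) subrr normr0; pos.
    have := Hin t x t0 D0; rewrite -/D; move: st1 (sqr_ge0 D) D0; rewrite sE exprMn; clear; nra.
  have Wd : W <= D ^+ 2 by rewrite /W ger_pMr// exprn_gt0.
  have W1 : W <= 1 by apply: (le_trans Wd); rewrite expr_le1//; exact: ltW.
  (* Close points are handled by the local improvement in cylinders inside [U]. For distant points
     both Hessians are bounded by interpolation, and [D ^ al] is at most a multiple of the power of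
     the distance. *)
  rewrite -/W; have [small|large] := leP `|y - x| (ka * D).
    have B0 : 0 <= (th * m + C0 * (S / (D / 32) ^+ 2 + G)) * `|y - x| `^ al.
      apply: mulr_ge0; last by pos.
      by apply: addr_ge0; [pos|apply: mulr_ge0 => //; apply: addr_ge0 => //; apply: divr_ge0; pos].
    have := @coordinate_path (fun z => Hv i j (t, z)) x y _ B0.
    move=> /(_ _)/wrap[].
      move=> c n a cx a0 a2.
      have cx8 : `|c - x| <= D / 8 by move: cx small ka1 D0; clear; nra.
      have zx z : `|z - c| <= D / 32 -> `|z - x| <= D / 4.
        move=> zc; rewrite (_ : z - x = (z - c) + (c - x)); last by rewrite addrA subrK.
        by apply: (le_trans (ler_normD _ _)); move: cx8 zc D0; clear; lra.
      have sub p : cyl t c (D / 32) p -> U p.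
        case: p => s z [/= s0 /andP[s1 s2] zc]; apply: (ddU t x) => //.
          by rewrite s2 andbT -/D; move: s1 D2; clear; lra.
        by rewrite -/D; move: (zx z zc) D0; clear; lra.
      apply: (le_trans (@LI S G m (D / 32) t c q b g v dv Hv i j n a _ t0 m0 S0 G0 cv H2 _ _ _ _ _ _ a0 _)).
      - by rewrite divr_gt0//=; move: D1; clear; lra.
      - by move=> s z /sub; exact: Hs.
      - have [c1 c2 c3] := Hc; split=> [p /sub|k l|k]; first exact: c1.
          by split=> [p /sub|s z z' /sub ? /sub ?]; [exact: (c2 k l).1|exact: (c2 k l).2].
        by split=> [p /sub|s z z' /sub ? /sub ?]; [exact: (c3 k).1|exact: (c3 k).2].
      - by move=> p /sub; exact: Hb.
      - by move=> s z z' /sub ? /sub ?; exact: Hg.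
      - move=> k l s z z' s0 st zc zc'; apply: Hm => //.
          by move: (zx z' zc') D0; clear; lra.
        rewrite (_ : z - z' = (z - c) - (z' - c)); last by rewrite opprB addrA subrK.
        by apply: (le_trans (ler_normB _ _)); move: zc zc' D0; clear; lra.
      - case: Hin => [|Hin]; [by right|left].
        by have := Hin t x t0 D0; rewrite -/D exprMn; move: (sqr_ge0 D); clear; nra.
      - by move: a2 small ka2 D0; clear; nra.
      rewrite ler_wpM2l//; last by apply: powR_le => //; [exact: ltW|move: a2 a0; clear; lra].
      by apply: addr_ge0; [pos|apply: mulr_ge0 => //; apply: addr_ge0 => //; apply: divr_ge0; pos].
    move=> A; apply: (le_trans (ler_wpM2l (ltW W0) A)).
    rewrite [X in W * X]mulrA [leLHS]mulrA [W * _]mulrA ler_wpM2r ?powR_ge0//.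
    have e1 : W * m = 8 * M by rewrite /m; field; rewrite gt_eqF.
    have e2 : W * (S / (D / 32) ^+ 2) <= k10 * S.
      rewrite (_ : S / _ = k10 * S * (D ^+ 2)^-1); last by rewrite k10E; field; rewrite gt_eqF.
      rewrite mulrCA -[leRHS]mulr1 ler_wpM2l; [by []|by pos|].
      by rewrite ler_pdivrMr ?exprn_gt0// mul1r.
    have e3 : W * G <= k10 * G by apply: ler_wpM2r => //; exact: le_trans W1 k101.
    have e4 : dn * (th * (8 * M)) <= M / 2.
      have thd : dn * th <= 16^-1.
        rewrite /th ler_pdivrMr; last by rewrite mulr_gt0 ?ltr0n// ltr_wpDl.
        by clear; lra.
      have M8 : 0 <= 8 * M by pos.
      by have := ler_wpM2r M8 thd; rewrite -mulrA; clear; lra.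
    rewrite -/dn (_ : W * dn * _ = dn * (th * (W * m)) + dn * C0 * (W * (S / (D / 32) ^+ 2) + W * G)); last by ring.
    rewrite e1; apply: lerD => //.
    apply: (@le_trans _ _ (dn * C0 * (k10 * S + k10 * G))).
      by rewrite ler_wpM2l ?lerD//; pos.
    by rewrite -mulrDr mulrA ler_wpM2r// /C1 lerDl.
  have Hb2 z : `|z - x| <= D / 4 -> `|Hv i j (t, z)| <= 4 * S / (eta * D) ^+ 2 + m * (2 * (eta * D)) `^ al.
    move=> zx; have eD : 0 < eta * D by rewrite mulr_gt0.
    have eD2 : eta * D <= D / 32 by rewrite mulrC ler_pM2l.
    have tt : t - (D / 32) ^+ 2 <= t <= t by rewrite lexx andbT gerBl sqr_ge0.
    apply: (interpolation_hessian (H2 t) eD) => w wz.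
      apply: Hb; apply: (ddU t x) => //.
        by rewrite -/D lexx andbT gerBl sqr_ge0.
      rewrite -/D (_ : w - x = (w - z) + (z - x)); last by rewrite addrA subrK.
      by apply: (le_trans (ler_normD _ _)); move: wz zx eD2 D0; clear; lra.
    apply: (le_trans (Hm i j t z w (ltW t0) tt _ _)).
    - by move: zx D0; clear; lra.
    - by move: wz eD2 D0; clear; lra.
    by rewrite ler_wpM2l ?(ltW m0)// powR_le.
  have nx : `|x - x| <= D / 4 by rewrite subrr normr0; pos.
  have := le_trans (ler_normB _ _) (lerD (Hb2 y yx) (Hb2 x nx)).
  set Bd := 4 * S / _ + _ => A.
  apply: (le_trans (ler_wpM2l (ltW W0) A)).
  have powl : ka `^ al * D `^ al <= `|y - x| `^ al.
    by rewrite -powRM; try (by pos); apply: powR_le; [pos|pos|exact: ltW].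
  have e1 : W * Bd <= (4 / eta ^+ 2 * S + M / 4 * ka `^ al) * D `^ al.
    rewrite /Bd mulrDr [leRHS]mulrDl; apply: lerD.
      by rewrite le_eqVlt; apply/orP; left; apply/eqP; rewrite /W; field; rewrite !gt_eqF.
    rewrite mulrA powRM; try by pos.
    rewrite (_ : W * m = 8 * M); last by rewrite /m; field; rewrite gt_eqF.
    rewrite mulrA powRM; try by pos.
    have hh : (2 `^ al * eta `^ al) <= ka `^ al / 32 by rewrite -powRM//; pos.
    rewrite mulrA -[8 * M * _ * _]mulrA ler_wpM2r ?(ltW p0)//.
    have M8 : 0 <= 8 * M by pos.
    by apply: (le_trans (ler_wpM2l M8 hh)); clear; lra.
  have e2 : 0 <= 4 / eta ^+ 2 * S + M / 4 * ka `^ al by apply: addr_ge0; [apply: mulr_ge0 => //; apply: divr_ge0|]; pos.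
  have e3 : 4 / eta ^+ 2 * S + M / 4 * ka `^ al <= (4 / eta ^+ 2 / ka `^ al * S + M / 4) * ka `^ al.
    by rewrite le_eqVlt; apply/orP; left; apply/eqP; field; rewrite !gt_eqF.
  have e4 : 0 <= 4 / eta ^+ 2 / ka `^ al * S + M / 4.
    by apply: addr_ge0; [apply: mulr_ge0 => //; apply: divr_ge0; [apply: divr_ge0|]; pos|pos].
  rewrite mulrDr -[W * Bd + W * Bd]mulr2n -[W * Bd *+ 2]mulr_natl.
  apply: (@le_trans _ _ (2 * ((4 / eta ^+ 2 / ka `^ al * S + M / 4) * `|y - x| `^ al))).
    rewrite ler_wpM2l//; apply: (le_trans e1).
    apply: (@le_trans _ _ ((4 / eta ^+ 2 / ka `^ al * S + M / 4) * (ka `^ al * D `^ al))).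
      by rewrite mulrA ler_wpM2r// ltW.
    by rewrite ler_wpM2l.
  rewrite mulrA ler_wpM2r ?powR_ge0//.
  have e5 : 8 / eta ^+ 2 / ka `^ al = 2 * (4 / eta ^+ 2 / ka `^ al) by ring.
  have e6 : 0 <= 8 / eta ^+ 2 / ka `^ al * G by exact: mulr_ge0.
  have e7 : 0 <= dn * C0 * k10 * (S + G) by exact: mulr_ge0.
  by rewrite /C1; move: e6 e7; rewrite e5; clear; lra.
pose M1 : R := `|M0| + 1.
have M10 : 0 < M1 by rewrite /M1 ltr_wpDl.
have PM1 : P M1.
  move=> i j t x y t0 D0 yx.
  have w1 : dd t x ^+ 2 * dd t x `^ al <= 1.
    apply: mulr_ile1; [pos|pos| |].
      by rewrite expr_le1//; exact: ltW.
    by have := powR_le al0' (ltW D0) (dd1 t x); rewrite powR1.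
  apply: (@le_trans _ _ (1 * `|Hv i j (t, y) - Hv i j (t, x)|)); first by rewrite ler_wpM2r.
  rewrite mul1r; apply: (le_trans (HM0 i j t y x)); rewrite ler_wpM2r ?powR_ge0//.
  by rewrite /M1; have := ler_norm M0; lra.
(* [2 * C1 * (S + G)] is the fixed point of the improvement, and the excess over it is halved each
   time. *)
have Pn k : P (M1 / 2 ^+ k + 2 * C1 * (S + G)).
  elim: k => [|k IH].
    move=> i j t x y t0 D0 yx; apply: (le_trans (PM1 i j t x y t0 D0 yx)).
    rewrite ler_wpM2r ?powR_ge0// expr0 divr1 lerDl; pos.
  have pk : 0 < 2 ^+ k :> R by rewrite exprn_gt0.
  have pos_k : 0 < M1 / 2 ^+ k + 2 * C1 * (S + G).
    by rewrite ltr_pwDl ?divr_gt0//; pos.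
  have := step _ pos_k IH; rewrite (_ : _ / 2 + _ = M1 / 2 ^+ k.+1 + 2 * C1 * (S + G))//.
  by rewrite exprS; field; rewrite gt_eqF.
move=> i j t x y t0 D0 yx; apply/ler_addgt0Pr => ep ep0.
pose w := `|y - x| `^ al; have w0 : 0 <= w by exact: powR_ge0.
have M1w : 0 <= M1 * w by pos.
have [k kP] := pow2_dominates M1w ep0.
apply: (le_trans (Pn k i j t x y t0 D0 yx)); rewrite -/w mulrDl addrC lerD2l.
by rewrite mulrAC ler_pdivrMr ?exprn_gt0//; exact: ltW.
Qed.

End weighted_schauder.

(** * Global and interior estimates of first and second derivatives *)

Section a_priori_estimates.
Context {R : realType} {d : nat}.
Local Notation E := 'rV[R]_d.
Local Notation e i := (delta_mx 0 i : 'rV[R]_d).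
Implicit Types (x y z : E) (i j n : 'I_d).

Definition after0 : set (R * E) := [set p | 0 < p.1].

Definition after0_box (T r : R) : set (R * E) := [set p | 0 < p.1 <= T /\ `|p.2| < r].

(** The weight is the constant 1: since the initial values vanish, there is no boundary to keep away
    from. Holder increments over distances beyond [1 / 4] follow from the sup bound of the
    Hessian. *)
Lemma global_schauder (al lam La : R) : 0 < al < 1 -> 0 < lam -> 0 <= La ->
  exists2 C : R, 0 <= C & forall (S G M0 : R) q b g (v : R * E -> R) dv Hv,
    0 <= S -> 0 <= G ->
    continuous v -> C2_slices v dv Hv -> solves_on after0 q b g v dv Hv ->
    coefs_on after0 al lam La q b -> bounded_on after0 S v -> holder_on after0 al G g ->
    (forall i j t x y, `|Hv i j (t, x) - Hv i j (t, y)| <= M0 * `|x - y| `^ al) ->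
    (forall x, v (0, x) = 0) ->
    [/\ forall i j, bounded_on after0 (C * (S + G)) (Hv i j),
        forall i, bounded_on after0 (C * (S + G)) (dv i)
      & forall i j, holder_on after0 al (C * (S + G)) (Hv i j)].
Proof.
move=> al01 lam0 La0; have /andP[al0 al1] := al01.
have [C0 C00 WS] := @weighted_schauder R d al lam La al01 lam0 La0.
(* [256 = 4 * 8 ^ 2] comes from interpolation with step [1 / 8]. *)
have [k kE] : exists k : R, k = 256 by exists 256.
have k0 : 0 <= k by rewrite kE ler0n.
have k1 : 2 <= k by rewrite kE ler_nat.
exists (8 * (k + C0)); first by pos.
move=> S G M0 q b g v dv Hv S0 G0 cv H2 Hs Hc Hb Hg HM v0.
pose T := S + G; have T0 : 0 <= T by rewrite /T; pos.
pose dd (t : R) x : R := 1.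
have wt : weight_on after0 dd.
  split=> // t x s y *; rewrite /dd; by clear; lra.
have W i j (t : R) x y : 0 < t -> `|y - x| <= 4^-1 -> `|Hv i j (t, y) - Hv i j (t, x)| <= C0 * T * `|y - x| `^ al.
  move=> t0 yx; have := WS after0 dd S G M0 q b g v dv Hv wt S0 G0 cv H2 Hs Hc Hb Hg HM (or_introl v0) i j t x y t0.
  by rewrite /dd powR1 expr1n !mul1r; apply => //; rewrite ltr01.
have p1 (r : R) : 0 <= r <= 1 -> r `^ al <= 1.
  by move=> /andP[r0 r1]; have := powR_le (ltW al0) r0 r1; rewrite powR1.
have S1 i j (t : R) x : 0 < t -> `|Hv i j (t, x)| <= (k + C0) * T.
  move=> t0; have h8 : (0 : R) < 8^-1 by rewrite invr_gt0 ltr0n.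
  apply: (le_trans (@interpolation_hessian _ _ _ _ _ x i j 8^-1 S (C0 * T) (H2 t) h8 _ _)).
  - by move=> y _; exact: Hb.
  - move=> y yx; have yx4 : `|y - x| <= 4^-1 by move: yx; clear; lra.
    apply: (le_trans (W i j t x y t0 yx4)); rewrite -[leRHS]mulr1 ler_wpM2l//; first by pos.
    by apply: p1; rewrite normr_ge0 /=; move: yx4; clear; lra.
  rewrite (_ : 4 * S / 8^-1 ^+ 2 = k * S); last by rewrite kE; field.
  rewrite mulrDl lerD2r; apply: ler_wpM2l => //; rewrite /T; move: G0; clear; lra.
have kC0 : 0 <= (k + C0) * T by pos.
split.
- move=> i j [t x] /= t0; apply: (le_trans (S1 i j t x t0)).
  by rewrite -/T -mulrA; move: kC0; clear; lra.
- move=> i [t x] /= t0.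
  apply: (le_trans (@interpolation_gradient _ _ _ _ _ x i 1 S ((k + C0) * T) (H2 t) ltr01 _ _)).
  + by move=> y _; exact: Hb.
  + by move=> y _; exact: S1.
  rewrite divr1 mul1r -/T -mulrA.
  have : 2 * S <= k * T by apply: ler_pM => //; rewrite /T; move: G0; clear; lra.
  have : 0 <= C0 * T by pos.
  by move: kC0; clear; lra.
- move=> i j t x y /= t0 _; rewrite -/T; have [xy|xy] := leP `|x - y| 4^-1.
    apply: (le_trans (W i j t y x t0 xy)); rewrite ler_wpM2r ?powR_ge0// -mulrA.
    have : 0 <= k * T by pos.
    have : 0 <= C0 * T by pos.
    by clear; lra.
  apply: (le_trans (ler_normB _ _)); apply: (le_trans (lerD (S1 i j t x t0) (S1 i j t y t0))).
  have h4 : 4^-1 <= `|x - y| `^ al.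
    have q4 : (0 : R) < 4^-1 by rewrite invr_gt0 ltr0n.
    have q41 : (4^-1 : R) <= 1 by rewrite invf_le1 ?ltr0n// ler1n.
    apply: (@le_trans _ _ (4^-1 `^ al)); first by apply: ger1_powR; [rewrite q4|exact: ltW].
    by apply: powR_le; exact: ltW.
  have : 8 * (k + C0) * T * 4^-1 <= 8 * (k + C0) * T * `|x - y| `^ al by rewrite ler_wpM2l//; pos.
  by clear; lra.
Qed.

(** Meant for differences of approximate solutions, about whose derivatives at the initial time
    nothing is known: away from that time and from the lateral boundary, the sup bound [S] alone
    controls the derivatives. *)
Lemma interior_estimate (al lam La : R) : 0 < al < 1 -> 0 < lam -> 0 <= La ->
  exists2 C : R, 0 <= C & forall (T r S M0 : R) q b (v : R * E -> R) dv Hv,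
    0 <= S ->
    continuous v -> C2_slices v dv Hv -> solves_on (after0_box T r) q b (fun=> 0) v dv Hv ->
    coefs_on (after0_box T r) al lam La q b -> bounded_on (after0_box T r) S v ->
    (forall i j t x y, `|Hv i j (t, x) - Hv i j (t, y)| <= M0 * `|x - y| `^ al) ->
    forall (t D : R) x, 0 < D <= 1 -> D <= t <= T -> D <= r - `|x| ->
      (forall i j, `|Hv i j (t, x)| <= C * S / D ^+ 2) /\ (forall i, `|dv i (t, x)| <= C * S / D ^+ 2).
Proof.
move=> al01 lam0 La0; have /andP[al0 al1] := al01.
have [C0 C00 WS] := @weighted_schauder R d al lam La al01 lam0 La0.
have [k kE] : exists k : R, k = 256 by exists 256.
have k0 : 0 <= k by rewrite kE ler0n.
exists (4 * (k + C0) + 4); first by pos.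
move=> T r S M0 q b v dv Hv S0 cv H2 Hs Hc Hb HM.
(* The weight uses [t] instead of its square root; up to 1 this is smaller, and it gives
   [dd ^+ 2 <= t]. After time [T] the weight is 0, since the equation is not assumed there. *)
pose dd (t : R) x : R := if t <= T then Num.min 1 (Num.min (r - `|x|) t) else 0.
have ddP (t : R) x : 0 < dd t x -> [/\ dd t x <= 1, dd t x <= r - `|x|, dd t x <= t & t <= T].
  rewrite /dd; case: ifP => [tT _|_]; last by rewrite ltxx.
  by split=> //; rewrite !ge_min lexx ?orbT.
have ddI (t D : R) x : t <= T -> D <= 1 -> D <= r - `|x| -> D <= t -> D <= dd t x.
  by move=> tT *; rewrite /dd tT !le_min; apply/and3P.
have tri x y : r - `|x| - `|y - x| <= r - `|y|.
  have := ler_normD (y - x) x; rewrite subrK; clear; lra.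
have wt : weight_on (after0_box T r) dd.
  split=> [t x|t x s y t0 D0 s0 /andP[s1 s2] yx|t x s y t0 D0 s0 /andP[s1 s2] yx].
  - by rewrite /dd; case: ifP => _; rewrite ?ge_min ?lexx ?ler01.
  - have [D1 D2 D3 tT] := ddP t x D0; set D := dd t x in D0 D1 D2 D3 yx s1 *; have TR := tri x y.
    by apply: ddI; [exact: le_trans tT|move: D1 D0|move: TR yx D2|move: D0 D1 D3 s1]; clear; nra.
  - have [D1 D2 D3 tT] := ddP t x D0; set D := dd t x in D0 D1 D2 D3 yx s1 *; have TR := tri x y.
    by split=> /=; [by rewrite s0 (le_trans s2 tT)|]; move: TR yx D2 D0; clear; lra.
have W i j (t D : R) x y : 0 < D -> D <= dd t x -> `|y - x| <= D / 4 ->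
    `|Hv i j (t, y) - Hv i j (t, x)| <= C0 * S / D ^+ 2.
  move=> D0 Dd yx; have d0 : 0 < dd t x by exact: lt_le_trans Dd.
  have [_ _ d3 _] := ddP t x d0; have t0 : 0 < t by exact: lt_le_trans d3.
  have yx4 : `|y - x| <= dd t x / 4 by move: yx Dd; clear; lra.
  have Hin : (forall x, v (0, x) = 0) \/ (forall t x, 0 < t -> 0 < dd t x -> dd t x ^+ 2 <= t).
    by right=> t' x' t0' d0'; have [e1 _ e3 _] := ddP t' x' d0'; move: d0' e1 e3; clear; nra.
  have gh : holder_on (after0_box T r) al 0 (fun=> 0 : R).
    by move=> *; rewrite subrr normr0 mul0r.
  have := WS _ dd S 0 M0 q b (fun=> 0) v dv Hv wt S0 (lexx 0) cv H2 Hs Hc Hb gh HM Hin i j t x y t0 d0 yx4.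
  rewrite addr0 => A.
  have pd : 0 < dd t x `^ al by rewrite powR_gt0.
  have A2 : dd t x `^ al * (dd t x ^+ 2 * `|Hv i j (t, y) - Hv i j (t, x)|) <= dd t x `^ al * (C0 * S).
    rewrite mulrA [dd t x `^ al * _]mulrC; apply: (le_trans A); rewrite mulrC; apply: ler_wpM2r; first by pos.
    by apply: powR_le; [exact: ltW|pos|move: yx4 d0; clear; lra].
  rewrite ler_pM2l// in A2.
  rewrite ler_pdivlMr ?exprn_gt0// mulrC; apply: le_trans A2; apply: ler_wpM2r => //.
  by rewrite ler_sqr ?nnegrE; pos.
have S1 i j (t D : R) x : 0 < D -> D <= dd t x -> `|Hv i j (t, x)| <= (k + C0) * S / D ^+ 2.
  move=> D0 Dd; have [d1 d2 d3 d4] := ddP t x (lt_le_trans D0 Dd).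
  have t0 : 0 < t by exact: lt_le_trans (lt_le_trans D0 Dd) d3.
  have D8 : 0 < D / 8 by rewrite divr_gt0.
  apply: (le_trans (@interpolation_hessian _ _ _ _ _ x i j (D / 8) S (C0 * S / D ^+ 2) (H2 t) D8 _ _)).
  - move=> y yx; apply: Hb; split=> /=; [by rewrite t0 d4|]; have := tri x y.
    by move: yx d2 Dd D0; clear; lra.
  - by move=> y yx; apply: W => //; move: yx; clear; lra.
  rewrite [(k + C0) * S]mulrDl [leRHS]mulrDl lerD2r (_ : 4 * S / _ = k * S / D ^+ 2)//.
  by rewrite kE; field; rewrite gt_eqF.
move=> t D x /andP[D0 D1] /andP[Dt tT] Dr.
have Dd : D <= dd t x by exact: ddI.
have D2 : 0 < D ^+ 2 by rewrite exprn_gt0.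
have X0 : 0 <= S / D ^+ 2 by apply: divr_ge0; pos.
have Y0 : 0 <= (k + C0) * (S / D ^+ 2) by pos.
split=> [i j|i].
  apply: (le_trans (S1 i j t D x D0 Dd)).
  by rewrite -!mulrA [leRHS]mulrDl -mulrA; move: X0 Y0; clear; lra.
have Dh : 0 < D / 2 by rewrite divr_gt0.
apply: (le_trans (@interpolation_gradient _ _ _ _ _ x i (D / 2) S ((k + C0) * S / (D / 2) ^+ 2) (H2 t) Dh _ _)).
- move=> y yx; apply: Hb; split=> /=; first by rewrite (lt_le_trans D0 Dt).
  by have := tri x y; move: yx Dr D0; clear; lra.
- move=> y yx; apply: S1 => //; apply: ddI => //; [move: D1 D0| |move: Dt D0]; try (by clear; lra).
  by have := tri x y; move: yx Dr; clear; lra.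
rewrite (_ : 2 * S / (D / 2) = 4 * (S / D ^+ 2) * D); last by field; rewrite gt_eqF.
rewrite (_ : D / 2 * _ = 2 * ((k + C0) * (S / D ^+ 2)) * D); last by field; rewrite gt_eqF.
rewrite -[leRHS]mulrA [leRHS]mulrDl -[4 * (k + C0) * _]mulrA.
by move: X0 Y0 D1 D0; set X := S / D ^+ 2; clear; nra.
Qed.

End a_priori_estimates.

(** * Lyapunov barriers *)

Section barriers.
Context {R : realType} {d : nat}.
Local Notation E := 'rV[R]_d.
Local Notation e i := (delta_mx 0 i : 'rV[R]_d).
Implicit Types (x y z : E) (i j n : 'I_d) (s t : R).

Definition coercive (phi : E -> R) := forall M : R, exists r : R, forall x, r <= `|x| -> M <= phi x.

Lemma is_derive_expR_scale (lam t : R) :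
  is_derive t 1 (fun s => expR (lam * s)) (lam * expR (lam * t)).
Proof.
have D : is_derive t 1 (fun s : R => lam * s) (lam * 1) by exact: is_deriveMl.
by have := is_derive1_comp (is_derive_expR (lam * t)) D; rewrite mulr1 mulrC.
Qed.

(** Maximum principle for [w] minus the barrier. On the lateral boundary [phi >= ml], so the barrier
    exceeds [F] there; the exponential turns the Lyapunov inequality for [phi] into that of a
    supersolution. *)
Lemma barrier_on_box (T rho lam ml dl F : R) (w wt : R * E -> R) dw Hw q b
    (phi : E -> R) dphi Hphi :
  0 <= dl -> 0 <= F -> 0 < ml -> 0 <= lam -> continuous phi ->
  {within cylinder 0 T 0 rho, continuous w} ->
  (forall t, 0 < t <= T ->
     is_C2 (fun x => w (t, x)) (fun i x => dw i (t, x)) (fun i j x => Hw i j (t, x))) ->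
  (forall t x, 0 < t <= T -> `|x| < rho -> is_derive t 1 (fun s => w (s, x)) (wt (t, x))) ->
  (forall t x, 0 < t <= T -> `|x| < rho -> (q (t, x))^T = q (t, x) /\ psd (q (t, x))) ->
  is_C2 phi dphi Hphi ->
  (forall x, `|x| <= rho -> 0 <= phi x) -> (forall x, `|x| = rho -> ml <= phi x) ->
  (forall t x, 0 < t <= T -> `|x| < rho ->
     op q b (fun i p => dphi i p.2) (fun i j p => Hphi i j p.2) (t, x) <= lam * phi x) ->
  (forall x, `|x| <= rho -> w (0, x) <= dl) ->
  (forall t x, 0 <= t <= T -> `|x| <= rho -> w (t, x) <= F) ->
  (forall t x, 0 < t <= T -> `|x| < rho -> 0 < w (t, x) -> wt (t, x) <= op q b dw Hw (t, x)) ->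
  forall t x, 0 <= t <= T -> `|x| <= rho -> w (t, x) <= dl + F / ml * expR (lam * t) * phi x.
Proof.
move=> dl0 F0 ml0 lam0 cphi cw H2 Ht Hq Hphi2 p0 pml Hop W0 WF Heq t x tT xr.
pose c := F / ml; have c0 : 0 <= c by rewrite /c; apply: divr_ge0; pos.
pose W p := w p - dl - c * expR (lam * p.1) * phi p.2.
have e0 (s : R) : 0 < expR s by exact: expR_gt0.
have cexp : continuous (fun p : R * E => c * expR (lam * p.1) * phi p.2).
  move=> p; have c1 : {for p, continuous (fun p : R * E => p.1)} by exact: cvg_fst.
  have c2 : {for p, continuous (fun p : R * E => p.2)} by exact: cvg_snd.
  have cc (r : R) : {for p, continuous (fun=> r : R)} by exact: cst_continuous.
  have c3 : {for p, continuous (fun p : R * E => expR (lam * p.1))}.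
    exact: (continuous_comp (continuousM (cc lam) c1) (@continuous_expR R _)).
  exact: (continuousM (continuousM (cc c) c3) (continuous_comp c2 (cphi _))).
suff : W (t, x) <= 0 by rewrite -/c /W /=; clear; lra.
have B0 y : `|y - 0| = `|y| by rewrite subr0.
apply: (@box_max_principle R d 0 T 0 rho W (fun p => wt p - c * (lam * expR (lam * p.1)) * phi p.2)
  (fun i p => dw i p - c * expR (lam * p.1) * dphi i p.2)
  (fun i j p => Hw i j p - c * expR (lam * p.1) * Hphi i j p.2) q b) => //; rewrite ?B0//.
- move=> p; apply: cvgB; last exact: (continuous_subspaceT cexp).
  by apply: cvgB; [exact: cw|exact: cvg_cst].
- move=> s sT; apply: (is_C2_ext (is_C2_lin 1 (-1) (is_C2_lin 1 (- (c * expR (lam * s))) (H2 s sT) Hphi2) (is_C2_cst dl))) => *;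
  by rewrite /W /=; ring.
- move=> s y sT; rewrite B0 => yr.
  have D1 : is_derive s 1 (fun s => c * phi y * expR (lam * s)) (c * phi y * (lam * expR (lam * s))).
    by apply: is_deriveMl; exact: is_derive_expR_scale.
  have := is_deriveB (is_deriveB (Ht s y sT yr) (is_derive_cst dl s 1)) D1.
  rewrite subr0 (_ : _ * (lam * _) = c * (lam * expR (lam * s)) * phi y); last by clear; ring.
  rewrite (_ : _ - _ = fun s => W (s, y))//.
  by apply/funext => s'; rewrite /W /= !fctE /=; congr (_ - _); ring.
- by move=> s y sT; rewrite B0; exact: Hq.
- move=> y; rewrite B0 => yr; rewrite /W /= mulr0 expR0 mulr1.
  have : 0 <= c * phi y by rewrite mulr_ge0// p0.
  by have := W0 y yr; clear; lra.
- move=> s y sT; rewrite B0 => yr; rewrite /W /=.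
  have sT0 : 0 <= s by case/andP: sT.
  have E1 : 1 <= expR (lam * s) by rewrite -expR0 ler_expR mulr_ge0.
  have cm : c * ml = F by rewrite /c divfK// gt_eqF.
  have : c * ml <= c * expR (lam * s) * phi y.
    rewrite -mulrA ler_wpM2l//; apply: (le_trans (pml y yr)).
    by rewrite ler_peMl// p0// yr.
  have yr' : `|y| <= rho by rewrite yr.
  by have := WF s y sT yr'; rewrite cm; move: dl0; clear; lra.
- move=> s y sT; rewrite B0 => yr; rewrite /W /= => Wp.
  have wp : 0 < w (s, y).
    have := mulr_ge0 (mulr_ge0 c0 (ltW (e0 (lam * s)))) (p0 y (ltW yr)).
    by move: Wp dl0; clear; lra.
  have A1 := Heq s y sT yr wp; have A2 := Hop s y sT yr.
  have -> : \sum_i \sum_j q (s, y) i j * (Hw i j (s, y) - c * expR (lam * s) * Hphi i j y)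
     + \sum_i b (s, y) 0 i * (dw i (s, y) - c * expR (lam * s) * dphi i y)
     = op q b dw Hw (s, y) - c * expR (lam * s) * op q b (fun i p => dphi i p.2) (fun i j p => Hphi i j p.2) (s, y).
    rewrite /op /= mulrDr !mulr_sumr opprD addrACA -!sumrB; congr (_ + _).
      apply: eq_bigr => i _; rewrite mulr_sumr -sumrB; apply: eq_bigr => j _; ring.
    by apply: eq_bigr => i _; ring.
  have ce : 0 <= c * expR (lam * s) by rewrite mulr_ge0// ltW.
  have := ler_wpM2l ce A2; move: A1; clear; lra.
Qed.

(* At a fixed point the barrier tends to 0 as the box exhausts the space. *)
Lemma barrier_global (T lam F : R) (w wt : R * E -> R) dw Hw q b
    (phi : E -> R) dphi Hphi :
  0 <= lam ->
  {within [set p : R * E | 0 <= p.1 <= T], continuous w} ->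
  (forall t, 0 < t <= T ->
     is_C2 (fun x => w (t, x)) (fun i x => dw i (t, x)) (fun i j x => Hw i j (t, x))) ->
  (forall t x, 0 < t <= T -> is_derive t 1 (fun s => w (s, x)) (wt (t, x))) ->
  (forall t x, 0 < t <= T -> (q (t, x))^T = q (t, x) /\ psd (q (t, x))) ->
  continuous phi -> is_C2 phi dphi Hphi -> (forall x, 0 <= phi x) -> coercive phi ->
  (forall t x, 0 < t <= T ->
     op q b (fun i p => dphi i p.2) (fun i j p => Hphi i j p.2) (t, x) <= lam * phi x) ->
  (forall x, w (0, x) <= 0) ->
  (forall t x, 0 <= t <= T -> w (t, x) <= F) ->
  (forall t x, 0 < t <= T -> 0 < w (t, x) -> wt (t, x) <= op q b dw Hw (t, x)) ->
  forall t x, 0 <= t <= T -> w (t, x) <= 0.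
Proof.
move=> lam0 cw H2 Ht Hq cphi Hphi2 p0 pc Hop W0 WF Heq t x tT.
apply/ler_addgt0Pr => ep ep0; rewrite add0r.
pose F' := Num.max F 0; have F'0 : 0 <= F' by rewrite le_max lexx orbT.
pose X := F' * expR (lam * t) * phi x.
have X0 : 0 <= X by rewrite mulr_ge0// mulr_ge0// ltW// expR_gt0.
pose ml := X / ep + 1.
have ml0 : 0 < ml by rewrite ltr_wpDl// divr_ge0// ltW.
have [r Hr] := pc ml.
pose rho := Num.max r `|x|.
have xr : `|x| <= rho by rewrite le_max lexx orbT.
have pml y : `|y| = rho -> ml <= phi y by move=> yE; apply: Hr; rewrite yE le_max lexx.
have cw' : {within cylinder 0 T 0 rho, continuous w}.
  apply: continuous_subspaceW cw => -[s y] [/= + _]; by rewrite in_itv.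
have := @barrier_on_box T rho lam ml 0 F' w wt dw Hw q b phi dphi Hphi (lexx 0) F'0 ml0 lam0
  cphi cw' H2 (fun t x tT _ => Ht t x tT) (fun t x tT _ => Hq t x tT) Hphi2 (fun x _ => p0 x) pml
  (fun t x tT _ => Hop t x tT) (fun x _ => W0 x) _ (fun t x tT _ => Heq t x tT) t x tT xr.
move=> /(_ _)/wrap[]; first by move=> s y sT _; rewrite le_max WF.
rewrite add0r => /le_trans; apply.
rewrite (_ : _ * _ * _ = X / ml); last by rewrite /X; ring.
rewrite ler_pdivrMr// /ml mulrDr mulr1 mulrC divfK ?gt_eqF// lerDl; exact: ltW.
Qed.

Lemma sqr_norm_le x : `|x| ^+ 2 <= \sum_k x 0 k ^+ 2.
Proof.
have S0 : 0 <= \sum_k x 0 k ^+ 2 by apply: sumr_ge0 => k _; exact: sqr_ge0.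
rewrite -(sqr_sqrtr S0) ler_sqr ?nnegrE ?sqrtr_ge0//; apply: norm_le_coord; first exact: sqrtr_ge0.
move=> k; rewrite -sqrtr_sqr ler_sqrt// (bigD1 k)//= lerDl sumr_ge0// => j _; exact: sqr_ge0.
Qed.

(** For bounded coefficients, 1 plus the squared Euclidean norm is a Lyapunov function. Its rate
    collects [2 * d * La] from the second-order part and the drift, estimated by
    [2 * x_i <= 1 + x_i ^ 2] in absolute value. *)
Lemma bounded_coefs_max_principle (al lam La T F : R) (w wt : R * E -> R) dw Hw q b :
  0 < lam -> 0 <= La -> coefs_on after0 al lam La q b ->
  {within [set p : R * E | 0 <= p.1 <= T], continuous w} ->
  (forall t, 0 < t <= T ->
     is_C2 (fun x => w (t, x)) (fun i x => dw i (t, x)) (fun i j x => Hw i j (t, x))) ->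
  (forall t x, 0 < t <= T -> is_derive t 1 (fun s => w (s, x)) (wt (t, x))) ->
  (forall x, w (0, x) <= 0) ->
  (forall t x, 0 <= t <= T -> w (t, x) <= F) ->
  (forall t x, 0 < t <= T -> 0 < w (t, x) -> wt (t, x) <= op q b dw Hw (t, x)) ->
  forall t x, 0 <= t <= T -> w (t, x) <= 0.
Proof.
move=> lam0 La0 [C1 C2 C3] cw H2 Ht W0 WF Heq.
pose phi (x : E) := 1 + \sum_k x 0 k ^+ 2.
have S0 x : 0 <= \sum_k x 0 k ^+ 2 by apply: sumr_ge0 => k _; exact: sqr_ge0.
have p1 x : 1 <= phi x by rewrite lerDl.
have H2phi : is_C2 phi (fun i x => 2 * x 0 i) (fun i j x => 2 * (i == j)%:R).
  apply: (is_C2_ext (is_C2_lin 1 1 (is_C2_cst 1) (is_C2_sqr (0 : E)))) => [x|i x|i j x].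
  - by rewrite /phi !mul1r; congr (_ + _); apply: eq_bigr => k _; rewrite mxE subr0.
  - by rewrite mxE subr0; ring.
  - by ring.
have cphi : continuous phi.
  move=> x; have cc (r : R) : {for x, continuous (fun=> r : R)} by exact: cst_continuous.
  apply: (continuousD (cc 1)); apply: continuous_big_sum => k.
  have ck := @coord_continuous R 1 d 0 k x; exact: (continuousM ck ck).
apply: (@barrier_global T ((3 * d%:R + 1) * La) F w wt dw Hw q b phi _ _ _ cw H2 Ht _ cphi H2phi) => //.
- by pos.
- by move=> t x /andP[t0 _]; have E1 := C1 (t, x) t0; split; [case: E1|exact: elliptic_psd (ltW lam0) E1].
- by move=> x; exact: le_trans (p1 x).
- move=> M; exists (Num.max 1 M) => x xM.
  have x1 : 1 <= `|x| by apply: le_trans xM; rewrite le_max lexx.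
  have xM' : M <= `|x| by apply: le_trans xM; rewrite le_max lexx orbT.
  by have := sqr_norm_le x; rewrite /phi; move: x1 xM'; clear; nra.
move=> t x /andP[t0 _]; rewrite /op /=.
have q1 : \sum_i \sum_j q (t, x) i j * (2 * (i == j)%:R) <= d%:R * (2 * La).
  apply: (le_trans (ler_norm _)); apply: sum_le_const => i.
  rewrite (bigD1 i)//= eqxx big1 => [|j /negbTE]; last by rewrite eq_sym => ->; rewrite !mulr0.
  by rewrite mulr1 addr0 normrM mulrC [`|2|]ger0_norm// ler_wpM2l//; exact: (C2 i i).1.
have q2 : \sum_i b (t, x) 0 i * (2 * x 0 i) <= La * (d%:R + \sum_k x 0 k ^+ 2).
  have dsum : d%:R = \sum_(i < d) (1 : R) by rewrite sumr_const card_ord.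
  rewrite dsum -big_split mulr_sumr; apply: ler_sum => i _ /=.
  apply: (le_trans (ler_norm _)); rewrite normrM; apply: ler_pM => //; first exact: (C3 i).1.
  by rewrite ler_norml; have := sqr_ge0 (x 0 i - 1); have := sqr_ge0 (x 0 i + 1); clear; nra.
have dn : 0 <= d%:R :> R by exact: ler0n.
have : 0 <= d%:R * La * \sum_k x 0 k ^+ 2 by rewrite !mulr_ge0.
by rewrite /phi; move: q1 q2 La0; clear; lra.
Qed.

End barriers.

(** * Uniform convergence on a set *)

Section uniform_limits.
Context {R : realType}.

Definition limf (T : Type) (f : nat -> T -> R) (p : T) : R := limn (fun n => f n p).

Definition ucauchy (T : Type) (A : set T) (f : nat -> T -> R) := forall ep : R, 0 < ep ->
  exists N : nat, forall n m p, (N <= n)%N -> (N <= m)%N -> A p -> `|f n p - f m p| <= ep.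

Definition uconv (T : Type) (A : set T) (f : nat -> T -> R) (g : T -> R) := forall ep : R, 0 < ep ->
  exists N : nat, forall n p, (N <= n)%N -> A p -> `|f n p - g p| <= ep.

Lemma ucauchy_cvg (T : Type) (A : set T) f p : ucauchy A f -> A p -> f n p @[n --> \oo] --> limf f p.
Proof.
move=> H Ap; suff : cvgn (fun n => f n p) by [].
apply/cauchy_cvgP; apply: cauchy_exP => ep ep0.
have [N HN] := H (ep / 2) ltac:(by rewrite divr_gt0).
exists (f N p); exists N => // n /= Nn; rewrite /ball /=.
by apply: (le_lt_trans (HN N n p _ Nn Ap)) => //; lra.
Qed.

Lemma uconv_cvg (T : Type) (A : set T) f (g : T -> R) p : uconv A f g -> A p -> f n p @[n --> \oo] --> g p.
Proof.
move=> H Ap; apply/cvgrPdist_le => ep ep0; have [N HN] := H ep ep0.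
by exists N => // n Nn; rewrite distrC; exact: HN.
Qed.

Lemma ucauchy_uconv (T : Type) (A : set T) f : ucauchy A f -> uconv A f (limf f).
Proof.
move=> H ep ep0; have [N HN] := H ep ep0; exists N => n p Nn Ap.
have C : `|f n p - f m p| @[m --> \oo] --> `|f n p - limf f p|.
  by apply: cvg_norm; apply: cvgB; [exact: cvg_cst|exact: ucauchy_cvg H Ap].
by apply: (cvg_le_bound C); exists N => // m Nm; exact: HN.
Qed.

Lemma uconv_ucauchy (T : Type) (A : set T) f (g : T -> R) : uconv A f g -> ucauchy A f.
Proof.
move=> H ep ep0; have [N HN] := H (ep / 2) ltac:(by rewrite divr_gt0).
exists N => n m p Nn Nm Ap.
rewrite (_ : f n p - f m p = (f n p - g p) - (f m p - g p)); last by ring.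
by apply: (le_trans (ler_normB _ _)); move: (HN n p Nn Ap) (HN m p Nm Ap); clear; lra.
Qed.

Lemma uconv_le (T : Type) (A : set T) f (g : T -> R) (c : R) p : uconv A f g -> A p ->
  (forall n, `|f n p| <= c) -> `|g p| <= c.
Proof.
move=> H Ap Hc; have C : `|f n p| @[n --> \oo] --> `|g p| by apply: cvg_norm; exact: uconv_cvg H Ap.
by apply: (cvg_le_bound C); exists 0%N => // n _; exact: Hc.
Qed.

Lemma uconv_continuous (V : normedModType R) (A : set V) f (g : V -> R) (x : V) (rho : R) :
  0 < rho -> (forall y, `|y - x| < rho -> A y) -> uconv A f g ->
  (forall n, {for x, continuous (f n)}) -> {for x, continuous g}.
Proof.
move=> r0 HA H Hc; apply/continuous_epsP => ep ep0.
have [N HN] := H (ep / 3) ltac:(by rewrite divr_gt0).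
have [dl dl0 Hd] := (continuous_epsP _ _).1 (Hc N) (ep / 3) ltac:(by rewrite divr_gt0).
exists (Num.min dl rho); first by rewrite lt_min dl0.
move=> y; rewrite lt_min => /andP[y1 y2].
have Ax : A x by apply: HA; rewrite subrr normr0.
rewrite (_ : g y - g x = (f N y - f N x) - (f N y - g y) + (f N x - g x)); last by ring.
apply: (le_trans (ler_normD _ _)); apply: (le_trans (lerD (ler_normB _ _) (lexx _))).
by move: (Hd y y1) (HN N y (leqnn _) (HA y y2)) (HN N x (leqnn _) Ax); clear; lra.
Qed.

(** Only a short segment in direction [v] has to lie in [A]. The same lemma thus serves for space
    derivatives and, with [V] the real line, for the time derivative. *)
Lemma uconv_derive (V : normedModType R) (A : set V) (fn gn : nat -> V -> R) f g (x v : V) (rho : R) :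
  0 < rho -> (forall r : R, `|r| < rho -> A (x + r *: v)) ->
  (forall n y, A y -> is_derive y v (fn n) (gn n y)) ->
  uconv A fn f -> uconv A gn g -> is_derive x v f (g x).
Proof.
move=> r0 HA Hd Hf Hg.
have D : is_derive (0 : R) 1 (fun r => f (x + r *: v)) (g (x + 0 *: v)).
  apply: (@limit_derivative R (fun n r => fn n (x + r *: v)) (fun n r => gn n (x + r *: v))
    (fun r => f (x + r *: v)) (fun r => g (x + r *: v)) rho r0).
  - move=> n r rr; have /is_derive_epsP H := Hd n _ (HA r rr).
    apply/is_derive_epsP => ep /H[dl dl0 K]; exists dl => // h /K.
    by rewrite [h *: 1]mulr1 scalerDl addrA.
  - by move=> r rr; exact: uconv_cvg Hf (HA r rr).
  - move=> ep ep0; have [N HN] := Hg ep ep0; exists N => // n Nn r rr.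
    exact: HN (HA r rr).
move/is_derive_epsP : D => D; apply/is_derive_epsP => ep /D[dl dl0 K]; exists dl => // h /K.
by rewrite add0r [h *: 1]mulr1 scale0r addr0.
Qed.

Lemma uconv_lin (T : Type) (A : set T) (f h : nat -> T -> R) (g k : T -> R) (a b : R) :
  uconv A f g -> uconv A h k ->
  uconv A (fun n p => a * f n p + b * h n p) (fun p => a * g p + b * k p).
Proof.
move=> H1 H2 ep ep0; pose c := `|a| + `|b| + 1.
have c0 : 0 < c by rewrite ltr_wpDl// addr_ge0.
have [N1 K1] := H1 (ep / c) (divr_gt0 ep0 c0); have [N2 K2] := H2 (ep / c) (divr_gt0 ep0 c0).
exists (maxn N1 N2) => n p; rewrite geq_max => /andP[n1 n2] Ap.
rewrite (_ : _ - _ = a * (f n p - g p) + b * (h n p - k p)); last by ring.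
apply: (le_trans (ler_normD _ _)); rewrite !normrM.
have := ler_wpM2l (normr_ge0 a) (K1 n p n1 Ap); have := ler_wpM2l (normr_ge0 b) (K2 n p n2 Ap).
have : (ep / c) * c = ep by rewrite divfK// gt_eqF.
have : 0 <= ep / c by apply: divr_ge0; exact: ltW.
by rewrite /c; move: (normr_ge0 a) (normr_ge0 b); clear; lra.
Qed.

Lemma uconv_cst (T : Type) (A : set T) (g : T -> R) : uconv A (fun=> g) g.
Proof. by move=> ep ep0; exists 0%N => n p _ _; rewrite subrr normr0 ltW. Qed.

End uniform_limits.

(** * Spaces of data and solutions, and the a priori bound *)

Section solution_classes.
Context {R : realType} {d : nat}.
Local Notation E := 'rV[R]_d.
Local Notation e i := (delta_mx 0 i : 'rV[R]_d).
Implicit Types (x y z : E) (i j n : 'I_d) (s t : R).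
Implicit Types (f g v w : R * E -> R) (dv dw : 'I_d -> R * E -> R)
  (Hv Hw : 'I_d -> 'I_d -> R * E -> R) (q : R * E -> 'M[R]_d) (b : R * E -> E).

(* isY and isX are the balls of radius K in the spaces of right-hand sides and of solutions with
   zero initial value; Holder continuity is only required in the space variable. *)
Definition isY (al K : R) g :=
  [/\ continuous g, forall p, `|g p| <= K
    & forall t x y, `|g (t, x) - g (t, y)| <= K * `|x - y| `^ al].

Definition isX (al K : R) v dv Hv :=
  [/\ [/\ continuous v, forall i, continuous (dv i) & forall i j, continuous (Hv i j)],
      C2_slices v dv Hv,
      forall t x, t <= 0 -> v (t, x) = 0,
      forall p, [/\ `|v p| <= K, forall i, `|dv i p| <= K & forall i j, `|Hv i j p| <= K]
    & forall i j t x y, `|Hv i j (t, x) - Hv i j (t, y)| <= K * `|x - y| `^ al].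

Lemma C2_slices_lin (a c : R) v dv Hv w dw Hw : C2_slices v dv Hv -> C2_slices w dw Hw ->
  C2_slices (fun p => a * v p + c * w p) (fun i p => a * dv i p + c * dw i p)
    (fun i j p => a * Hv i j p + c * Hw i j p).
Proof. by move=> H1 H2 t; exact: is_C2_lin. Qed.

Lemma op_lin (a c : R) q b dv Hv dw Hw p :
  op q b (fun i p => a * dv i p + c * dw i p) (fun i j p => a * Hv i j p + c * Hw i j p) p
  = a * op q b dv Hv p + c * op q b dw Hw p.
Proof.
rewrite /op (mulrDr a) (mulrDr c) !mulr_sumr addrACA; congr (_ + _); rewrite -big_split; apply: eq_bigr => i _ /=.
  by rewrite !mulr_sumr -big_split; apply: eq_bigr => j _ /=; ring.
by ring.
Qed.

Lemma solves_on_lin (U : set (R * E)) (a c : R) q b g v dv Hv h w dw Hw :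
  solves_on U q b g v dv Hv -> solves_on U q b h w dw Hw ->
  solves_on U q b (fun p => a * g p + c * h p) (fun p => a * v p + c * w p)
    (fun i p => a * dv i p + c * dw i p) (fun i j p => a * Hv i j p + c * Hw i j p).
Proof.
move=> H1 H2 t x Up; have := is_deriveD (is_deriveMl a (H1 t x Up)) (is_deriveMl c (H2 t x Up)).
rewrite op_lin; congr (is_derive _ _ _ _); ring.
Qed.

Lemma lin_bound (a c u1 u2 K1 K2 : R) : `|u1| <= K1 -> `|u2| <= K2 ->
  `|a * u1 + c * u2| <= `|a| * K1 + `|c| * K2.
Proof.
move=> h1 h2; apply: (le_trans (ler_normD _ _)); rewrite !normrM.
by apply: lerD; apply: ler_wpM2l.
Qed.

Lemma isX_lin (a c al K1 K2 : R) v dv Hv w dw Hw : isX al K1 v dv Hv -> isX al K2 w dw Hw ->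
  isX al (`|a| * K1 + `|c| * K2) (fun p => a * v p + c * w p)
    (fun i p => a * dv i p + c * dw i p) (fun i j p => a * Hv i j p + c * Hw i j p).
Proof.
move=> [[A1 A2 A3] A4 A5 A6 A7] [[B1 B2 B3] B4 B5 B6 B7]; split.
- by split=> [p|i p|i j p]; apply: continuous_lin; (exact: A1 || exact: B1 || exact: A2 || exact: B2 || exact: A3 || exact: B3).
- exact: C2_slices_lin.
- by move=> t x t0; rewrite A5// B5// !mulr0 addr0.
- move=> p; have [a1 a2 a3] := A6 p; have [b1 b2 b3] := B6 p.
  by split=> [|i|i j]; exact: lin_bound.
- move=> i j t x y; rewrite (_ : _ - _ = a * (Hv i j (t, x) - Hv i j (t, y)) + c * (Hw i j (t, x) - Hw i j (t, y))); last by ring.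
  by apply: (le_trans (lin_bound _ _ (A7 i j t x y) (B7 i j t x y))); rewrite !mulrA -mulrDl.
Qed.

Lemma isY_lin (a c al K1 K2 : R) g h : isY al K1 g -> isY al K2 h ->
  isY al (`|a| * K1 + `|c| * K2) (fun p => a * g p + c * h p).
Proof.
move=> [A1 A2 A3] [B1 B2 B3]; split.
- by move=> p; apply: continuous_lin; [exact: A1|exact: B1].
- by move=> p; exact: lin_bound.
- move=> t x y; rewrite (_ : _ - _ = a * (g (t, x) - g (t, y)) + c * (h (t, x) - h (t, y))); last by ring.
  by apply: (le_trans (lin_bound _ _ (A3 t x y) (B3 t x y))); rewrite !mulrA -mulrDl.
Qed.

(** Where [v > G], the damping gives [- v + g <= 0], so [v - G] is a subsolution there. The bound
    [K] makes the maximum principle on the whole space applicable and does not enter the result. *)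
Lemma sup_bound (al lam La K G : R) q b g v dv Hv : 0 < lam -> 0 <= La -> 0 <= G ->
  coefs_on after0 al lam La q b -> continuous v -> C2_slices v dv Hv ->
  solves_on after0 q b g v dv Hv -> (forall p, `|v p| <= K) ->
  (forall p, after0 p -> g p <= G) -> (forall x, v (0, x) <= G) ->
  forall t x, 0 <= t -> v (t, x) <= G.
Proof.
move=> lam0 La0 G0 Hc cv H2 Hs HK Hg H0 t x t0.
pose w p := v p - G.
suff : w (t, x) <= 0 by rewrite /w subr_le0.
apply: (@bounded_coefs_max_principle R d al lam La t (K + G) w
  (fun p => op q b dv Hv p - v p + g p) dv Hv q b lam0 La0 Hc) => //.
- apply: continuous_subspaceT => p; apply: cvgB; [exact: cv|exact: cvg_cst].
- move=> s _; apply: (is_C2_ext (is_C2_lin 1 (- G) (H2 s) (is_C2_cst 1))) => * /=; rewrite /w; ring.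
- move=> s y /andP[s0 _]; have := is_deriveB (Hs s y s0) (is_derive_cst G s 1).
  by rewrite subr0.
- by move=> y; rewrite /w subr_le0.
- move=> s y _; rewrite /w; have := HK (s, y); have := ler_norm (v (s, y)); move: G0; clear; lra.
- move=> s y /andP[s0 _]; rewrite /w; have := Hg (s, y) s0; clear; lra.
- by rewrite t0 lexx.
Qed.

Lemma sup_bound_abs (al lam La K G : R) q b g v dv Hv : 0 < lam -> 0 <= La -> 0 <= G ->
  coefs_on after0 al lam La q b -> continuous v -> C2_slices v dv Hv ->
  solves_on after0 q b g v dv Hv -> (forall p, `|v p| <= K) ->
  (forall p, after0 p -> `|g p| <= G) -> (forall x, `|v (0, x)| <= G) ->
  forall t x, 0 <= t -> `|v (t, x)| <= G.
Proof.
move=> lam0 La0 G0 Hc cv H2 Hs HK Hg H0 t x t0; rewrite ler_norml; apply/andP; split; last first.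
  apply: (sup_bound lam0 La0 G0 Hc cv H2 Hs HK) => // [p p0|y].
    by apply: le_trans (Hg p p0); exact: ler_norm.
  by apply: le_trans (H0 y); exact: ler_norm.
pose w p := (-1) * v p + 0 * v p.
have cw : continuous w by move=> p; apply: continuous_lin; exact: cv.
have := @sup_bound al lam La K G q b _ w _ _ lam0 La0 G0 Hc cw (C2_slices_lin (-1) 0 H2 H2) (solves_on_lin (-1) 0 Hs Hs).
have wE p : w p = - v p by rewrite /w; ring.
move=> /(_ _ _ _ t x t0); rewrite wE lerNl; apply.
- by move=> p; rewrite wE normrN.
- move=> p p0; apply: le_trans (Hg p p0); rewrite mul0r addr0 mulN1r -normrN; exact: ler_norm.
- by move=> y; rewrite wE; apply: le_trans (H0 y); rewrite -normrN; exact: ler_norm.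
Qed.

(** Whatever the size of [K], the sup bound gives [|v| <= G], and the global estimate then controls
    the derivatives. At times [t <= 0] everything vanishes with [v]. *)
Lemma a_priori (al lam La : R) : 0 < al < 1 -> 0 < lam -> 0 <= La ->
  exists2 C : R, 1 <= C & forall (K G : R) q b g v dv Hv, 0 <= G ->
    coefs_on after0 al lam La q b -> isX al K v dv Hv -> solves_on after0 q b g v dv Hv ->
    isY al G g -> isX al (C * G) v dv Hv.
Proof.
move=> al01 lam0 La0; have [C C0 GS] := @global_schauder R d al lam La al01 lam0 La0.
exists (2 * C + 1); first by rewrite lerDr mulr_ge0.
move=> K G q b g v dv Hv G0 Hc [[A1 A2 A3] A4 A5 A6 A7] Hs [B1 B2 B3].
have v0 x : v (0, x) = 0 by exact: A5.
have S t x : 0 <= t -> `|v (t, x)| <= G.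
  have Kv p : `|v p| <= K by have [] := A6 p.
  apply: (sup_bound_abs lam0 La0 G0 Hc A1 A4 Hs Kv) => [p _|y].
  - exact: B2.
  - by rewrite v0 normr0.
have [D1 D2 D3] := GS G G K q b g v dv Hv G0 G0 A1 A4 Hs Hc
  ltac:(by move=> [t x] /ltW t0; exact: S) (fun t x y _ _ => B3 t x y) A7 v0.
have CG : C * (G + G) <= (2 * C + 1) * G by move: G0; clear; lra.
have CG0 : 0 <= (2 * C + 1) * G by pos.
have neg t : t <= 0 -> (forall i x, dv i (t, x) = 0) /\ (forall i j x, Hv i j (t, x) = 0).
  move=> t0; have Z x : v (t, x) = 0 by exact: A5.
  split=> [i x|]; last exact: hessian_eq0 A4 Z.
  have [H1 _ _ _] := A4 t; have A := H1 i x.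
  have E0 : (fun x => v (t, x)) = cst 0 by apply/funext => z; exact: Z.
  rewrite E0 in A; have B := is_derive_cst (0 : R) x (e i).
  by rewrite -(@derive_val _ _ _ _ _ _ _ A) (@derive_val _ _ _ _ _ _ _ B).
split=> //.
- case=> t x; have [t0|t0] := ltP 0 t; last first.
    by have [Z1 Z2] := neg t t0; split=> [|i|i j]; rewrite ?A5 ?Z1 ?Z2 ?normr0.
  split=> [|i|i j]; last exact: le_trans (D1 i j (t, x) t0) CG.
    apply: (le_trans (S t x (ltW t0))); have : 0 <= C * G by pos.
    by clear; lra.
  exact: le_trans (D2 i (t, x) t0) CG.
- move=> i j t x y; have [t0|t0] := ltP 0 t; last first.
    by have [_ Z2] := neg t t0; rewrite !Z2 subrr normr0; pos.
  by apply: (le_trans (D3 i j t x y t0 t0)); rewrite ler_wpM2r ?powR_ge0.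
Qed.

End solution_classes.

(** * Balls of solutions are closed in the sup norm *)

Section closure_of_solutions.
Context {R : realType} {d : nat}.
Local Notation E := 'rV[R]_d.
Local Notation e i := (delta_mx 0 i : 'rV[R]_d).
Implicit Types (x y z : E) (i j : 'I_d) (n m : nat) (s t : R).
Implicit Types (f g v w : R * E -> R) (dv dw : 'I_d -> R * E -> R)
  (Hv Hw : 'I_d -> 'I_d -> R * E -> R) (q : R * E -> 'M[R]_d) (b : R * E -> E).

(** On a ball the Hessians share one Holder modulus. Interpolation with a fixed small step therefore
    turns closeness of values into closeness of derivatives. *)
Lemma X_interpolation (al K ep : R) : 0 < al -> 0 <= K -> 0 < ep ->
  exists2 dl : R, 0 < dl & forall v dv Hv w dw Hw, isX al K v dv Hv -> isX al K w dw Hw ->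
    (forall p, `|v p - w p| <= dl) ->
    forall p, (forall i, `|dv i p - dw i p| <= ep) /\ (forall i j, `|Hv i j p - Hw i j p| <= ep).
Proof.
move=> al0 K0 ep0.
have c0 : 0 < ep / (16 * (K + 1)) by rewrite divr_gt0// mulr_gt0// ltr_wpDl.
have [h2 h20 Hh2] := @powR_small R al _ al0 c0.
pose h := h2 / 2; have h0 : 0 < h by rewrite divr_gt0.
have hE : 2 * h = h2 by rewrite /h; field.
(* The first bound controls [4 * dl / h ^+ 2] in the Hessian, the second [2 * dl] in the
   gradient. *)
pose dl := Num.min (ep * h ^+ 2 / 32) (ep / 8).
have dl0 : 0 < dl by rewrite lt_min !divr_gt0// mulr_gt0// exprn_gt0.
have dl1 : dl <= ep * h ^+ 2 / 32 by rewrite ge_min lexx.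
have dl2 : dl <= ep / 8 by rewrite ge_min lexx orbT.
exists dl => // v dv Hv w dw Hw X1 X2 Hd [t x].
have [[_ _ _] C2 _ _ Hh] := isX_lin 1 (-1) X1 X2.
have Hd' y : `|1 * v (t, y) + -1 * w (t, y)| <= dl by rewrite mul1r mulN1r; exact: Hd.
have KE : `|1| * K + `|-1| * K = 2 * K by rewrite normrN1 normr1; ring.
have S2 i j y : `|1 * Hv i j (t, y) + -1 * Hw i j (t, y)| <= ep / 2.
  apply: (le_trans (@interpolation_hessian _ _ _ _ _ y i j h dl (ep / 8) (C2 t) h0 (fun z _ => Hd' z) _)).
    move=> z zy; have := Hh i j t z y; rewrite KE => /le_trans; apply.
    have : `|z - y| `^ al <= ep / (16 * (K + 1)).
      by apply: le_trans Hh2; apply: powR_le; [exact: ltW|exact: normr_ge0|rewrite -hE].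
    have K2 : 0 <= 2 * K by pos.
    move=> /(ler_wpM2l K2) /le_trans; apply.
    rewrite mulrA ler_pdivrMr ?mulr_gt0 ?ltr_wpDl//; move: K0 ep0; clear; nra.
  have : 4 * dl / h ^+ 2 <= ep / 8.
    by rewrite ler_pdivrMr ?exprn_gt0//; move: dl1; clear; lra.
  by move: ep0; clear; lra.
split=> [i|i j]; last first.
  by have := S2 i j x; rewrite mul1r mulN1r; move=> /le_trans; apply; move: ep0; clear; lra.
have := @interpolation_gradient _ _ _ _ _ x i 1 dl (ep / 2) (C2 t) ltr01 (fun z _ => Hd' z) (fun z _ => S2 i i z).
rewrite mul1r mulN1r divr1 mul1r => /le_trans; apply.
by move: dl2 ep0; clear; lra.
Qed.

(** The derivatives inherit the Cauchy property from the values by [X_interpolation], and the bounds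
    defining the ball pass to the limit pointwise. *)
Lemma X_limit (al K : R) (v : nat -> R * E -> R) (dv : nat -> 'I_d -> R * E -> R)
    (Hv : nat -> 'I_d -> 'I_d -> R * E -> R) : 0 < al -> 0 <= K ->
  (forall n, isX al K (v n) (dv n) (Hv n)) -> ucauchy setT v ->
  exists V dV HV, [/\ isX al K V dV HV, uconv setT v V,
    forall i, uconv setT (fun n => dv n i) (dV i) & forall i j, uconv setT (fun n => Hv n i j) (HV i j)].
Proof.
move=> al0 K0 HX Cv.
have C12 ep : 0 < ep -> exists N, forall n m p, (N <= n)%N -> (N <= m)%N ->
    (forall i, `|dv n i p - dv m i p| <= ep) /\ (forall i j, `|Hv n i j p - Hv m i j p| <= ep).
  move=> ep0; have [dl dl0 Hd] := @X_interpolation al K ep al0 K0 ep0.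
  have [N HN] := Cv dl dl0; exists N => n m p Nn Nm.
  by apply: (Hd _ _ _ _ _ _ (HX n) (HX m)) => p'; exact: HN.
have U0 := ucauchy_uconv Cv.
have U1 i : uconv setT (fun n => dv n i) (limf (fun n => dv n i)).
  apply: ucauchy_uconv => ep /C12 [N HN]; exists N => n m p Nn Nm _; exact: (HN n m p Nn Nm).1.
have U2 i j : uconv setT (fun n => Hv n i j) (limf (fun n => Hv n i j)).
  apply: ucauchy_uconv => ep /C12 [N HN]; exists N => n m p Nn Nm _; exact: (HN n m p Nn Nm).2.
exists (limf v), (fun i => limf (fun n => dv n i)), (fun i j => limf (fun n => Hv n i j)).
have CT (f : nat -> R * E -> R) g : uconv setT f g -> (forall n, continuous (f n)) -> continuous g.
  by move=> H Hc p; apply: (@uconv_continuous _ _ setT f g p 1 ltr01) => // n; exact: Hc.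
have sl (f : nat -> R * E -> R) g t : uconv setT f g -> uconv (@setT E) (fun n x => f n (t, x)) (fun x => g (t, x)).
  by move=> H ep ep0; have [N HN] := H ep ep0; exists N => n x Nn _; exact: HN.
have c1 i : continuous (limf (fun n => dv n i)).
  by apply: CT (U1 i) _ => n; have [[_ A _] _ _ _ _] := HX n; exact: A.
have c2 i j : continuous (limf (fun n => Hv n i j)).
  by apply: CT (U2 i j) _ => n; have [[_ _ A] _ _ _ _] := HX n; exact: A.
split=> //; split.
- by split=> //; apply: CT U0 _ => n; have [[A _ _] _ _ _ _] := HX n; exact: A.
- move=> t; split=> [i x|i x|i j x|i j x];
    [|exact: continuous_slice (c1 i _)| |exact: continuous_slice (c2 i j _)].
    apply: (@uconv_derive _ _ setT _ _ _ _ x (e i) 1 ltr01 (fun _ _ => I) _ (sl _ _ t U0) (sl _ _ t (U1 i))).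
    by move=> n y _; have [_ A _ _ _] := HX n; have [A1 _ _ _] := A t; exact: A1.
  apply: (@uconv_derive _ _ setT _ _ _ _ x (e i) 1 ltr01 (fun _ _ => I) _ (sl _ _ t (U1 j)) (sl _ _ t (U2 i j))).
  by move=> n y _; have [_ A _ _ _] := HX n; have [_ _ A3 _] := A t; exact: A3.
- move=> t x t0; apply/eqP; rewrite -normr_le0; apply: (uconv_le U0 I) => n.
  by have [_ _ A _ _] := HX n; rewrite A// normr0.
- move=> p; split=> [|i|i j].
  + by apply: (uconv_le U0 I) => n; have [_ _ _ A _] := HX n; have [] := A p.
  + by apply: (uconv_le (U1 i) I) => n; have [_ _ _ A _] := HX n; have [_ A1 _] := A p; exact: A1.
  + by apply: (uconv_le (U2 i j) I) => n; have [_ _ _ A _] := HX n; have [_ _ A1] := A p; exact: A1.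
- move=> i j t x y.
  have D := uconv_lin 1 (-1) (sl _ _ t (U2 i j)) (sl _ _ t (U2 i j)).
  have C : `|Hv n i j (t, x) - Hv n i j (t, y)| @[n --> \oo] --> `|limf (fun n => Hv n i j) (t, x) - limf (fun n => Hv n i j) (t, y)|.
    by apply: cvg_norm; apply: cvgB; exact: uconv_cvg (U2 i j) I.
  by apply: (cvg_le_bound C); exists 0%N => // n _; have [_ _ _ _ A] := HX n; exact: A.
Qed.

Lemma op_uconv (A : set (R * E)) (La : R) q b (dv : nat -> 'I_d -> R * E -> R)
    (Hv : nat -> 'I_d -> 'I_d -> R * E -> R) dV HV : 0 <= La ->
  (forall p, A p -> (forall i j, `|q p i j| <= La) /\ forall i, `|b p 0 i| <= La) ->
  (forall i, uconv A (fun n => dv n i) (dV i)) -> (forall i j, uconv A (fun n => Hv n i j) (HV i j)) ->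
  uconv A (fun n => op q b (dv n) (Hv n)) (op q b dV HV).
Proof.
move=> La0 Hq U1 U2 ep ep0.
pose dn : R := d%:R; have dn0 : 0 <= dn by exact: ler0n.
pose c := dn * (dn * La) + dn * La + 1.
have c1 : 0 <= dn * (dn * La) + dn * La by pos.
have c0 : 0 < c by rewrite ltr_wpDl.
have e0 : 0 < ep / c by rewrite divr_gt0.
have [f Hf] := choice (fun i => U1 i (ep / c) e0).
have [g Hg] := choice (fun ij : 'I_d * 'I_d => U2 ij.1 ij.2 (ep / c) e0).
exists (maxn (\max_i f i) (\max_ij g ij)) => n p; rewrite geq_max => /andP[n1 n2] Ap.
have [q1 b1] := Hq p Ap.
rewrite (_ : _ - _ = 1 * op q b (dv n) (Hv n) p + (-1) * op q b dV HV p); last by ring.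
rewrite -op_lin /op; apply: (le_trans (ler_normD _ _)).
have A1 : `|\sum_i \sum_j q p i j * (1 * Hv n i j p + -1 * HV i j p)| <= dn * (dn * (La * (ep / c))).
  apply: sum_le_const => i; apply: sum_le_const => j; rewrite normrM; apply: ler_pM => //.
  rewrite mul1r mulN1r; apply: (Hg (i, j)) => //; apply: leq_trans n2.
  exact: (@leq_bigmax _ g (i, j)).
have A2 : `|\sum_i b p 0 i * (1 * dv n i p + -1 * dV i p)| <= dn * (La * (ep / c)).
  apply: sum_le_const => i; rewrite normrM; apply: ler_pM => //.
  rewrite mul1r mulN1r; apply: Hf => //; apply: leq_trans n1.
  exact: (@leq_bigmax _ f i).
apply: (le_trans (lerD A1 A2)).
have : (ep / c) * c = ep by rewrite divfK// gt_eqF.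
by move: (ltW e0); set r := ep / c; clearbody r; rewrite /c; clear; lra.
Qed.

(** The right-hand sides converge uniformly on a time segment through [(t, x)], so the time
    derivative passes to the limit with the equation. *)
Lemma solves_uconv (A : set (R * E)) (La : R) q b (gn : nat -> R * E -> R) g (v : nat -> R * E -> R) (dv : nat -> 'I_d -> R * E -> R)
    (Hv : nat -> 'I_d -> 'I_d -> R * E -> R) V dV HV (t rho : R) x :
  0 <= La -> (forall p, A p -> (forall i j, `|q p i j| <= La) /\ forall i, `|b p 0 i| <= La) ->
  (forall n, solves_on A q b (gn n) (v n) (dv n) (Hv n)) ->
  uconv A gn g -> uconv A v V ->
  (forall i, uconv A (fun n => dv n i) (dV i)) -> (forall i j, uconv A (fun n => Hv n i j) (HV i j)) ->
  0 < rho -> (forall s, `|s - t| < rho -> A (s, x)) ->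
  is_derive t 1 (fun s => V (s, x)) (op q b dV HV (t, x) - V (t, x) + g (t, x)).
Proof.
move=> La0 Hq Hs Ug U0 U1 U2 r0 HA.
have UO := op_uconv La0 Hq U1 U2.
have UR := uconv_lin 1 1 (uconv_lin 1 (-1) UO U0) Ug.
pose AT : set R := [set s | A (s, x)].
have sl (f : nat -> R * E -> R) h : uconv A f h -> uconv AT (fun n s => f n (s, x)) (fun s => h (s, x)).
  by move=> H ep ep0; have [N HN] := H ep ep0; exists N => n s Nn As; exact: HN.
rewrite (_ : _ + _ = 1 * (1 * op q b dV HV (t, x) + -1 * V (t, x)) + 1 * g (t, x)); last by ring.
apply: (@uconv_derive _ _ AT _ _ _ _ t 1 rho r0 _ _ (sl _ _ U0) (sl _ _ UR)).
- by move=> r rr; apply: HA; rewrite [r *: 1]mulr1 addrC addKr.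
- by move=> n s As; have := Hs n s x As; rewrite !mul1r mulN1r.
Qed.

Lemma X_closure (al K lam La : R) q b (gn : nat -> R * E -> R) g (v : nat -> R * E -> R) (dv : nat -> 'I_d -> R * E -> R)
    (Hv : nat -> 'I_d -> 'I_d -> R * E -> R) : 0 < al -> 0 <= K -> 0 <= La ->
  coefs_on after0 al lam La q b ->
  (forall n, isX al K (v n) (dv n) (Hv n)) -> ucauchy setT v ->
  (forall n, solves_on after0 q b (gn n) (v n) (dv n) (Hv n)) -> uconv setT gn g ->
  exists V dV HV, [/\ isX al K V dV HV, solves_on after0 q b g V dV HV & uconv setT v V].
Proof.
move=> al0 K0 La0 [_ C2 C3] HX Cv Hs Ug.
have [V [dV [HV [XV U0 U1 U2]]]] := X_limit al0 K0 HX Cv.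
exists V, dV, HV; split=> // t x t0.
have sub (f : nat -> R * E -> R) h : uconv setT f h -> uconv after0 f h.
  by move=> H ep ep0; have [N HN] := H ep ep0; exists N => n p Nn _; exact: HN.
apply: (@solves_uconv after0 La q b gn g v dv Hv V dV HV t t x La0 _ Hs (sub _ _ Ug) (sub _ _ U0)
  (fun i => sub _ _ (U1 i)) (fun i j => sub _ _ (U2 i j)) t0).
- by move=> p p0; split=> [i j|i]; [exact: (C2 i j).1|exact: (C3 i).1].
- by move=> s; rewrite /after0 /= ltr_norml; clear; lra.
Qed.

End closure_of_solutions.

(** * A damped linear ordinary differential equation *)

Section linear_ode.
Context {R : realType}.
Implicit Types (k t s M : R) (f g y z : R -> R).

Definition isode k f y :=
  [/\ forall t, t <= 0 -> y t = 0, continuous y & forall t, 0 < t -> is_derive t 1 y (f t - k * y t)].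

Lemma isode_lin (a c : R) k f y g z : isode k f y -> isode k g z ->
  isode k (fun t => a * f t + c * g t) (fun t => a * y t + c * z t).
Proof.
move=> [A1 A2 A3] [B1 B2 B3]; split.
- by move=> t t0; rewrite A1// B1// !mulr0 addr0.
- by move=> t; apply: continuous_lin; [exact: A2|exact: B2].
- move=> t t0; have := is_deriveD (is_deriveMl a (A3 t t0)) (is_deriveMl c (B3 t t0)).
  by congr (is_derive _ _ _ _); ring.
Qed.

(** The function [expR (k * s) * (y s - M / k)] is nonincreasing for [s > 0] and starts at
    [- (M / k)]. *)
Lemma isode_upper k f y M : 0 < k -> 0 <= M -> isode k f y -> (forall t, 0 < t -> f t <= M) ->
  forall t, y t <= M / k.
Proof.
move=> k0 M0 [Y1 Y2 Y3] Hf t; have Mk : 0 <= M / k by apply: divr_ge0; pos.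
have [t0|t0] := leP t 0; first by rewrite Y1.
pose z s := expR (k * s) * (y s - M / k).
have cz : continuous z.
  move=> s; have cc (r : R) : {for s, continuous (fun=> r : R)} by exact: cst_continuous.
  have ci : {for s, continuous (fun u : R => u)} by exact: cvg_id.
  have c1 := continuous_comp (continuousM (cc k) ci) (@continuous_expR R _).
  exact: (continuousM c1 (continuousB (Y2 s) (cc (M / k)))).
have dz s : s \in `]0, t[ -> is_derive s 1 z (expR (k * s) * (f s - M)).
  rewrite in_itv/= => /andP[s0 _].
  have := is_deriveM (is_derive_expR_scale k s) (is_deriveB (Y3 s s0) (is_derive_cst (M / k) s 1)).
  rewrite subr0 /GRing.scale/= (_ : _ + _ = expR (k * s) * (f s - M)) //.
  by rewrite !fctE /=; field; rewrite gt_eqF.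
have [c /[!in_itv]/= /andP[c0 ct] E1] := MVT t0 dz (continuous_subspaceT cz).
have z0 : z 0 = - (M / k) by rewrite /z mulr0 expR0 Y1// sub0r mul1r.
have : z t <= 0.
  rewrite -(subrK (z 0) (z t)) E1 z0 subr0.
  have A : expR (k * c) * (f c - M) <= 0 by rewrite pmulr_rle0 ?expR_gt0// subr_le0; exact: Hf.
  by have := mulr_le0_ge0 A (ltW t0); move: Mk; clear; lra.
by rewrite /z pmulr_rle0 ?expR_gt0// subr_le0.
Qed.

Lemma isode_bound k f y M : 0 < k -> 0 <= M -> isode k f y -> (forall t, 0 < t -> `|f t| <= M) ->
  forall t, `|y t| <= M / k.
Proof.
move=> k0 M0 H Hf t; rewrite ler_norml; apply/andP; split; last first.
  by apply: (isode_upper k0 M0 H) => s /Hf; exact: le_trans (ler_norm _).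
have := isode_upper k0 M0 (isode_lin (-1) 0 H H) _ t => /(_ _)/wrap[].
  move=> s /Hf; rewrite mul0r addr0 mulN1r -normrN; exact: le_trans (ler_norm _).
by rewrite mul0r addr0 mulN1r lerNl.
Qed.

(** Variation of constants gives a solution [z] on []-1, +oo[] vanishing at 0; composing it with the
    maximum of [s] and 0 extends it by 0 to the left. *)
Lemma isode_exists k f : 0 < k -> continuous f -> exists y, isode k f y.
Proof.
move=> k0 cf.
have ce s : {for s, continuous (fun u : R => expR (k * u))}.
  have cc (r : R) : {for s, continuous (fun=> r : R)} by exact: cst_continuous.
  have ci : {for s, continuous (fun u : R => u)} by exact: cvg_id.
  exact: (continuous_comp (continuousM (cc k) ci) (@continuous_expR R _)).
have cef : continuous (fun s => expR (k * s) * f s) by move=> s; exact: (continuousM (ce s) (cf s)).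
have [F HF] := exists_primitive cef.
pose z s := expR (- k * s) * (F s - F 0).
have dz s : -1 < s -> is_derive s 1 z (f s - k * z s).
  move=> s1; have := is_deriveM (is_derive_expR_scale (- k) s) (is_deriveB (HF s s1) (is_derive_cst (F 0) s 1)).
  rewrite subr0 /GRing.scale/= (_ : _ + _ = f s - k * z s) //.
  have -> : z s = expR (- k * s) * (F s - F 0) by [].
  have E : expR (- k * s) * (expR (k * s) * f s) = f s.
    by rewrite mulrA -expRD mulNr addNr expR0 mul1r.
  by rewrite E; change ((F - cst (F 0)) s) with (F s - F 0); ring.
pose m s := Num.max s 0.
have m0 s : 0 <= m s by rewrite le_max lexx orbT.
have z0 : z 0 = 0 by rewrite /z subrr mulr0.
exists (fun s => z (m s)); split.
- by move=> t t0; rewrite /m max_r.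
- move=> t; apply: (@continuous_comp _ _ _ m z).
    have ci : {for t, continuous (fun u : R => u)} by exact: cvg_id.
    have cc : {for t, continuous (fun=> 0 : R)} by exact: cst_continuous.
    exact: (continuous_max ci cc).
  by apply: is_derive_continuous1; apply: dz; have := m0 t; lra.
- move=> t t0; have mt : m t = t by rewrite /m max_l// ltW.
  have /is_derive_epsP H : is_derive t 1 z (f t - k * z t) by apply: dz; lra.
  rewrite mt; apply/is_derive_epsP => ep /H [dl dl0 Hd].
  exists (Num.min dl t); first by rewrite lt_min dl0.
  move=> h; rewrite lt_min => /andP[h1 h2]; have := Hd h h1.
  rewrite /GRing.scale/= mulr1 mt (_ : m (t + h) = t + h)// /m max_l//.
  by move: h2; rewrite ltr_norml; lra.
Qed.

Lemma geometric_ucauchy (T : Type) (A : set T) (f : nat -> T -> R) (K r : R) : 0 <= K -> 0 <= r < 1 ->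
  (forall n p, A p -> `|f n.+1 p - f n p| <= K * r ^+ n) -> ucauchy A f.
Proof.
move=> K0 /andP[r0 r1] H.
have q0 : 0 < 1 - r by rewrite subr_gt0.
have D n m p : A p -> `|f (n + m)%N p - f n p| <= K * r ^+ n / (1 - r).
  move=> Ap.
  have S : `|f (n + m)%N p - f n p| <= K * r ^+ n * (1 - r ^+ m) / (1 - r).
    elim: m => [|m IH]; first by rewrite addn0 subrr normr0 expr0 subrr mulr0 mul0r.
    rewrite (_ : _ - _ = (f (n + m).+1 p - f (n + m)%N p) + (f (n + m)%N p - f n p)); last by rewrite addnS; ring.
    apply: (le_trans (ler_normD _ _)); apply: (le_trans (lerD (H _ p Ap) IH)).
    rewrite le_eqVlt; apply/orP; left; apply/eqP; rewrite exprD exprS; field.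
    by rewrite gt_eqF.
  apply: (le_trans S); rewrite ler_wpM2r ?invr_ge0 ?(ltW q0)// -[leRHS]mulr1 ler_wpM2l//; first by pos.
  by rewrite gerBl exprn_ge0.
move=> ep ep0.
have /cvgrPdist_lt C0 : r ^+ n @[n --> \oo] --> (0 : R) by apply: cvg_expr; rewrite ger0_norm.
have e1 : 0 < ep * (1 - r) / (2 * (K + 1)) by rewrite divr_gt0 ?mulr_gt0// ltr_wpDl.
have [N _ HN] := C0 _ e1.
have DN n p : (N <= n)%N -> A p -> `|f n p - f N p| <= ep / 2.
  move=> Nn Ap; rewrite -(subnKC Nn); apply: (le_trans (D _ _ _ Ap)).
  have := HN N (leqnn N); rewrite /= sub0r normrN ger0_norm ?exprn_ge0// => HN'.
  rewrite ler_pdivrMr//.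
  have : r ^+ N * (2 * (K + 1)) < ep * (1 - r) by rewrite -ltr_pdivlMr// mulr_gt0// ltr_wpDl.
  have := exprn_ge0 N r0; move: K0; set u := r ^+ N; clear; nra.
exists N => n m p Nn Nm Ap.
rewrite (_ : _ - _ = (f n p - f N p) - (f m p - f N p)); last by ring.
by apply: (le_trans (ler_normB _ _)); move: (DN n p Nn Ap) (DN m p Nm Ap); clear; lra.
Qed.

End linear_ode.

(** * The heat equation discretised in space *)

Section semidiscrete.
Context {R : realType} {d : nat}.
Local Notation E := 'rV[R]_d.
Local Notation e i := (delta_mx 0 i : 'rV[R]_d).
Implicit Types (x y z : E) (i j : 'I_d) (n m : nat) (s t : R).
Implicit Types (f g v w : R * E -> R).

(* The difference Laplacian of step h is shiftsum h v - (rate h - 1) v, hence isSol h g v is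
   v_t = Lap_h v - v + g with v = 0 for t <= 0. *)
Definition rate (h : R) : R := 1 + 2 * d%:R / h ^+ 2.

Definition shiftsum (h : R) v (p : R * E) : R :=
  (\sum_i (v (p.1, p.2 + h *: e i) + v (p.1, p.2 - h *: e i))) / h ^+ 2.

Definition isSol (h : R) g v := forall x,
  isode (rate h) (fun t => g (t, x) + shiftsum h v (t, x)) (fun t => v (t, x)).

Lemma rate_ge1 (h : R) : 1 <= rate h.
Proof. by rewrite /rate lerDl mulr_ge0// ?mulr_ge0// invr_ge0 sqr_ge0. Qed.

Lemma rate_gt0 (h : R) : 0 < rate h. Proof. exact: lt_le_trans (rate_ge1 h). Qed.

Lemma shiftsum_lin (h a c : R) v w p :
  shiftsum h (fun p => a * v p + c * w p) p = a * shiftsum h v p + c * shiftsum h w p.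
Proof.
rewrite /shiftsum !mulrA -mulrDl; congr (_ / _).
by rewrite !mulr_sumr -big_split; apply: eq_bigr => i _ /=; ring.
Qed.

Lemma shiftsum_bound (h B : R) v p : (forall p, `|v p| <= B) -> `|shiftsum h v p| <= (rate h - 1) * B.
Proof.
move=> H; rewrite /shiftsum /rate normrM [`|_^-1|]ger0_norm ?invr_ge0 ?sqr_ge0//.
rewrite (_ : _ * B = (d%:R * (2 * B)) / h ^+ 2); last by ring.
apply: ler_wpM2r; first by rewrite invr_ge0 sqr_ge0.
apply: sum_le_const => i; apply: (le_trans (ler_normD _ _)).
by have := H (p.1, p.2 + h *: e i); have := H (p.1, p.2 - h *: e i); clear; lra.
Qed.

Lemma sol_lin (h a c : R) g v f w : isSol h g v -> isSol h f w ->
  isSol h (fun p => a * g p + c * f p) (fun p => a * v p + c * w p).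
Proof.
move=> H1 H2 x; have := isode_lin a c (H1 x) (H2 x); congr (isode _ _ _).
by apply/funext => t; rewrite shiftsum_lin; ring.
Qed.

Lemma sol_shift (h : R) g v z : isSol h g v ->
  isSol h (fun p => g (p.1, p.2 + z)) (fun p => v (p.1, p.2 + z)).
Proof.
move=> H x; have := H (x + z); congr (isode _ _ _).
apply/funext => t; congr (_ + _ / _); apply: eq_bigr => i _ /=.
by rewrite addrAC [x - _ + z]addrAC.
Qed.

(** For the supremum [S] of [|v|], finite by the bound [K], the equation gives
    [S <= (M + (rate h - 1) * S) / rate h], that is, [S <= M]. The 1 in [rate h], which is the
    damping, makes this uniform in [h]. *)
Lemma sol_bound (h K M : R) g v : isSol h g v -> (forall p, `|v p| <= K) ->
  0 <= M -> (forall t x, 0 < t -> `|g (t, x)| <= M) -> forall p, `|v p| <= M.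
Proof.
move=> H HK M0 Hg p.
pose A := range (fun p => `|v p|).
have Asup : has_sup A by split; [exists `|v p|, p|exists K => _ [q _ <-]; exact: HK].
have HB q : `|v q| <= sup A by apply: (sup_upper_bound Asup); exists q.
apply: (le_trans (HB p)).
have B0 : 0 <= sup A by apply: le_trans (HB p).
have k1 := rate_ge1 h; have k0 := rate_gt0 h.
have X0 : 0 <= M + (rate h - 1) * sup A by rewrite addr_ge0// mulr_ge0// subr_ge0.
have : sup A <= (M + (rate h - 1) * sup A) / rate h.
  apply: ge_sup; first by exists `|v p|, p.
  move=> _ [[t x] _ <-]; apply: (isode_bound k0 X0 (H x)) => s s0.
  apply: (le_trans (ler_normD _ _)); apply: lerD; first exact: Hg.
  exact: shiftsum_bound.
by rewrite ler_pdivlMr//; clear; lra.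
Qed.

Lemma continuous_of_moduli (al K L : R) g : 0 < al -> 0 <= K -> 0 <= L ->
  (forall t x y, `|g (t, x) - g (t, y)| <= K * `|x - y| `^ al) ->
  (forall s t x, `|g (t, x) - g (s, x)| <= L * `|t - s|) -> continuous g.
Proof.
move=> al0 K0 L0 HK HL [s y]; apply/continuous_epsP => ep ep0.
have c0 : 0 < ep / (2 * (K + 1)) by rewrite divr_gt0// mulr_gt0// ltr_wpDl.
have [h h0 Hh] := @powR_small R al _ al0 c0.
exists (Num.min h (ep / (2 * (L + 1)))).
  by rewrite lt_min h0 divr_gt0// mulr_gt0// ltr_wpDl.
move=> [t x]; rewrite lt_min => /andP[].
rewrite prod_normE /= !gt_max => /andP[_ xy] /andP[ts _].
rewrite (_ : _ - _ = (g (t, x) - g (t, y)) + (g (t, y) - g (s, y))); last by ring.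
apply: (le_trans (ler_normD _ _)).
have A1 : `|g (t, x) - g (t, y)| <= ep / 2.
  apply: (le_trans (HK t x y)).
  have : `|x - y| `^ al <= ep / (2 * (K + 1)).
    by apply: le_trans Hh; apply: powR_le; [exact: ltW|exact: normr_ge0|exact: ltW].
  move=> /(ler_wpM2l K0) /le_trans; apply.
  by rewrite mulrA ler_pdivrMr ?mulr_gt0 ?ltr_wpDl//; move: K0 ep0; clear; nra.
have A2 : `|g (t, y) - g (s, y)| <= ep / 2.
  apply: (le_trans (HL s t y)); move/ltW/(ler_wpM2l L0) : ts => /le_trans; apply.
  by rewrite mulrA ler_pdivrMr ?mulr_gt0 ?ltr_wpDl//; move: L0 ep0; clear; nra.
by move: A1 A2; clear; lra.
Qed.

Lemma isY_ge0 (al K : R) g : isY al K g -> 0 <= K.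
Proof. by case=> _ H _; apply: le_trans (H (0, 0)). Qed.

(** The equation commutes with translations. So a space increment of [v] solves it for the increment
    of [g], and [sol_bound] preserves the Holder constant [K]. The Lipschitz constant in time
    depends on [h] and serves for continuity only. *)
Lemma sol_isY (al K h : R) g v : 0 < al -> isY al K g -> isSol h g v ->
  (forall p, `|v p| <= K) -> isY al K v.
Proof.
move=> al0 Yg H HK; have K0 := isY_ge0 Yg; have [g1 g2 g3] := Yg.
have Hv t x y : `|v (t, x) - v (t, y)| <= K * `|x - y| `^ al.
  have := sol_lin 1 (-1) (sol_shift (x - y) H) H.
  move=> D; have := sol_bound D _ _ _ (t, y) => /(_ (2 * K) (K * `|x - y| `^ al)) /=.
  rewrite mul1r mulN1r [y + (x - y)]addrC subrK; apply.
  - move=> p; rewrite mul1r mulN1r; apply: (le_trans (ler_normB _ _)).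
    by have := HK (p.1, p.2 + (x - y)); have := HK p; clear; lra.
  - by rewrite mulr_ge0// powR_ge0.
  - move=> s z _; rewrite mul1r mulN1r; apply: (le_trans (g3 _ _ _)).
    by rewrite [z + _ - z]addrC addKr.
pose L := K + (rate h - 1) * K + rate h * K.
have k1 := rate_ge1 h; have k0 := rate_gt0 h.
have L0 : 0 <= L by rewrite /L !addr_ge0// mulr_ge0// ?subr_ge0// ltW.
have HL s t x : `|v (t, x) - v (s, x)| <= L * `|t - s|.
  have [A1 A2 A3] := H x.
  have main a c : 0 <= a -> a < c -> `|v (c, x) - v (a, x)| <= L * (c - a).
    move=> a0 ac.
    have D u : u \in `]a, c[ -> is_derive u 1 (fun t => v (t, x)) (g (u, x) + shiftsum h v (u, x) - rate h * v (u, x)).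
      by rewrite in_itv/= => /andP[au _]; apply: A3; exact: le_lt_trans au.
    have [u _ ->] := MVT ac D (continuous_subspaceT A2).
    have ca : 0 < c - a by rewrite subr_gt0.
    rewrite normrM (gtr0_norm ca) ler_wpM2r ?(ltW ca)//.
    apply: (le_trans (ler_normB _ _)); apply: lerD.
      by apply: (le_trans (ler_normD _ _)); apply: lerD => //; exact: shiftsum_bound.
    by rewrite normrM (gtr0_norm k0) ler_wpM2l// ltW.
  have tr t' : v (t', x) = v (Num.max t' 0, x).
    by have [t0|t0] := leP t' 0; rewrite // A1// A1.
  rewrite tr [v (s, x)]tr; set t' := Num.max t 0; set s' := Num.max s 0.
  have t'0 : 0 <= t' by rewrite le_max lexx orbT.
  have s'0 : 0 <= s' by rewrite le_max lexx orbT.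
  have lip : `|t' - s'| <= `|t - s|.
    by rewrite /t' /s'; case: (leP t 0); case: (leP s 0) => ? ?; 
      rewrite ler_norml; have := ler_norm (t - s); have := ler_norm (s - t); rewrite [`|s - t|]distrC; lra.
  apply: le_trans (ler_wpM2l L0 lip).
  have [ts|st|->] := ltgtP t' s'.
  - by rewrite distrC [`|t' - s'|]distrC; rewrite [`|s' - t'|]gtr0_norm ?subr_gt0//; exact: main.
  - by rewrite [`|t' - s'|]gtr0_norm ?subr_gt0//; exact: main.
  - by rewrite !subrr normr0 mulr0.
by split=> //; exact: continuous_of_moduli al0 K0 L0 Hv HL.
Qed.

Definition ode_sol (k : R) (f : R -> R) : R -> R := xget (fun=> 0) [set y | isode k f y].

(** The neighbouring values of the previous iterate are put on the right-hand side, which leaves an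
    independent ordinary differential equation at each [x]. *)
Fixpoint picard (h : R) g n : R * E -> R :=
  if n is n'.+1 then fun p => ode_sol (rate h) (fun t => g (t, p.2) + shiftsum h (picard h g n') (t, p.2)) p.1
  else fun=> 0.

Lemma sol_exists (al K h : R) g : 0 < al -> 0 < h -> isY al K g ->
  exists2 v, isSol h g v & isY al K v.
Proof.
move=> al0 h0 Yg; have K0 := isY_ge0 Yg; have [g1 g2 g3] := Yg.
have k1 := rate_ge1 h; have k0 := rate_gt0 h; pose k := rate h.
pose u := picard h g.
have cg x : continuous (fun t => g (t, x)).
  move=> t; have c1 : {for t, continuous (fun=> x : E)} by exact: cst_continuous.
  have c2 : {for t, continuous (fun s : R => s)} by exact: cvg_id.
  exact: (continuous_comp (continuous_pair c2 c1) (g1 _)).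
have cS v : (forall x, continuous (fun t => v (t, x))) -> forall x, continuous (fun t => g (t, x) + shiftsum h v (t, x)).
  move=> cv x t; apply: (continuousD (cg x t)); rewrite /shiftsum /=.
  have cc : {for t, continuous (fun=> (h ^+ 2)^-1 : R)} by exact: cst_continuous.
  apply: (fun H => continuousM H cc); apply: continuous_big_sum => i.
  exact: (continuousD (cv _ t) (cv _ t)).
have Hu n : (forall x, continuous (fun t => u n (t, x))) /\
    forall x, isode k (fun t => g (t, x) + shiftsum h (u n) (t, x)) (fun t => u n.+1 (t, x)).
  elim: n => [|n [_ IH]].
    have c0 x : continuous (fun t => u 0%N (t, x)) by exact: cst_continuous.
    split=> // x; have [y Hy] := isode_exists k0 (cS _ c0 x).
    exact: (xgetPex (fun=> 0) (ex_intro _ y Hy)).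
  have c0 x : continuous (fun t => u n.+1 (t, x)) by have [] := IH x.
  split=> // x; have [y Hy] := isode_exists k0 (cS _ c0 x).
  exact: (xgetPex (fun=> 0) (ex_intro _ y Hy)).
(* The contraction factor: the neighbours weigh [rate h - 1] against the decay rate [rate h]. *)
pose r := (k - 1) / k.
have r01 : 0 <= r < 1.
  rewrite /r divr_ge0 ?subr_ge0 ?(ltW k0)//= ltr_pdivrMr// mul1r; rewrite /k; lra.
have Du n p : `|u n.+1 p - u n p| <= K / k * r ^+ n.
  elim: n p => [|n IH] [t x].
    rewrite subr0 expr0 mulr1; apply: (isode_bound k0 K0 ((Hu 0%N).2 x)) => s _.
    rewrite (_ : shiftsum _ _ _ = 0) ?addr0//.
    by rewrite /shiftsum big1 ?mul0r// => i _; rewrite addr0.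
  have D := isode_lin 1 (-1) ((Hu n.+1).2 x) ((Hu n).2 x).
  have M0 : 0 <= (k - 1) * (K / k * r ^+ n).
    by rewrite mulr_ge0 ?subr_ge0// mulr_ge0 ?divr_ge0 ?(ltW k0)// exprn_ge0//; case/andP: r01.
  have e1 : (k - 1) * (K / k * r ^+ n) / k = K / k * r ^+ n.+1 by rewrite exprS /r; ring.
  have := isode_bound k0 M0 D _ t; rewrite -/k e1 mul1r mulN1r; apply=> s _.
  rewrite (_ : 1 * (g _ + _) + _ = shiftsum h (fun p => 1 * u n.+1 p + (-1) * u n p) (s, x)).
    by rewrite /k; apply: shiftsum_bound => p; rewrite mul1r mulN1r.
  by rewrite shiftsum_lin; ring.
have Kk : 0 <= K / k by rewrite divr_ge0// ltW.
have Cu : ucauchy setT u by apply: (geometric_ucauchy Kk r01) => n p _; exact: Du.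
have Bu n p : `|u n p| <= K.
  elim: n p => [|n IH] [t x]; first by rewrite normr0.
  have M0 : 0 <= K + (k - 1) * K by rewrite addr_ge0// mulr_ge0// subr_ge0.
  have e1 : (K + (k - 1) * K) / k = K by field; rewrite gt_eqF.
  have := isode_bound k0 M0 ((Hu n).2 x) _ t; rewrite -/k e1; apply=> s _.
  apply: (le_trans (ler_normD _ _)); apply: lerD => //; exact: shiftsum_bound.
have Uu := ucauchy_uconv Cu; set V := limf u in Uu.
have US : uconv setT (fun n => shiftsum h (u n)) (shiftsum h V).
  move=> ep ep0; have [N HN] := Uu (ep / k) (divr_gt0 ep0 k0); exists N => n p Nn _.
  rewrite (_ : _ - _ = shiftsum h (fun p => 1 * u n p + (-1) * V p) p); last by rewrite shiftsum_lin; ring.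
  apply: (le_trans (@shiftsum_bound h (ep / k) _ p _)).
    by move=> p'; rewrite mul1r mulN1r; exact: HN.
  by rewrite mulrA ler_pdivrMr// mulrC ler_wpM2l ?(ltW ep0)// /k gerBl.
have BV p : `|V p| <= K by apply: (uconv_le Uu I).
have SV : isSol h g V.
  move=> x; split.
  - move=> t t0; apply/eqP; rewrite -normr_le0; apply: (uconv_le (f := fun n => u n.+1) (A := setT) _ I).
      by move=> ep /Uu[N HN]; exists N => n p Nn _; apply: HN => //; exact: leqW.
    by move=> n; have [A1 _ _] := (Hu n).2 x; rewrite A1// normr0.
  - move=> t; apply: (@uconv_continuous _ _ setT (fun n t => u n (t, x)) _ t 1 ltr01) => //.
      by move=> ep /Uu[N HN]; exists N => n s Nn _; exact: HN.
    by move=> n; exact: (Hu n).1.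
  - move=> t t0; pose A : set R := [set s | 0 < s].
    apply: (@uconv_derive _ _ A (fun n s => u n.+1 (s, x)) (fun n s => g (s, x) + shiftsum h (u n) (s, x) - k * u n.+1 (s, x))
      (fun s => V (s, x)) (fun s => g (s, x) + shiftsum h V (s, x) - k * V (s, x)) t 1 t t0).
    + by move=> r'; rewrite /A /= [r' *: 1]mulr1 ltr_norml; lra.
    + by move=> n s s0; have [_ _ A3] := (Hu n).2 x; exact: A3.
    + by move=> ep /Uu[N HN]; exists N => n s Nn _; apply: HN => //; exact: leqW.
    + move=> ep ep0; have [N1 H1] := US (ep / 2) ltac:(by rewrite divr_gt0).
      have [N2 H2] := Uu (ep / (2 * k)) ltac:(by rewrite divr_gt0// mulr_gt0).
      exists (maxn N1 N2) => n s; rewrite geq_max => /andP[n1 n2] _.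
      rewrite (_ : _ - _ = (shiftsum h (u n) (s, x) - shiftsum h V (s, x)) - k * (u n.+1 (s, x) - V (s, x))); last by ring.
      apply: (le_trans (ler_normB _ _)); rewrite normrM (gtr0_norm k0).
      have := H1 n (s, x) n1 I; have := ler_wpM2l (ltW k0) (H2 n.+1 (s, x) (leqW n2) I).
      rewrite (_ : k * (ep / (2 * k)) = ep / 2); last by field; rewrite gt_eqF.
      by clear; lra.
by exists V => //; exact: sol_isY al0 Yg SV BV.
Qed.

End semidiscrete.

(** * The heat equation with a smooth right-hand side *)

Section heat_equation.
Context {R : realType} {d : nat}.
Local Notation E := 'rV[R]_d.
Local Notation e i := (delta_mx 0 i : 'rV[R]_d).
Implicit Types (x y z : E) (i j : 'I_d) (n m : nat) (s t : R).
Implicit Types (f g v w : R * E -> R) (dv dg : 'I_d -> R * E -> R) (Hv Hg : 'I_d -> 'I_d -> R * E -> R).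

Lemma holder_increment (al K : R) g g1 i t x (r : R) : 0 <= al -> 0 <= K ->
  (forall y, is_derive y (e i) (fun z => g (t, z)) (g1 (t, y))) ->
  (forall y z, `|g1 (t, y) - g1 (t, z)| <= K * `|y - z| `^ al) ->
  `|g (t, x + r *: e i) - g (t, x) - r * g1 (t, x)| <= K * `|r| `^ al * `|r|.
Proof.
move=> al0 K0 Hd Hh.
have D s : is_derive s 1 (fun u : R => g (t, x + u *: e i)) (g1 (t, x + s *: e i)).
  exact: (is_derive_line (fun z => g (t, z)) x (e i) s _).1.
have fin c : `|c| <= `|r| -> `|r * g1 (t, x + c *: e i) - r * g1 (t, x)| <= K * `|r| `^ al * `|r|.
  move=> cr; rewrite -mulrBr normrM mulrC; apply: ler_wpM2r => //.
  apply: (le_trans (Hh _ _)); apply: ler_wpM2l => //; apply: powR_le => //.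
  by rewrite addrC addKr; apply: le_trans cr; exact: norm_delta_le.
have [r0|r0] := leP 0 r.
  have [c /andP[c0 cr]] := mvt_real r0 (fun s _ => D s); rewrite scale0r addr0 => ->.
  by rewrite subr0 mulrC; apply: fin; rewrite !ger0_norm.
have [c /andP[rc c0]] := mvt_real (ltW r0) (fun s _ => D s); rewrite scale0r addr0 => H.
have -> : g (t, x + r *: e i) - g (t, x) = r * g1 (t, x + c *: e i) by rewrite -opprB H; ring.
by apply: fin; rewrite !ler0_norm ?lerN2// ltW.
Qed.

(** The increment of [v] along [r *: e i] minus [r * v1] solves the semidiscrete equation for the
    same combination of [g] and [g1]. That combination is of order [r ^ (1 + al)], hence so is the
    solution, by [sol_bound]. *)
Lemma sol_derive (al K h : R) g g1 v v1 i : 0 < al -> isY al K g -> isY al K g1 ->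
  (forall t y, is_derive y (e i) (fun z => g (t, z)) (g1 (t, y))) ->
  isSol h g v -> isSol h g1 v1 -> (forall p, `|v p| <= K) -> (forall p, `|v1 p| <= K) ->
  forall t x, is_derive x (e i) (fun z => v (t, z)) (v1 (t, x)).
Proof.
move=> al0 Yg Yg1 Hd Sv Sv1 Bv Bv1 t x; have K0 := isY_ge0 Yg; have [_ _ g3] := Yg1.
apply/is_derive_epsP => ep ep0.
have c0 : 0 < ep / (K + 1) by rewrite divr_gt0// ltr_wpDl.
have [dl dl0 Hdl] := @powR_small R al _ al0 c0.
exists dl => // r rdl.
have D := sol_lin 1 (- r) (sol_lin 1 (-1) (sol_shift (r *: e i) Sv) Sv) Sv1.
have M0 : 0 <= K * `|r| `^ al * `|r| by rewrite !mulr_ge0// powR_ge0.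
have := sol_bound (K := 2 * K + `|r| * K) D _ M0 _ (t, x) => /(_ _ _)/wrap[].
- move=> p; apply: (le_trans (ler_normD _ _)); rewrite !mul1r mulN1r; apply: lerD.
    by apply: (le_trans (ler_normB _ _)); have := Bv (p.1, p.2 + r *: e i); have := Bv p; clear; lra.
  by rewrite normrM normrN ler_wpM2l.
- move=> s y s0; rewrite !mul1r mulN1r mulNr; apply: holder_increment => //; exact: ltW.
rewrite /= !mul1r mulN1r mulNr => /le_trans; apply; apply: ler_wpM2r => //.
have : `|r| `^ al <= ep / (K + 1) by apply: le_trans Hdl; apply: powR_le; rewrite ?(ltW al0)// ltW.
move=> /(ler_wpM2l K0) /le_trans; apply.
by rewrite mulrA ler_pdivrMr ?ltr_wpDl//; move: K0 ep0; clear; nra.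
Qed.

Definition laph (h : R) v p := shiftsum h v p - (@rate R d h - 1) * v p.

(** A second difference is a second derivative at a point within [2 * h] of [x - h *: e i], hence
    within [3 * h] of [x]. *)
Lemma laph_consistency (al K h : R) v dv Hv t x : 0 <= al -> 0 <= K -> 0 < h -> C2_slices v dv Hv ->
  (forall i y z, `|Hv i i (t, y) - Hv i i (t, z)| <= K * `|y - z| `^ al) ->
  `|laph h v (t, x) - \sum_i Hv i i (t, x)| <= d%:R * (K * (3 * h) `^ al).
Proof.
move=> al0 K0 h0 H2 Hh.
have -> : laph h v (t, x) - \sum_i Hv i i (t, x)
    = \sum_i ((v (t, x + h *: e i) + v (t, x - h *: e i) - 2 * v (t, x)) / h ^+ 2 - Hv i i (t, x)).
  rewrite /laph /shiftsum /rate /= sumrB -mulr_suml sumrB sumr_const card_ord; congr (_ - _).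
  rewrite -[_ *+ d]mulr_natl; ring.
apply: sum_le_const => i.
have [y yx E] := ddiff_mixed i i t (x - h *: e i) H2 (ltW h0).
have -> : v (t, x + h *: e i) + v (t, x - h *: e i) - 2 * v (t, x) = h ^+ 2 * Hv i i (t, y).
  by rewrite -E /ddiff /= subrK; ring.
rewrite mulrAC mulfV ?mul1r; last by rewrite expf_neq0// gt_eqF.
apply: (le_trans (Hh _ _ _)); apply: ler_wpM2l => //; apply: powR_le => //.
rewrite (_ : y - x = (y - (x - h *: e i)) - h *: e i); last by rewrite opprB [h *: _ - x]addrC addrA addrK.
apply: (le_trans (ler_normB _ _)); have := @norm_delta_le R d h i; rewrite (gtr0_norm h0).
by move: yx; clear; lra.
Qed.

(** Solutions for different steps become solutions for one step with a corrected right-hand side,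
    and [sol_bound] can then compare them. *)
Lemma sol_change (h k : R) g v : isSol k g v ->
  isSol h (fun p => g p + (laph k v p - laph h v p)) v.
Proof.
move=> H x; have [A1 A2 A3] := H x; split=> // t t0; have := A3 t t0.
by congr (is_derive _ _ _ _); rewrite /laph; ring.
Qed.

Lemma identity_coefs (al : R) : coefs_on after0 al 1 1 (fun=> 1%:M : 'M[R]_d) (fun=> 0 : E).
Proof.
split=> [p _|i j|i].
- split; first by rewrite trmx1.
  move=> v; rewrite /qform mul1r; apply: ler_sum => i _.
  rewrite (bigD1 i)//= big1 ?addr0 => [|j ji]; last by rewrite mxE eq_sym (negbTE ji) mul0r.
  by rewrite mxE eqxx mulr1n mul1r expr2.
- split=> [p _|t x y _ _]; last by rewrite subrr normr0 mul1r powR_ge0.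
  by rewrite mxE; case: eqP; rewrite /= ?normr1 ?normr0.
- by split=> [p _|t x y _ _]; rewrite mxE ?subrr normr0 ?mul1r ?powR_ge0.
Qed.

Lemma op_laplacian dv Hv p : op (fun=> 1%:M : 'M[R]_d) (fun=> 0 : E) dv Hv p = \sum_i Hv i i p.
Proof.
rewrite /op [X in _ + X]big1 ?addr0 => [|i _]; last by rewrite mxE mul0r.
apply: eq_bigr => i _; rewrite (bigD1 i)//= big1 ?addr0 => [|j ji].
  by rewrite mxE eqxx mul1r.
by rewrite mxE eq_sym (negbTE ji) mul0r.
Qed.

(** Since [g] has Holder second derivatives, [sol_derive] bounds the second derivatives of the
    semidiscrete solutions uniformly in the step. The consistency error thus tends to 0, both in the
    comparison of two steps and in the heat equation. *)
Lemma heat_smooth (al K : R) g dg Hg : 0 < al -> isY al K g -> (forall i, isY al K (dg i)) ->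
  (forall i j, isY al K (Hg i j)) -> C2_slices g dg Hg ->
  exists V dV HV, isX al K V dV HV /\ solves_on after0 (fun=> 1%:M) (fun=> 0) g V dV HV.
Proof.
move=> al0 Y0 Y1 Y2 Cg; have K0 := isY_ge0 Y0.
pose h n : R := n.+1%:R^-1; have h0 n : 0 < h n by rewrite invr_gt0.
have ex n : exists w : (R * E -> R) * ('I_d -> R * E -> R) * ('I_d -> 'I_d -> R * E -> R),
    [/\ isSol (h n) g w.1.1, isX al K w.1.1 w.1.2 w.2 & C2_slices w.1.1 w.1.2 w.2].
  have [v Sv Yv] := sol_exists al0 (h0 n) Y0.
  have sol g' : isY al K g' -> exists w, isSol (h n) g' w /\ isY al K w.
    by move=> /(sol_exists al0 (h0 n))[w A B]; exists w.
  have [dv Hdv] := choice (fun i => sol _ (Y1 i)).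
  have [Hv' HHv] := choice (fun ij : 'I_d * 'I_d => sol _ (Y2 ij.1 ij.2)).
  pose Hv i j := Hv' (i, j).
  have C : C2_slices v dv Hv.
    move=> t; split=> [i x|i|i j x|i j].
    - have [S1 [_ B1 _]] := Hdv i; have [_ B0 _] := Yv.
      apply: (sol_derive al0 Y0 (Y1 i) _ Sv S1 B0 B1) => s y; have [A _ _ _] := Cg s; exact: A.
    - by move=> x; apply: continuous_slice; have [_ [A _ _]] := Hdv i; exact: A.
    - have [S1 [_ B1 _]] := Hdv j; have [S2 [_ B2 _]] := HHv (i, j).
      apply: (sol_derive al0 (Y1 j) (Y2 i j) _ S1 S2 B1 B2) => s y; have [_ _ A _] := Cg s; exact: A.
    - by move=> x; apply: continuous_slice; have [_ [A _ _]] := HHv (i, j); exact: A.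
  exists (v, dv, Hv); split=> //=; have [Y01 Y02 Y03] := Yv; split=> //.
  - by split=> [|i|i j] //; [have [_ []] := Hdv i|have [_ []] := HHv (i, j)].
  - by move=> t x t0; have [A _ _] := Sv x; exact: A.
  - by move=> p; split=> [|i|i j] //; [have [_ [_ A _]] := Hdv i|have [_ [_ A _]] := HHv (i, j)]; exact: A.
  - by move=> i j t x y; have [_ [_ _ A]] := HHv (i, j); exact: A.
have [w Hw] := choice ex.
pose v n := (w n).1.1; pose dv n := (w n).1.2; pose Hv n := (w n).2.
have cons n m p : `|laph (h n) (v m) p - \sum_i Hv m i i p| <= d%:R * (K * (3 * h n) `^ al).
  have [_ X C] := Hw m; case: p => t x; apply: laph_consistency C _; rewrite ?(ltW al0)// => i y z.
  by have [_ _ _ _ A] := X; exact: A.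
have small ep : 0 < ep -> exists N, forall n, (N <= n)%N -> d%:R * (K * (3 * h n) `^ al) <= ep.
  move=> ep0; have c0 : 0 <= d%:R * K :> R by rewrite mulr_ge0.
  have c1 : 0 < ep / (d%:R * K + 1) by rewrite divr_gt0// ltr_wpDl.
  have [r r0 Hr] := @powR_small R al _ al0 c1.
  have [N HN] : exists N : nat, 3 / r <= N%:R by exists (Num.truncn (3 / r)).+1; exact/ltW/truncnS_gt.
  exists N => n Nn; have : (3 * h n) `^ al <= ep / (d%:R * K + 1).
    apply: le_trans Hr; apply: powR_le; rewrite ?(ltW al0)//; first by rewrite mulr_ge0// ltW.
    rewrite /h ler_pdivrMr// mulrC -ler_pdivrMr//; apply: (le_trans HN); rewrite ler_nat; exact: leqW.
  move=> /(ler_wpM2l c0); rewrite mulrA => /le_trans; apply.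
  by rewrite mulrA ler_pdivrMr ?ltr_wpDl//; move: c0 ep0; clear; nra.
(* [v n] solves the heat equation exactly, for a right-hand side corrected by the consistency
   error. *)
pose gn n p := g p + (laph (h n) (v n) p - \sum_i Hv n i i p).
have Ug : uconv setT gn g.
  by move=> ep /small[N HN]; exists N => n p Nn _; rewrite /gn addrC addKr; apply: (le_trans (cons n n p)); exact: HN.
have Cv : ucauchy setT v.
  move=> ep ep0; have [N HN] := small (ep / 2) ltac:(by rewrite divr_gt0).
  exists N => n m p Nn Nm _.
  have [Sn Xn _] := Hw n; have [Sm Xm _] := Hw m.
  have D := sol_lin 1 (-1) Sn (sol_change (h n) Sm).
  have := sol_bound (K := 2 * K) D _ (ltW ep0) _ p => /(_ _ _)/wrap[].
  - move=> p'; rewrite mul1r mulN1r; apply: (le_trans (ler_normB _ _)).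
    have [_ _ _ /(_ p')[A _ _] _] := Xn; have [_ _ _ /(_ p')[A' _ _] _] := Xm.
    by move: A A'; clear; lra.
  - move=> t x _; have := cons n m (t, x); have := cons m m (t, x).
    have := HN n Nn; have := HN m Nm; rewrite -/(v m).
    set a := laph _ _ _; set c := laph _ _ _; set s := \sum_i _ => b1 b2 b3 b4.
    rewrite (_ : 1 * _ + _ = (c - s) - (a - s)); last by ring.
    apply: (le_trans (ler_normB _ _)); move: b1 b2 b3 b4; clear; lra.
  by rewrite mul1r mulN1r.
have Hs n : solves_on after0 (fun=> 1%:M) (fun=> 0) (gn n) (v n) (dv n) (Hv n).
  move=> t x t0; have [S _ _] := Hw n; have [_ _ A] := S x; have := A t t0; rewrite -/(v n).
  by congr (is_derive _ _ _ _); rewrite op_laplacian /gn /laph; set l := \sum_i _; ring.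
have [V [dV [HV [X S _]]]] := X_closure al0 K0 ler01 (identity_coefs al) (fun n => let: And3 _ X _ := Hw n in X) Cv Hs Ug.
by exists V, dV, HV.
Qed.

End heat_equation.

(** * Averages over a segment *)

Section averages.
Context {R : realType}.
Implicit Types (f g h : R -> R) (r s x ep : R).

(* A primitive of f on ]-1, +oo[ only. *)
Definition prim f : R -> R :=
  xget (fun=> 0) [set F : R -> R | forall x, -1 < x -> is_derive x 1 F (f x)].

Definition avg ep f := (prim f ep - prim f 0) / ep.

Lemma primP f x : continuous f -> -1 < x -> is_derive x 1 (prim f) (f x).
Proof.
move=> /exists_primitive HF; have := xgetPex (fun=> 0) HF.
by rewrite -/(prim f) /=; apply.
Qed.

(** The mean value theorem for a combination of primitives evaluates the three averages at one
    common point. Holder and Taylor estimates thus pass to averages without any inequality between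
    integrals. *)
Lemma avg_mean ep (a b c : R) f g h : 0 < ep -> continuous f -> continuous g -> continuous h ->
  exists2 r, 0 <= r <= ep & a * avg ep f + b * avg ep g + c * avg ep h = a * f r + b * g r + c * h r.
Proof.
move=> ep0 cf cg ch.
have D r : 0 <= r <= ep -> is_derive r 1 (fun s => a * prim f s + b * prim g s + c * prim h s) (a * f r + b * g r + c * h r).
  move=> /andP[r0 _]; have r1 : -1 < r by apply: lt_le_trans r0; rewrite ltrN10.
  exact: (is_deriveD (is_deriveD (is_deriveMl a (primP cf r1)) (is_deriveMl b (primP cg r1))) (is_deriveMl c (primP ch r1))).
have [r rr E] := mvt_real (ltW ep0) D; exists r => //.
rewrite (_ : a * avg ep f + b * avg ep g + c * avg ep h =
    (a * prim f ep + b * prim g ep + c * prim h ep - (a * prim f 0 + b * prim g 0 + c * prim h 0)) / ep).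
  by rewrite E subr0 mulfK// gt_eqF.
by rewrite /avg; ring.
Qed.

(** The shift moves into the end points of one primitive. The restriction [|s| < 1] is due to
    [prim f] being a primitive on []-1, +oo[] only. *)
Lemma avg_shift ep f s : 0 < ep -> continuous f -> `|s| < 1 ->
  avg ep (fun r => f (r + s)) = (prim f (ep + s) - prim f s) / ep.
Proof.
move=> ep0 cf; rewrite ltr_norml => /andP[s1 s2]; congr (_ / _).
have cfs : continuous (fun r => f (r + s)) by exact: continuous_shiftr.
have D r : 0 <= r <= ep -> is_derive r 1 (fun r => prim (fun r => f (r + s)) r - prim f (r + s)) 0.
  move=> /andP[r0 _]; have r1 : -1 < r by apply: lt_le_trans r0; rewrite ltrN10.
  have rs : -1 < r + s by rewrite -[-1]add0r ler_ltD.
  have := is_deriveB (primP cfs r1) (@is_derive_shiftr R R _ _ _ s _ (primP cf rs)).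
  by rewrite subrr.
have [r _] := mvt_real (ltW ep0) D; rewrite mul0r add0r => /eqP; rewrite subr_eq0 => /eqP E.
set F := prim (fun r => f (r + s)) in E *.
by rewrite -[F ep](subrK (prim f (ep + s))) E; ring.
Qed.

Lemma avg_derive ep f : 0 < ep -> continuous f ->
  is_derive (0 : R) 1 (fun s => avg ep (fun r => f (r + s))) ((f ep - f 0) / ep).
Proof.
move=> ep0 cf.
have r1 : -1 < 0 + ep :> R by rewrite add0r; apply: lt_trans ep0; rewrite ltrN10.
have r2 : -1 < 0 :> R by rewrite ltrN10.
have D1 := @is_derive_shiftr R R _ _ _ ep _ (primP cf r1).
have D := is_deriveMl ep^-1 (is_deriveB D1 (primP cf r2)).
apply/is_derive_epsP => c c0; have [dl dl0 H] := (is_derive_epsP _ _ _ _).1 D c c0.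
exists (Num.min dl 1); first by rewrite lt_min dl0 ltr01.
move=> s; rewrite lt_min => /andP[s1 s2]; have := H s s1.
rewrite [s *: 1]mulr1 add0r avg_shift// avg_shift ?normr0//.
congr (`|_| <= _); rewrite !fctE add0r addr0 [s + ep]addrC; ring.
Qed.

(** For [N <= 1] a Lipschitz bound is the stronger one; for [N > 1] the sup bound [F] suffices. *)
Lemma holder_of_lipschitz (al A F N u w : R) : 0 < al < 1 -> 0 <= A -> 0 <= N -> `|u| <= F -> `|w| <= F ->
  `|u - w| <= A * N -> `|u - w| <= (A + 2 * F) * N `^ al.
Proof.
move=> /andP[al0 al1] A0 N0 uF wF H; have F0 : 0 <= F by apply: le_trans uF.
have [N1|N1] := leP N 1.
  apply: (le_trans H); apply: ler_pM => //; first by rewrite lerDl mulr_ge0.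
  have [->|N'] := eqVneq N 0; first exact: powR_ge0.
  by apply: ger1_powR; rewrite ?(ltW al1)// lt_def N' N0.
have h3 : 1 <= N `^ al by rewrite -[leLHS](powRr0 N); apply: ler_powR; exact: ltW.
apply: (le_trans (ler_normB _ _)); apply: (@le_trans _ _ (2 * F * 1)); first by move: uF wF; clear; lra.
by apply: ler_pM => //; rewrite ?mulr_ge0// lerDr.
Qed.

End averages.

(** * Smoothing along the coordinate directions *)

Section mollification.
Context {R : realType} {d : nat}.
Local Notation E := 'rV[R]_d.
Local Notation e i := (delta_mx 0 i : 'rV[R]_d).
Implicit Types (x y z : E) (i j : 'I_d) (n m : nat) (r s t : R) (l : seq 'I_d).
Implicit Types (f g h v w : R * E -> R).

(* Averaging over a segment in direction i already gains one derivative in that direction. *)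
Definition mol (ep : R) i g (p : R * E) : R := avg ep (fun r => g (p.1, p.2 + r *: e i)).

Definition mols (ep : R) l g := foldr (mol ep) g l.

Lemma continuous_segment g t x i : continuous g -> continuous (fun r => g (t, x + r *: e i)).
Proof.
move=> cg r; have c1 : {for r, continuous (fun=> t : R)} by exact: cst_continuous.
have c2 : {for r, continuous (fun s : R => x + s *: e i)}.
  by apply: continuousD; [exact: cst_continuous|exact: scalel_continuous].
exact: (continuous_comp (continuous_pair c1 c2) (cg _)).
Qed.

Lemma mol_mean ep i (a b c : R) f g h p q k : 0 < ep -> continuous f -> continuous g -> continuous h ->
  exists2 r, 0 <= r <= ep &
    a * mol ep i f p + b * mol ep i g q + c * mol ep i h k
    = a * f (p.1, p.2 + r *: e i) + b * g (q.1, q.2 + r *: e i) + c * h (k.1, k.2 + r *: e i).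
Proof.
by move=> ep0 cf cg ch; apply: avg_mean => //; exact: continuous_segment.
Qed.

Lemma mol_value ep i g t x : 0 < ep -> continuous g ->
  exists2 r, 0 <= r <= ep & mol ep i g (t, x) = g (t, x + r *: e i).
Proof.
move=> ep0 cg; have [r r1 E] := mol_mean i 1 0 0 (t, x) (t, x) (t, x) ep0 cg cg cg.
by exists r => //; move: E; rewrite mul1r !mul0r !addr0 mul1r.
Qed.

Lemma mol_sub ep i g p q : 0 < ep -> continuous g ->
  exists2 r, 0 <= r <= ep & mol ep i g p - mol ep i g q = g (p.1, p.2 + r *: e i) - g (q.1, q.2 + r *: e i).
Proof.
move=> ep0 cg; have [r r1 E] := mol_mean i 1 (-1) 0 p q q ep0 cg cg cg.
by exists r => //; move: E; rewrite !mul1r !mulN1r !mul0r !addr0.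
Qed.

(** By [mol_sub] an increment of the average is an increment of [g] at a common point of the
    segment, and continuity of [g] is uniform along that compact segment. *)
Lemma mol_continuous ep i g : 0 < ep -> continuous g -> continuous (mol ep i g).
Proof.
move=> ep0 cg q; apply/continuous_epsP => c c0.
have K : compact `[0, ep]%classic by exact: segment_compact.
pose P (p : R * E) r := `|g (p.1, p.2 + r *: e i) - g (q.1, q.2 + r *: e i)| <= c.
have : \forall p \near q, `[0, ep]%classic `<=` P p.
  apply: ((compact_near_coveringP `[0, ep]%classic).1 K (R * E)%type (nbhs q) P) => r _.
  pose k (z : R * (R * E)) : R := g (z.2.1, z.2.2 + z.1 *: e i) - g (q.1, q.2 + z.1 *: e i).
  have ck : {for (r, q), continuous k}.
    have c1 : {for (r, q), continuous (fun z : R * (R * E) => z.1)} by exact: cvg_fst.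
    have c2 : {for (r, q), continuous (fun z : R * (R * E) => z.2)} by exact: cvg_snd.
    have c21 : {for (r, q), continuous (fun z : R * (R * E) => z.2.1)}.
      by apply: (continuous_comp c2); exact: cvg_fst.
    have c22 : {for (r, q), continuous (fun z : R * (R * E) => z.2.2)}.
      by apply: (continuous_comp c2); exact: cvg_snd.
    have cs : {for (r, q), continuous (fun z : R * (R * E) => z.1 *: e i)}.
      have sc : {for r, continuous (fun u : R => u *: e i)} by exact: scalel_continuous.
      exact: (continuous_comp c1 sc).
    have cq1 : {for (r, q), continuous (fun z : R * (R * E) => q.1)} by exact: cst_continuous.
    have cq2 : {for (r, q), continuous (fun z : R * (R * E) => q.2)} by exact: cst_continuous.
    exact: (continuousB (continuous_comp (continuous_pair c21 (continuousD c22 cs)) (cg _))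
      (continuous_comp (continuous_pair cq1 (continuousD cq2 cs)) (cg _))).
  have [dl dl0 H] := (continuous_epsP _ _).1 ck c c0.
  have B : \forall p \near q, `|p - q| < dl.
    by apply/nbhs_ballP; exists dl => // p; rewrite -ball_normE /= distrC.
  near=> r' p; rewrite /P; have := H (r', p); rewrite /k /= subrr subr0; apply.
  rewrite prod_normE /= gt_max; apply/andP; split.
    by rewrite distrC; near: r'; apply: nbhsx_ballx.
  by near: p.
move=> /nbhs_ballP[dl /= dl0 H]; exists dl => // p pq.
have [r r1 ->] := mol_sub i p q ep0 cg; apply: H; last by rewrite /= in_itv.
by rewrite -ball_normE /= distrC.
Unshelve. all: by end_near. Qed.

Lemma mol_derive al K ep i j g g1 : 0 < ep -> 0 < al -> continuous g -> isY al K g1 ->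
  (forall t x, is_derive x (e j) (fun y => g (t, y)) (g1 (t, x))) ->
  forall t x, is_derive x (e j) (fun y => mol ep i g (t, y)) (mol ep i g1 (t, x)).
Proof.
move=> ep0 al0 cg Y1 Hd t x; have K0 := isY_ge0 Y1; have [c1 _ g3] := Y1.
apply/is_derive_epsP => c c0.
have c'0 : 0 < c / (K + 1) by rewrite divr_gt0// ltr_wpDl.
have [dl dl0 Hdl] := @powR_small R al _ al0 c'0.
exists dl => // r rdl.
have [s s1] := mol_mean i 1 (-1) (- r) (t, x + r *: e j) (t, x) (t, x) ep0 cg cg c1.
rewrite !mul1r !mulN1r !mulNr /= => ->; rewrite [x + _ + _]addrAC.
have := holder_increment (x + s *: e i) r (ltW al0) K0 (Hd t) (g3 t); move=> /le_trans; apply.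
apply: ler_wpM2r => //.
have : `|r| `^ al <= c / (K + 1) by apply: le_trans Hdl; apply: powR_le; rewrite ?(ltW al0)// ltW.
move=> /(ler_wpM2l K0) /le_trans; apply.
by rewrite mulrA ler_pdivrMr ?ltr_wpDl//; move: K0 c0; clear; nra.
Qed.

Lemma mol_derive_self ep i g t x : 0 < ep -> continuous g ->
  is_derive x (e i) (fun y => mol ep i g (t, y)) ((g (t, x + ep *: e i) - g (t, x)) / ep).
Proof.
move=> ep0 cg; apply/is_derive_line0.
have := avg_derive ep0 (@continuous_segment g t x i cg); rewrite scale0r addr0.
congr (is_derive _ _ _ _); apply/funext => s; rewrite /mol /=; congr avg.
by apply/funext => r; rewrite scalerDl [r *: _ + _]addrC addrA.
Qed.

Lemma isY_mol al K ep i g : 0 < ep -> isY al K g -> isY al K (mol ep i g).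
Proof.
move=> ep0 [g1 g2 g3]; split; first exact: mol_continuous.
  by move=> [t x]; have [r _ ->] := mol_value i t x ep0 g1.
move=> t x y; have [r _ ->] := mol_sub i (t, x) (t, y) ep0 g1; apply: (le_trans (g3 _ _ _)).
by rewrite /= opprD addrACA subrr addr0.
Qed.

Lemma isY_mols al K ep l g : 0 < ep -> isY al K g -> isY al K (mols ep l g).
Proof. by move=> ep0 Y; elim: l => //= i l IH; exact: isY_mol. Qed.

Lemma mols_continuous ep l g : 0 < ep -> continuous g -> continuous (mols ep l g).
Proof. by move=> ep0 cg; elim: l => //= i l IH; exact: mol_continuous. Qed.

Lemma mols_derive al K ep j l g g1 : 0 < ep -> 0 < al -> continuous g -> isY al K g1 ->
  (forall t x, is_derive x (e j) (fun y => g (t, y)) (g1 (t, x))) ->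
  forall t x, is_derive x (e j) (fun y => mols ep l g (t, y)) (mols ep l g1 (t, x)).
Proof.
move=> ep0 al0 cg Y1 Hd; elim: l => //= i l IH.
by apply: (mol_derive (al := al) (K := K)) => //; [exact: mols_continuous|exact: isY_mols].
Qed.

Lemma isY_shift al K g z : isY al K g -> isY al K (fun p => g (p.1, p.2 + z)).
Proof.
move=> [g1 g2 g3]; split=> //; first exact: continuous_shift_snd.
by move=> t x y; apply: (le_trans (g3 _ _ _)); rewrite /= opprD addrACA subrr addr0.
Qed.

(** The average in direction [j] has a difference quotient as derivative, whence [2 * K / ep]; the
    averages applied after it commute with this derivative. *)
Lemma mols_smooth al K ep j l g : 0 < ep -> 0 < al -> isY al K g -> j \in l ->
  exists2 g1, isY al (2 * K / ep) g1 &
    forall t x, is_derive x (e j) (fun y => mols ep l g (t, y)) (g1 (t, x)).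
Proof.
move=> ep0 al0 Y; elim: l => //= i l IH; rewrite inE; case: eqP => [-> _|_ /= /IH[g1 Y1 H1]].
  have Yl := isY_mols l ep0 Y; have [c1 _ _] := Yl.
  exists (fun p => ep^-1 * mols ep l g (p.1, p.2 + ep *: e i) + (- ep^-1) * mols ep l g p).
    rewrite (_ : 2 * K / ep = `|ep^-1| * K + `|- ep^-1| * K).
      by apply: isY_lin => //; exact: isY_shift.
    by rewrite normrN gtr0_norm ?invr_gt0//; ring.
  move=> t x; have := mol_derive_self i t x ep0 c1.
  by congr (is_derive _ _ _ _); rewrite /=; ring.
exists (mol ep i g1); first exact: isY_mol.
by apply: (mol_derive (al := al) (K := 2 * K / ep)) => //; apply: mols_continuous => //; case: Y.
Qed.

(** Each averaging replaces a value by one at distance at most [ep], so closeness to a constant on a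
    larger box survives on the smaller one. *)
Lemma mols_local ep l g (c dl rho : R) t x : 0 < ep -> continuous g ->
  (forall y, `|y - x| <= rho + (size l)%:R * ep -> `|g (t, y) - c| <= dl) ->
  forall y, `|y - x| <= rho -> `|mols ep l g (t, y) - c| <= dl.
Proof.
move=> ep0 cg; elim: l rho => [|i l IH] rho /=; first by rewrite mul0r addr0.
move=> H y yx; have [r /andP[r0 r1] ->] := mol_value i t y ep0 (@mols_continuous _ l _ ep0 cg).
apply: (IH (rho + ep)).
  by move=> z zx; apply: H; apply: (le_trans zx); rewrite -natr1 mulrDl mul1r -addrA [ep + _]addrC.
rewrite addrAC; apply: (le_trans (ler_normD _ _)); apply: lerD => //.
by apply: (le_trans (norm_delta_le _ _)); rewrite ger0_norm.
Qed.

Lemma isY_mono al (K L : R) g : K <= L -> isY al K g -> isY al L g.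
Proof.
move=> KL [g1 g2 g3]; split=> [|p|t x y] //; first exact: le_trans KL.
by apply: (le_trans (g3 t x y)); apply: ler_wpM2r => //; exact: powR_ge0.
Qed.

(** A round of averages gains one derivative in every direction, and two rounds give the second
    derivatives. [L] blows up with small [ep], which is harmless: the averaged function itself keeps
    the constant [K]. *)
Lemma mollification al K ep l g : 0 < ep -> 0 < al -> (forall j, j \in l) -> isY al K g ->
  exists dg Hg, exists2 L, K <= L & [/\ forall i, isY al L (dg i), forall i j, isY al L (Hg i j)
    & C2_slices (mols ep l (mols ep l g)) dg Hg].
Proof.
move=> ep0 al0 jl Y; have K0 := isY_ge0 Y; set h := mols ep l g.
have Yh : isY al K h by exact: isY_mols.
have ex1 j : exists g1, isY al (2 * K / ep) g1 /\ forall t x, is_derive x (e j) (fun y => h (t, y)) (g1 (t, x)).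
  by have [g1 A B] := mols_smooth ep0 al0 Y (jl j); exists g1.
have [g1 H1] := choice ex1.
have ex2 (ij : 'I_d * 'I_d) : exists g2, isY al (2 * (2 * K / ep) / ep) g2 /\
    forall t x, is_derive x (e ij.1) (fun y => mols ep l (g1 ij.2) (t, y)) (g2 (t, x)).
  by have [g2 A B] := mols_smooth ep0 al0 (H1 ij.2).1 (jl ij.1); exists g2.
have [g2 H2] := choice ex2.
pose L1 := 2 * K / ep; pose L2 := 2 * L1 / ep.
have L10 : 0 <= L1 by rewrite divr_ge0 ?mulr_ge0// ltW.
have L20 : 0 <= L2 by rewrite /L2 divr_ge0 ?(ltW ep0)// mulr_ge0.
exists (fun j => mols ep l (g1 j)), (fun i j => g2 (i, j)), (K + L1 + L2).
  by rewrite -addrA lerDl addr_ge0.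
have Y1 j : isY al (K + L1 + L2) (mols ep l (g1 j)).
  by apply: isY_mols => //; apply: isY_mono (H1 j).1; rewrite -/L1; move: K0 L20; clear; lra.
have Y2 i j : isY al (K + L1 + L2) (g2 (i, j)).
  by apply: isY_mono (H2 (i, j)).1; rewrite -/L1 -/L2; move: K0 L10; clear; lra.
split=> // t; split=> [i x|i|i j x|i j].
- apply: (mols_derive (al := al) (K := 2 * K / ep)) => //; [by case: Yh|exact: (H1 i).1|exact: (H1 i).2].
- by move=> x; apply: continuous_slice; case: (Y1 i) => A _ _; exact: A.
- exact: (H2 (i, j)).2.
- by move=> x; apply: continuous_slice; case: (Y2 i j) => A _ _; exact: A.
Qed.

Lemma mols_close al K ep l g p : 0 < ep -> 0 < al -> isY al K g ->
  `|mols ep l g p - g p| <= K * ((size l)%:R * ep) `^ al.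
Proof.
move=> ep0 al0 Y; have K0 := isY_ge0 Y; have [c _ H] := Y; case: p => t x.
apply: (mols_local (rho := 0) (x := x) ep0 c); last by rewrite subrr normr0.
move=> y; rewrite add0r => yx; apply: (le_trans (H _ _ _)); apply: ler_wpM2l => //.
by apply: powR_le => //; exact: ltW.
Qed.

Lemma mols_lipschitz (F ep : R) j l g : 0 < ep -> continuous g -> (forall p, `|g p| <= F) -> j \in l ->
  forall t x r, 0 <= r -> `|mols ep l g (t, x + r *: e j) - mols ep l g (t, x)| <= 2 * F / ep * r.
Proof.
move=> ep0 cg HF; elim: l => //= i l IH; have cl := @mols_continuous _ l _ ep0 cg.
have Fl p : `|mols ep l g p| <= F.
  case: p => t x; rewrite -[mols _ _ _ _]subr0; apply: (mols_local (rho := 0) (x := x) ep0 cg).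
    by move=> y _; rewrite subr0.
  by rewrite subrr normr0.
rewrite inE; case: eqP => [-> _ t x r r0|_ /= /IH H t x r r0].
  have D s : is_derive s 1 (fun u : R => mol ep i (mols ep l g) (t, x + u *: e i))
      ((mols ep l g (t, x + s *: e i + ep *: e i) - mols ep l g (t, x + s *: e i)) / ep).
    apply: (is_derive_line (fun z => mol ep i (mols ep l g) (t, z)) x (e i) s _).1.
    exact: mol_derive_self.
  have [s _] := mvt_real r0 (fun s _ => D s); rewrite scale0r addr0 => ->.
  rewrite subr0 normrM (ger0_norm r0); apply: ler_wpM2r => //.
  rewrite normrM [`|ep^-1|]gtr0_norm ?invr_gt0//; apply: ler_wpM2r; first by rewrite invr_ge0 ltW.
  apply: (le_trans (ler_normB _ _)); have := Fl (t, x + s *: e i + ep *: e i); have := Fl (t, x + s *: e i).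
  by clear; lra.
have [s _ ->] := mol_sub i (t, x + r *: e j) (t, x) ep0 cl.
by rewrite /= addrAC; exact: H.
Qed.

(** One round of averages makes a bounded function Lipschitz in space, hence Holder. This is the
    entry point for initial data with no modulus of continuity. *)
Lemma isY_of_bounded al (F ep : R) l g : 0 < ep -> 0 < al < 1 -> continuous g -> (forall p, `|g p| <= F) ->
  (forall j, j \in l) -> exists L, isY al L (mols ep l g).
Proof.
move=> ep0 /andP[al0 al1] cg HF jl; have F0 : 0 <= F by apply: le_trans (HF (0, 0)).
have cl := @mols_continuous _ l _ ep0 cg.
have Fl p : `|mols ep l g p| <= F.
  case: p => t x; rewrite -[mols _ _ _ _]subr0; apply: (mols_local (rho := 0) (x := x) ep0 cg).
    by move=> y _; rewrite subr0.
  by rewrite subrr normr0.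
pose D : R := d%:R; have D0 : 0 <= D by exact: ler0n.
have fe0 : 0 <= 2 * F / ep by rewrite divr_ge0 ?mulr_ge0// ltW.
have lip t x y : `|mols ep l g (t, y) - mols ep l g (t, x)| <= D * (2 * F / ep * `|y - x|).
  apply: (@coordinate_path R d (fun z => mols ep l g (t, z))) => [|c n a _ a0 ayx]; first by rewrite mulr_ge0.
  have a2 : 0 <= 2 * a by rewrite mulr_ge0// ltW.
  have := mols_lipschitz ep0 cg HF (jl n) t (c - a *: e n) a2.
  rewrite -addrA -scaleNr -scalerDl (_ : - a + 2 * a = a); last by ring.
  by rewrite scaleNr => /le_trans; apply; exact: ler_wpM2l.
exists (D * (2 * F / ep) + 2 * F); split=> // [p|t x y].
  by apply: (le_trans (Fl p)); have := mulr_ge0 D0 fe0; move: F0; clear; lra.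
have c0 : 0 <= D * (2 * F / ep) by rewrite mulr_ge0.
apply: holder_of_lipschitz => //; first by rewrite al0.
by apply: (le_trans (lip t y x)); rewrite (mulrA D).
Qed.

End mollification.

(** * From the Laplacian to bounded Holder coefficients *)

Section method_of_continuity.
Context {R : realType} {d : nat}.
Local Notation E := 'rV[R]_d.
Local Notation e i := (delta_mx 0 i : 'rV[R]_d).
Implicit Types (x y z : E) (i j : 'I_d) (n m : nat) (r s t : R).
Implicit Types (f g h v w : R * E -> R) (dv dw : 'I_d -> R * E -> R)
  (Hv Hw : 'I_d -> 'I_d -> R * E -> R) (q : R * E -> 'M[R]_d) (b : R * E -> E).

Definition solvable (al : R) q b := forall (K : R) g, isY al K g ->
  exists v dv Hv, exists2 L, isX al L v dv Hv & solves_on after0 q b g v dv Hv.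

(** The a priori bound sees the right-hand side through [K] only, and averaging preserves [K]. So
    the solutions for smoothed right-hand sides stay in one ball, and the sup bound makes them
    Cauchy. *)
Lemma heat_solvable al : 0 < al < 1 -> solvable al (fun=> 1%:M) (fun=> 0).
Proof.
move=> al01 K g Y; have [al0 _] := andP al01; have K0 := isY_ge0 Y.
pose ep n : R := n.+1%:R^-1; have ep0 n : 0 < ep n by rewrite invr_gt0.
pose l := enum 'I_d; have jl j : j \in l by rewrite mem_enum.
pose gn n := mols (ep n) l (mols (ep n) l g).
have Yn n : isY al K (gn n) by apply: isY_mols => //; exact: isY_mols.
have [C C1 AP] := @a_priori R d al 1 1 al01 ltr01 ler01.
have ex n : exists w : (R * E -> R) * ('I_d -> R * E -> R) * ('I_d -> 'I_d -> R * E -> R),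
    isX al (C * K) w.1.1 w.1.2 w.2 /\ solves_on after0 (fun=> 1%:M) (fun=> 0) (gn n) w.1.1 w.1.2 w.2.
  have [dg [Hg [L KL [Y1 Y2 Cg]]]] := mollification (ep0 n) al0 jl Y.
  have [v [dv [Hv [X S]]]] := heat_smooth al0 (isY_mono KL (Yn n)) Y1 Y2 Cg.
  by exists (v, dv, Hv); split=> //=; apply: AP X S (Yn n) => //; exact: identity_coefs.
have [w Hw] := choice ex.
have close n p : `|gn n p - g p| <= 2 * (K * ((size l)%:R * ep n) `^ al).
  rewrite (_ : _ - _ = (gn n p - mols (ep n) l g p) + (mols (ep n) l g p - g p)); last by ring.
  have := mols_close l p (ep0 n) al0 Y; have := mols_close l p (ep0 n) al0 (isY_mols l (ep0 n) Y).
  by rewrite -/(gn n) => h1 h2; apply: (le_trans (ler_normD _ _)); move: h1 h2; clear; lra.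
have Ug : uconv setT gn g.
  move=> c c0; have c1 : 0 < c / (2 * K + 1) by rewrite divr_gt0// ltr_wpDl// mulr_ge0.
  have [r r0 Hr] := @powR_small R al _ al0 c1.
  have [N HN] : exists N : nat, (size l)%:R / r <= N%:R by exists (Num.truncn ((size l)%:R / r)).+1; exact/ltW/truncnS_gt.
  exists N => n p Nn _; apply: (le_trans (close n p)).
  have : ((size l)%:R * ep n) `^ al <= c / (2 * K + 1).
    apply: le_trans Hr; apply: powR_le; rewrite ?(ltW al0)//; first by rewrite mulr_ge0// ltW.
    rewrite /ep ler_pdivrMr// mulrC -ler_pdivrMr//; apply: (le_trans HN); rewrite ler_nat; exact: leqW.
  have K2 : 0 <= 2 * K by rewrite mulr_ge0.
  rewrite (mulrA 2) => /(ler_wpM2l K2) /le_trans; apply.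
  by rewrite mulrA ler_pdivrMr ?ltr_wpDl//; move: K2 c0; clear; nra.
have Cv : ucauchy setT (fun n => (w n).1.1).
  move=> c c0; have [N HN] := uconv_ucauchy Ug c0; exists N => n m p Nn Nm _.
  have [Xn Sn] := Hw n; have [Xm Sm] := Hw m.
  have [[cX _ _] C2 v0 Bd _] := isX_lin 1 (-1) Xn Xm.
  have S := solves_on_lin 1 (-1) Sn Sm; case: p => t x.
  have := sup_bound_abs (K := `|1| * (C * K) + `|-1| * (C * K)) (G := c) ltr01 ler01 (ltW c0) (identity_coefs al) cX C2 S.
  have [t0|t0] := leP 0 t; last by move=> _; have := v0 t x (ltW t0); rewrite mul1r mulN1r => ->; rewrite normr0 ltW.
  move=> /(_ _ _ _ t x t0)/wrap[].
  - by move=> p; have [] := Bd p.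
  - by move=> p _; rewrite mul1r mulN1r; exact: HN.
  - by move=> y; rewrite v0// normr0 ltW.
  by rewrite mul1r mulN1r.
have CK0 : 0 <= C * K by rewrite mulr_ge0// (le_trans ler01).
have [V [dV [HV [X S _]]]] := X_closure al0 CK0 ler01 (identity_coefs al) (fun n => (Hw n).1) Cv (fun n => (Hw n).2) Ug.
by exists V, dV, HV, (C * K).
Qed.

Lemma isY_mul (al A B : R) f g : isY al A f -> isY al B g -> isY al (2 * (A * B)) (fun p => f p * g p).
Proof.
move=> Yf Yg; have A0 := isY_ge0 Yf; have B0 := isY_ge0 Yg; have [f1 f2 f3] := Yf; have [g1 g2 g3] := Yg.
split=> [p|p|t x y]; first by apply: continuousM; [exact: f1|exact: g1].
  rewrite normrM; apply: (@le_trans _ _ (A * B)); first exact: ler_pM.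
  by rewrite ler_peMl ?mulr_ge0// ler1n.
rewrite (_ : _ - _ = f (t, x) * (g (t, x) - g (t, y)) + (f (t, x) - f (t, y)) * g (t, y)); last by ring.
apply: (le_trans (ler_normD _ _)); rewrite !normrM; set P := `|x - y| `^ al.
have : `|f (t, x)| * `|g (t, x) - g (t, y)| <= A * (B * P) by apply: ler_pM => //; exact: g3.
have : `|f (t, x) - f (t, y)| * `|g (t, y)| <= (A * P) * B by apply: ler_pM => //; exact: f3.
by clear; lra.
Qed.

Lemma isY_sum (al K : R) (F : 'I_d -> R * E -> R) : (forall i, isY al K (F i)) ->
  isY al (d%:R * K) (fun p => \sum_i F i p).
Proof.
move=> H; split=> [p|p|t x y].
- by apply: continuous_big_sum => i; have [A _ _] := H i; exact: A.
- by apply: sum_le_const => i; have [_ A _] := H i; exact: A.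
- rewrite -sumrB -mulrA; apply: sum_le_const => i; have [_ _ A] := H i; exact: A.
Qed.

Lemma isX_gradient (al K : R) v dv Hv i : 0 < al < 1 -> isX al K v dv Hv -> isY al ((d%:R + 2) * K) (dv i).
Proof.
move=> al01 [[X1 X2 X3] C2 _ Bd _]; have K0 : 0 <= K by have [A _ _] := Bd (0, 0); apply: le_trans A.
have Bi p : `|dv i p| <= K by have [_ A _] := Bd p.
split=> [|p|t x y]; first exact: X2.
  by apply: (le_trans (Bi p)); have := mulr_ge0 (ler0n R d) K0; move: K0; clear; lra.
rewrite mulrDl; apply: holder_of_lipschitz => //; first by rewrite mulr_ge0.
have [_ _ D3 D4] := C2 t.
have := @lipschitz_of_gradient R d (fun z => dv i (t, z)) (fun j z => Hv j i (t, z)) y `|x - y| K y x (fun j z => D3 j i z) (fun j => D4 j i).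
rewrite subrr normr0 mulrAC; apply=> // j z _; have [_ _ A] := Bd (t, z); exact: A.
Qed.

Lemma isY_op (al La K : R) q b v dv Hv : 0 < al < 1 -> (forall i j, isY al La (fun p => q p i j)) ->
  (forall i, isY al La (fun p => b p 0 i)) -> isX al K v dv Hv ->
  isY al (2 * d%:R * (d%:R + (d%:R + 2)) * La * K) (op q b dv Hv).
Proof.
move=> al01 Yq Yb X; have [[X1 X2 X3] C2 _ Bd Hh] := X.
have Y2 i j : isY al K (Hv i j) by split=> // p; have [_ _ A] := Bd p.
have A1 : isY al (d%:R * (d%:R * (2 * (La * K)))) (fun p => \sum_i \sum_j q p i j * Hv i j p).
  by apply: isY_sum => i; apply: isY_sum => j; exact: isY_mul.
have A2 : isY al (d%:R * (2 * (La * ((d%:R + 2) * K)))) (fun p => \sum_i b p 0 i * dv i p).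
  by apply: isY_sum => i; apply: isY_mul => //; exact: isX_gradient X.
have := isY_lin 1 1 A1 A2; rewrite normr1 !mul1r.
rewrite (_ : _ + _ = 2 * d%:R * (d%:R + (d%:R + 2)) * La * K); last by ring.
by congr isY; apply/funext => p; rewrite !mul1r.
Qed.

Definition mixq (tau : R) q (p : R * E) : 'M[R]_d := (1 - tau)%:M + tau *: q p.
Definition mixb (tau : R) b (p : R * E) : E := tau *: b p.

Lemma op_mix (tau sg : R) q b dv Hv p : op (mixq sg q) (mixb sg b) dv Hv p =
  op (mixq tau q) (mixb tau b) dv Hv p + (sg - tau) * op (fun p => q p - 1%:M) b dv Hv p.
Proof.
rewrite /op mulrDr addrACA; congr (_ + _); rewrite mulr_sumr -big_split; apply: eq_bigr => i _ /=; last first.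
  by rewrite /mixb !mxE; ring.
rewrite mulr_sumr -big_split; apply: eq_bigr => j _ /=.
by rewrite /mixq !mxE; case: (i == j); rewrite ?mulr1n ?mulr0n; ring.
Qed.

(** The constants do not depend on [tau], because the identity matrix is elliptic with constant
    [1 >= lam] and has entries at most 1. The uniform length of a continuity step rests on this. *)
Lemma mix_coefs (al lam La tau : R) q b : 0 <= tau <= 1 -> 0 < lam <= 1 ->
  (forall p, elliptic_mx lam (q p)) -> (forall i j, isY al La (fun p => q p i j)) ->
  (forall i, isY al La (fun p => b p 0 i)) ->
  coefs_on after0 al lam (1 + La) (mixq tau q) (mixb tau b).
Proof.
move=> /andP[t0 t1] /andP[lam0 lam1] Eq Yq Yb.
have fin (c a z : R) : `|c| <= 1 -> `|a| <= z -> `|c| <= 1 -> 0 <= z -> `|(1 - tau) * c + tau * a| <= 1 + z.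
  move=> h1 h2 _ z0; apply: (le_trans (ler_normD _ _)); rewrite !normrM (ger0_norm t0).
  rewrite ger0_norm ?subr_ge0//; apply: lerD.
    by rewrite -[leRHS]mulr1; apply: ler_pM => //; rewrite ?subr_ge0// gerBl.
  by rewrite -[leRHS]mul1r; apply: ler_pM.
have hol (N a z : R) : 0 <= z -> 0 <= N -> `|a| <= z * N -> `|tau * a| <= (1 + z) * N.
  move=> z0 N0 h; rewrite normrM (ger0_norm t0); apply: (@le_trans _ _ (1 * (z * N))); first exact: ler_pM.
  by rewrite mul1r ler_wpM2r// lerDr.
split=> [p _|i j|i].
- have [q1 q2] := Eq p; split; first by rewrite /mixq linearD linearZ /= tr_scalar_mx q1.
  move=> v; have E0 : qform (mixq tau q p) v = (1 - tau) * (\sum_i v 0 i ^+ 2) + tau * qform (q p) v.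
    rewrite /qform !mulr_sumr -big_split; apply: eq_bigr => i _ /=.
    rewrite mulr_sumr (bigD1 i)//= [\sum_j tau * _](bigD1 i)//= addrA; congr (_ + _).
      by rewrite /mixq !mxE eqxx mulr1n; ring.
    by apply: eq_bigr => j ji; rewrite /mixq !mxE eq_sym (negbTE ji) mulr0n add0r -mulrA.
  have S0 : 0 <= \sum_i v 0 i ^+ 2 by apply: sumr_ge0 => i _; exact: sqr_ge0.
  rewrite E0; have := q2 v; set S := \sum_i _ in S0 *; set W := qform _ _ => h.
  have h1 := ler_wpM2l t0 h.
  have h2 : lam * S <= S by rewrite ler_piMl.
  have h3 : (1 - tau) * (lam * S) <= (1 - tau) * S by rewrite ler_wpM2l// subr_ge0.
  by apply: (le_trans _ (lerD h3 h1)); rewrite -mulrDl subrK mul1r.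
- have Y := Yq i j; have z0 := isY_ge0 Y; have [_ Y2 Y3] := Y.
  split=> [p _|t x y _ _].
    rewrite /mixq !mxE -mulr_natr; apply: fin => //; case: (i == j); rewrite ?normr1 ?normr0//.
  rewrite /mixq !mxE (_ : _ - _ = tau * (q (t, x) i j - q (t, y) i j)); last by ring.
  by apply: hol => //; rewrite ?powR_ge0.
- have Y := Yb i; have z0 := isY_ge0 Y; have [_ Y2 Y3] := Y.
  split=> [p _|t x y _ _]; rewrite /mixb !mxE.
    by have := hol 1 (b p 0 i) La z0 ler01; rewrite !mulr1; apply.
  by rewrite -mulrBr; apply: hol => //; rewrite ?powR_ge0.
Qed.

Lemma isX_mono (al K L : R) v dv Hv : K <= L -> isX al K v dv Hv -> isX al L v dv Hv.
Proof.
move=> KL [X1 X2 X3 X4 X5]; split=> // [p|i j t x y].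
  by have [A1 A2 A3] := X4 p; split=> [|i|i j]; apply: le_trans KL.
by apply: (le_trans (X5 i j t x y)); apply: ler_wpM2r => //; exact: powR_ge0.
Qed.

(** The problem for [sg] is the one for [tau] with [(sg - tau) * B v] moved to the right-hand side.
    By the a priori bound the resulting iteration contracts with factor [1 / 2], and [dl] depends
    neither on [tau] nor on the data. *)
Lemma continuity_step (al lam La : R) q b : 0 < al < 1 -> 0 < lam <= 1 -> 0 <= La ->
  (forall p, elliptic_mx lam (q p)) -> (forall i j, isY al La (fun p => q p i j)) ->
  (forall i, isY al La (fun p => b p 0 i)) ->
  exists2 dl : R, 0 < dl & forall tau sg, 0 <= tau <= 1 -> `|sg - tau| <= dl ->
    solvable al (mixq tau q) (mixb tau b) -> solvable al (mixq sg q) (mixb sg b).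
Proof.
move=> al01 lam01 La0 Eq Yq Yb; have [al0 _] := andP al01; have [lam0 lam1] := andP lam01.
have La1 : 0 <= 1 + La by rewrite addr_ge0.
have [C C1 AP] := @a_priori R d al lam (1 + La) al01 lam0 La1.
have C0 : 0 <= C by apply: le_trans C1.
pose B dv Hv := op (fun p => q p - 1%:M) b dv Hv.
have Yq1 i j : isY al (La + 1) (fun p => (q p - 1%:M) i j).
  have := isY_lin 1 1 (Yq i j) (_ : isY al 1 (fun=> - (1%:M : 'M[R]_d) i j)); rewrite normr1 !mul1r.
  move=> /(_ _)/wrap[].
    split=> [p|p|t x y]; first exact: cst_continuous.
      by rewrite normrN mxE; case: (i == j); rewrite ?normr1 ?normr0.
    by rewrite subrr normr0 mul1r powR_ge0.
  by congr isY; apply/funext => p; rewrite !mxE !mul1r.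
have Yb1 i : isY al (La + 1) (fun p => b p 0 i) by apply: isY_mono (Yb i); rewrite lerDl.
pose M := 2 * d%:R * (d%:R + (d%:R + 2)) * (La + 1).
have M0 : 0 <= M by rewrite /M !mulr_ge0 ?addr_ge0.
have YB K v dv Hv : isX al K v dv Hv -> isY al (M * K) (B dv Hv) by exact: isY_op.
pose dl := (2 * (C * M + 1))^-1.
have CM1 : 0 < C * M + 1 by rewrite ltr_wpDl// mulr_ge0.
have dl0 : 0 < dl by rewrite invr_gt0 mulr_gt0.
exists dl => // tau sg t01 sgt Hsol K g Y; have K0 := isY_ge0 Y.
pose et := sg - tau.
have etM : C * (`|et| * M) <= 1 / 2.
  apply: (@le_trans _ _ (C * (dl * M))); first by rewrite ler_wpM2l// ler_wpM2r.
  rewrite /dl (_ : C * (_ * M) = C * M / (2 * (C * M + 1))); last by ring.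
  by rewrite ler_pdivrMr ?mulr_gt0//; have := mulr_ge0 C0 M0; clear; lra.
have Cq := mix_coefs t01 lam01 Eq Yq Yb.
pose T : Type := ((R * E -> R) * ('I_d -> R * E -> R) * ('I_d -> 'I_d -> R * E -> R))%type.
pose good (k : R) (W : T) := isX al k W.1.1 W.1.2 W.2.
pose gB (W : T) (p : R * E) := 1 * g p + et * B W.1.2 W.2 p.
have YgB k W : good k W -> isY al (K + `|et| * (M * k)) (gB W).
  by move=> /YB YW; have := isY_lin 1 et Y YW; rewrite normr1 mul1r.
(* Outside the class of solutions the map is left as the identity, so that it can be iterated as a
   total function. *)
have ex (W : T) : exists W' : T, (exists k, good k W) ->
    (exists k, good k W') /\ solves_on after0 (mixq tau q) (mixb tau b) (gB W) W'.1.1 W'.1.2 W'.2.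
  have [[k Gk]|N] := pselect (exists k, good k W); last by exists W => /N.
  have [v [dv [Hv [L X S]]]] := Hsol _ _ (YgB k W Gk).
  by exists (v, dv, Hv) => _; split=> //; exists L.
have [F HF] := choice ex.
pose W n := iter n F ((fun=> 0), (fun _ _ => 0), (fun _ _ _ => 0)).
have G0 : good 0 (W 0%N).
  split=> /= [|t|//|p|i j t x y].
  - by split=> [|i|i j]; exact: cst_continuous.
  - exact: is_C2_cst.
  - by split=> [|i|i j]; rewrite normr0.
  - by rewrite subrr normr0 mul0r.
have GS n : (exists k, good k (W n)) /\ solves_on after0 (mixq tau q) (mixb tau b) (gB (W n)) (W n.+1).1.1 (W n.+1).1.2 (W n.+1).2.
  elim: n => [|n [IH _]].
    have G : exists k, good k (W 0%N) by exists 0.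
    by split=> //; exact: (HF _ G).2.
  have G : exists k, good k (W n.+1) by exact: (HF _ IH).1.
  by split=> //; exact: (HF _ G).2.
(* Each iterate lies in some ball, of unknown radius; the a priori bound replaces it by
   [C * (K + |et| * M * 2 * C * K)], which is at most [2 * C * K] by [etM]. *)
have GB n : good (2 * (C * K)) (W n).
  elim: n => [|n IH]; first by apply: isX_mono G0; rewrite !mulr_ge0.
  have [[k Gk] _] := GS n.+1; have [_ S] := GS n.
  have Yn := YgB _ _ IH; have X := AP _ _ _ _ _ _ _ _ (isY_ge0 Yn) Cq Gk S Yn.
  apply: isX_mono X; have := ler_wpM2r (mulr_ge0 C0 K0) etM.
  by clear; set z := C * K; rewrite (_ : C * (K + _) = z + 2 * (C * (`|et| * M) * z)); [lra|rewrite /z; ring].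
have DB n : isX al (C * K * (1 / 2) ^+ n) (fun p => 1 * (W n.+1).1.1 p + (-1) * (W n).1.1 p)
    (fun i p => 1 * (W n.+1).1.2 i p + (-1) * (W n).1.2 i p)
    (fun i j p => 1 * (W n.+1).2 i j p + (-1) * (W n).2 i j p).
  elim: n => [|n IH].
    have Y0 : isY al K (gB (W 0%N)) by have := YgB _ _ G0; rewrite !mulr0 addr0.
    have X := AP _ _ _ _ _ _ _ _ K0 Cq (GB 1%N) (GS 0%N).2 Y0.
    rewrite expr0 mulr1; move: X; congr isX.
    - by apply/funext => p; rewrite mul1r mulr0 addr0.
    - by apply/funext => i; apply/funext => p; rewrite mul1r mulr0 addr0.
    - by apply/funext => i; apply/funext => j; apply/funext => p; rewrite mul1r mulr0 addr0.
  have X := isX_lin 1 (-1) (GB n.+2) (GB n.+1).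
  have S := solves_on_lin 1 (-1) (GS n.+1).2 (GS n).2.
  have Yn : isY al (`|et| * (M * (C * K * (1 / 2) ^+ n))) (fun p => 1 * gB (W n.+1) p + -1 * gB (W n) p).
    have := isY_lin et 0 (YB _ _ _ _ IH) (YB _ _ _ _ IH); rewrite normr0 mul0r addr0.
    by congr isY; apply/funext => p; rewrite /B op_lin /gB /B; ring.
  apply: isX_mono (AP _ _ _ _ _ _ _ _ (isY_ge0 Yn) Cq X S Yn).
  have c0 : 0 <= C * K * (1 / 2) ^+ n by rewrite !mulr_ge0// exprn_ge0// divr_ge0.
  have := ler_wpM2r c0 etM; rewrite exprS; set z := C * K * _.
  by rewrite (_ : C * K * (1 / 2 * _) = 1 / 2 * z) ?mulrA//; rewrite /z; ring.
have Cv : ucauchy setT (fun n => (W n).1.1).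
  apply: (@geometric_ucauchy _ _ _ _ (C * K) (1 / 2)); first by rewrite mulr_ge0.
    by clear; lra.
  move=> n p _; have [_ _ _ /(_ p)[A _ _] _] := DB n; by move: A; rewrite mul1r mulN1r.
have K20 : 0 <= 2 * (C * K) by rewrite !mulr_ge0.
have [V [dV [HV [X U0 U1 U2]]]] := X_limit al0 K20 GB Cv.
exists V, dV, HV, (2 * (C * K)) => // t x t0.
have sub (f : nat -> R * E -> R) h : uconv setT f h -> uconv after0 f h.
  by move=> H c c0; have [N HN] := H c c0; exists N => n p Nn _; exact: HN.
have sh (f : nat -> R * E -> R) h : uconv setT f h -> uconv after0 (fun n => f n.+1) h.
  by move=> H c c0; have [N HN] := H c c0; exists N => n p Nn _; apply: HN => //; exact: leqW.
have UB : uconv after0 (fun n => B (W n).1.2 (W n).2) (B dV HV).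
  apply: (@op_uconv _ _ after0 (La + 1)) => [|p _|i|i j]; [exact: addr_ge0| |exact: sub|exact: sub].
  by split=> [i j|i]; [have [_ A _] := Yq1 i j|have [_ A _] := Yb1 i]; exact: A.
have UG := uconv_lin 1 et (uconv_cst after0 g) UB.
have [_ cq cb] := Cq.
have := @solves_uconv _ _ after0 (1 + La) (mixq tau q) (mixb tau b) (fun n => gB (W n)) _ (fun n => (W n.+1).1.1)
  (fun n => (W n.+1).1.2) (fun n => (W n.+1).2) V dV HV t t x La1 _ (fun n => (GS n).2) UG (sh _ _ U0)
  (fun i => sh _ _ (U1 i)) (fun i j => sh _ _ (U2 i j)) t0 => /(_ _ _)/wrap[].
- by move=> p p0; split=> [i j|i]; [exact: (cq i j).1|exact: (cb i).1].
- by move=> s; rewrite /after0 /= ltr_norml; clear; lra.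
by congr (is_derive _ _ _ _); rewrite (op_mix tau sg) /B -/et; ring.
Qed.

Lemma bounded_coefs_solvable (al lam La : R) q b : 0 < al < 1 -> 0 < lam <= 1 -> 0 <= La ->
  (forall p, elliptic_mx lam (q p)) -> (forall i j, isY al La (fun p => q p i j)) ->
  (forall i, isY al La (fun p => b p 0 i)) -> solvable al q b.
Proof.
move=> al01 lam01 La0 Eq Yq Yb.
have [dl dl0 step] := continuity_step al01 lam01 La0 Eq Yq Yb.
have [N HN] : exists N : nat, dl^-1 <= N%:R by exists (Num.truncn dl^-1).+1; exact/ltW/truncnS_gt.
have N0 : 0 < N%:R :> R by apply: lt_le_trans HN; rewrite invr_gt0.
have S k : (k <= N)%N -> solvable al (mixq (k%:R / N%:R) q) (mixb (k%:R / N%:R) b).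
  elim: k => [_|k IH kN].
    have -> : mixq (0%N%:R / N%:R) q = fun=> 1%:M.
      by apply/funext => p; rewrite /mixq mul0r subr0 scale0r addr0.
    have -> : mixb (0%N%:R / N%:R) b = fun=> 0 by apply/funext => p; rewrite /mixb mul0r scale0r.
    exact: heat_solvable.
  apply: (step _ _ _ _ (IH (ltnW kN))).
    by rewrite divr_ge0//= ler_pdivrMr// mul1r ler_nat ltnW.
  rewrite -mulrBl -natr1 addrC addKr mul1r ger0_norm ?invr_ge0//.
  by rewrite -[leRHS]invrK lef_pV2 ?posrE// invr_gt0.
have := S N (leqnn N); rewrite divff ?gt_eqF//.
have -> : mixb 1 b = b by apply/funext => p; rewrite /mixb scale1r.
by have -> : mixq 1 q = q by apply/funext => p; rewrite /mixq subrr scale1r raddf0 add0r.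
Qed.

End method_of_continuity.

(** * Coefficients clamped to a compact cylinder *)

Section clamping.
Context {R : realType} {d : nat}.
Local Notation E := 'rV[R]_d.
Implicit Types (x y z : E) (i j : 'I_d) (s t r n : R) (I : set R) (g : R * E -> R).

Definition clamp (lo hi r : R) : R := Num.max lo (Num.min r hi).

Lemma clamp_range (lo hi r : R) : lo <= hi -> lo <= clamp lo hi r <= hi.
Proof. by move=> h; rewrite /clamp le_max lexx ge_max h ge_min lexx orbT. Qed.

Lemma clamp_id (lo hi r : R) : lo <= r <= hi -> clamp lo hi r = r.
Proof. by move=> /andP[h1 h2]; rewrite /clamp min_l// max_r. Qed.

Lemma clamp_lip (lo hi a c : R) : `|clamp lo hi a - clamp lo hi c| <= `|a - c|.
Proof.
rewrite /clamp; have h1 := ler_norm (a - c); have h2 := ler_norm (c - a); rewrite distrC in h2.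
have h3 := normr_ge0 (a - c).
case: (leP a hi) => ha; case: (leP c hi) => hc; rewrite ?[Num.max lo _]maxEle; repeat case: ifP => ?; rewrite ler_norml; lra.
Qed.

Definition clampv (n : R) x : E := \row_j clamp (- n) n (x 0 j).

(** Time is also translated: the initial time [s] becomes 0, and the given coefficients are only
    evaluated at times in [[s, s + n]], which lie in [I]. *)
Definition clampp s n (p : R * E) : R * E := (s + clamp 0 n p.1, clampv n p.2).

Lemma clampv_lip n x y : `|clampv n x - clampv n y| <= `|x - y|.
Proof.
apply: norm_le_coord => // i; rewrite !mxE; apply: (le_trans (clamp_lip _ _ _ _)).
by have := coord_le_norm (x - y) i; rewrite !mxE.
Qed.

Lemma clampp_in s n p : 0 <= n -> cylinder s (s + n) 0 n (clampp s n p).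
Proof.
move=> n0; split => /=; first by rewrite in_itv/= lerDl lerD2l clamp_range.
rewrite /box /= subr0; apply: norm_le_coord => // i; rewrite mxE.
by rewrite ler_norml clamp_range// ge0_cp// n0.
Qed.

Lemma clampp_id s n t x : 0 <= t <= n -> `|x| <= n -> clampp s n (t, x) = (s + t, x).
Proof.
move=> tn xn; rewrite /clampp /= clamp_id//; congr (_, _); apply/rowP => i; rewrite mxE clamp_id//.
by rewrite -ler_norml; apply: le_trans xn; exact: coord_le_norm.
Qed.

Lemma enorm_le x : enorm x <= d%:R * `|x|.
Proof.
have c0 : 0 <= d%:R * `|x| by rewrite mulr_ge0.
rewrite /enorm -(ger0_norm c0) -sqrtr_sqr; apply: ler_wsqrtr.
apply: (le_trans (ler_norm _)); apply: (@le_trans _ _ (d%:R * `|x| ^+ 2)).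
  apply: sum_le_const => i; rewrite -expr2 normrX ler_sqr ?nnegrE//; exact: coord_le_norm.
rewrite exprMn; apply: ler_wpM2r; first exact: sqr_ge0.
by rewrite -natrX ler_nat; case: (d) => // m; rewrite leq_pmull.
Qed.

(** Clamping does not increase distances and has values in a compact cylinder, so the local Holder
    bound there becomes a global one. At equal times the parabolic distance is the space distance,
    and [D] compares the Euclidean with the maximum norm. *)
Lemma clamped_isY (al s n : R) I g : 0 < al -> 0 <= n -> (forall t, s <= t -> I t) ->
  parabolic_holder_loc al I g -> exists L, isY al L (fun p => g (clampp s n p)).
Proof.
move=> al0 n0 HI Hg; pose K : set (R * E) := cylinder s (s + n) 0 n.
have KI : K `<=` I `*` setT.
  by move=> [t x] [/= + _]; rewrite in_itv/= => /andP[st _]; split=> //; exact: HI.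
have [C HC] := Hg K (cylinder_compact n0) KI.
pose D : R := d%:R; have D0 : 0 <= D by exact: ler0n.
have Dist p p' : `|g (clampp s n p) - g (clampp s n p')| <=
    `|C| * (D * `|clampv n p.2 - clampv n p'.2| + Num.sqrt `|clamp 0 n p.1 - clamp 0 n p'.1|) `^ al.
  apply: (le_trans (HC _ _ (clampp_in s _ n0) (clampp_in s _ n0))).
  apply: (@le_trans _ _ (`|C| * parabolic_dist (clampp s n p) (clampp s n p') `^ al)).
    by rewrite ler_wpM2r ?powR_ge0// ler_norm.
  apply: ler_wpM2l => //; apply: powR_le; first exact: ltW.
    by rewrite addr_ge0// sqrtr_ge0.
  rewrite /parabolic_dist /=; apply: lerD; first exact: enorm_le.
  by rewrite opprD addrACA subrr add0r.
have range (p : R * E) : `|clampv n p.2 - clampv n (0 : R * E).2| <= n.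
  apply: norm_le_coord => // i; rewrite !mxE.
  have := @clamp_range (- n) n (p.2 0 i) ltac:(by rewrite ge0_cp// n0).
  have n00 : - n <= 0 <= n by rewrite oppr_le0 n0.
  by rewrite [clamp _ _ 0]clamp_id// subr0 ler_norml.
pose B := `|C| * (D * n + Num.sqrt n) `^ al; pose A := `|C| * D `^ al.
have hol t x y : `|g (clampp s n (t, x)) - g (clampp s n (t, y))| <= A * `|x - y| `^ al.
  apply: (le_trans (Dist _ _)); rewrite /= subrr normr0 sqrtr0 addr0 /A -mulrA ler_wpM2l//.
  rewrite -(powRM _ D0 (normr_ge0 _)); apply: powR_le; [exact: ltW|exact: mulr_ge0|].
  by apply: ler_wpM2l => //; exact: clampv_lip.
pose M := `|g (clampp s n 0)|.
exists (A + (B + M)).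
have A0 : 0 <= A by rewrite mulr_ge0// powR_ge0.
have B0 : 0 <= B by rewrite mulr_ge0// powR_ge0.
split.
- move=> [t0 x0]; apply/continuous_epsP => c c0.
  have c1 : 0 < c / (`|C| + 1) by rewrite divr_gt0// ltr_wpDl.
  have [h h0 Hh] := @powR_small R al _ al0 c1.
  exists (Num.min (h / (2 * (D + 1))) ((h / 2) ^+ 2)).
    by rewrite lt_min !divr_gt0//= ?exprn_gt0 ?divr_gt0// mulr_gt0// ltr_wpDl.
  move=> [t x]; rewrite lt_min prod_normE /= !gt_max => /andP[/andP[_ x1] /andP[t1 _]].
  apply: (le_trans (Dist _ _)) => /=.
  have : (D * `|clampv n x - clampv n x0| + Num.sqrt `|clamp 0 n t - clamp 0 n t0|) `^ al <= c / (`|C| + 1).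
    apply: le_trans Hh; apply: powR_le; first exact: ltW.
      by rewrite addr_ge0 ?sqrtr_ge0// mulr_ge0.
    have a1 : D * `|clampv n x - clampv n x0| <= h / 2.
      apply: (le_trans (ler_wpM2l D0 (clampv_lip _ _ _))); move/ltW/(ler_wpM2l D0) : x1 => /le_trans; apply.
      by rewrite mulrA ler_pdivrMr ?mulr_gt0 ?ltr_wpDl//; move: D0 h0; clear; nra.
    have a2 : Num.sqrt `|clamp 0 n t - clamp 0 n t0| <= h / 2.
      have h2 : 0 <= h / 2 by rewrite divr_ge0// ltW.
      rewrite -(ger0_norm h2) -(sqrtr_sqr (h / 2)); apply: ler_wsqrtr.
      by apply: (le_trans (clamp_lip _ _ _ _)); exact: ltW.
    by move: a1 a2; clear; lra.
  have Ca := normr_ge0 C; move=> /(ler_wpM2l Ca) /le_trans; apply.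
  by rewrite mulrA ler_pdivrMr ?ltr_wpDl//; move: Ca c0; clear; nra.
- move=> p; have : `|g (clampp s n p) - g (clampp s n 0)| <= B.
    apply: (le_trans (Dist _ _)); rewrite ler_wpM2l//; apply: powR_le; first exact: ltW.
      by rewrite addr_ge0 ?sqrtr_ge0// mulr_ge0.
    apply: lerD; first by rewrite ler_wpM2l.
    have c00 : clamp 0 n (0 : R * E).1 = 0 by apply: clamp_id; rewrite lexx.
    apply: ler_wsqrtr; rewrite c00 subr0.
    by have /andP[a1 a2] := clamp_range p.1 n0; rewrite ger0_norm.
  have := ler_normD (g (clampp s n p) - g (clampp s n 0)) (g (clampp s n 0)); rewrite subrK -/M.
  by move: A0; clear; lra.
- move=> t x y; apply: (le_trans (hol t x y)); rewrite ler_wpM2r ?powR_ge0// lerDl addr_ge0//; exact: normr_ge0.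
Qed.

(** A positive [inf] cannot be its default value 0, so it is a true lower bound of [eta]. The
    minimum with 1 keeps the constant valid for the identity matrix in the method of continuity. *)
Lemma uniform_ellipticity (I : set R) (Q : R * E -> 'M[R]_d) : elliptic I Q ->
  exists2 lam, 0 < lam <= 1 & forall p, I p.1 -> elliptic_mx lam (Q p).
Proof.
move=> [Qs [eta [e0 He]]]; pose S := eta @` (I `*` setT); have hS : has_inf S.
  by apply: contrapT => H; move: e0; rewrite inf_out// ltxx.
exists (Num.min 1 (inf S)); first by rewrite lt_min ltr01 e0 ge_min lexx.
move=> p Ip; have Ip' : (I `*` setT) p by [].
split=> [|v]; first exact: Qs.
have := He p v Ip'; rewrite /enorm sqr_sqrtr; last by apply: sumr_ge0 => i _; rewrite -expr2 sqr_ge0.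
have -> : dotp (v *m (Q p)^T) v = qform (Q p) v.
  rewrite /dotp /qform; apply: eq_bigr => i _; rewrite mxE mulr_suml; apply: eq_bigr => j _.
  by rewrite mxE; ring.
have -> : dotp v v = \sum_i v 0 i ^+ 2 by apply: eq_bigr => i _; rewrite expr2.
apply: le_trans; apply: ler_wpM2r; first by apply: sumr_ge0 => i _; exact: sqr_ge0.
have : inf S <= eta p by apply: (ge_inf hS.2); exists p.
by rewrite ge_min => ->; rewrite orbT.
Qed.

Lemma clamped_coefs (al s n : R) I (Q : R * E -> 'M[R]_d) (b : R * E -> E) : 0 < al -> 0 <= n ->
  (forall t, s <= t -> I t) -> (forall i j, parabolic_holder_loc al I (fun p => Q p i j)) ->
  (forall i, parabolic_holder_loc al I (fun p => b p 0 i)) ->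
  exists2 L, 0 <= L & (forall i j, isY al L (fun p => Q (clampp s n p) i j)) /\
    (forall i, isY al L (fun p => b (clampp s n p) 0 i)).
Proof.
move=> al0 n0 HI HQ Hb.
have [f Hf] := choice (fun ij : 'I_d * 'I_d => clamped_isY al0 n0 HI (HQ ij.1 ij.2)).
have [g Hg] := choice (fun i => clamped_isY al0 n0 HI (Hb i)).
have f0 ij : 0 <= f ij by exact: isY_ge0 (Hf ij).
have g0 i : 0 <= g i by exact: isY_ge0 (Hg i).
have F0 : 0 <= \sum_ij f ij by apply: sumr_ge0.
have G0 : 0 <= \sum_i g i by apply: sumr_ge0.
exists (\sum_ij f ij + \sum_i g i); first exact: addr_ge0.
split=> [i j|i].
  apply: isY_mono (Hf (i, j)); rewrite (bigD1 (i, j))//= -addrA lerDl addr_ge0//.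
  by apply: sumr_ge0.
apply: isY_mono (Hg i); rewrite [\sum_i g i](bigD1 i)//= addrCA lerDl addr_ge0//.
by apply: sumr_ge0.
Qed.

End clamping.

(** * Approximate solutions with prescribed initial values *)

Section approximation.
Context {R : realType} {d : nat}.
Local Notation E := 'rV[R]_d.
Local Notation e i := (delta_mx 0 i : 'rV[R]_d).
Implicit Types (x y z : E) (i j : 'I_d) (s t r : R) (q : R * E -> 'M[R]_d) (b : R * E -> E).

Lemma isY_initial al K (g : R * E -> R) : isY al K g -> isY al K (fun p => g (0, p.2)).
Proof.
move=> [g1 g2 g3]; split=> // p.
have c1 : {for p, continuous (fun _ : R * E => 0 : R)} by exact: cst_continuous.
have c2 : {for p, continuous (fun p : R * E => p.2)} by exact: cvg_snd.
exact: (continuous_comp (continuous_pair c1 c2) (g1 _)).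
Qed.

(** [z] is the sum of a time-independent smoothing [h] of [f] and of a solution [v] with zero
    initial values that compensates for [h]. There are three rounds of averages, one to make [f]
    Holder and two for second derivatives; each reaches as far as [d * ep], whence
    [3 * (d * ep)]. *)
Lemma approximate_solution (al lam La F ep : R) q b (f : E -> R) : 0 < al < 1 -> 0 < lam <= 1 -> 0 <= La ->
  (forall p, elliptic_mx lam (q p)) -> (forall i j, isY al La (fun p => q p i j)) ->
  (forall i, isY al La (fun p => b p 0 i)) ->
  0 < ep -> continuous f -> (forall x, `|f x| <= F) ->
  exists (z : R * E -> R) (dz : 'I_d -> R * E -> R) (Hz : 'I_d -> 'I_d -> R * E -> R) (K : R),
  [/\ [/\ continuous z, forall i, continuous (dz i) & forall i j, continuous (Hz i j)],
      C2_slices z dz Hz /\ solves_on after0 q b (fun=> 0) z dz Hz,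
      forall t x, `|z (t, x)| <= F /\ (t <= 0 -> z (t, x) = z (0, x)),
      forall x c dl, (forall y, `|y - x| <= 3 * (d%:R * ep) -> `|f y - c| <= dl) -> `|z (0, x) - c| <= dl
    & forall i j t x y, `|Hz i j (t, x) - Hz i j (t, y)| <= K * `|x - y| `^ al].
Proof.
move=> al01 lam01 La0 Eq Yq Yb ep0 cf HF; have [al0 al1] := andP al01; have [lam0 lam1] := andP lam01.
pose g0 (p : R * E) := f p.2.
have cg0 : continuous g0.
  move=> p; have c2 : {for p, continuous (fun p : R * E => p.2)} by exact: cvg_snd.
  exact: (continuous_comp c2 (cf _)).
pose l := enum 'I_d; have jl j : j \in l by rewrite mem_enum.
have sl : size l = d by rewrite size_enum_ord.
have [L0 Y0] := isY_of_bounded (l := l) ep0 al01 cg0 (fun p => HF p.2) jl.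
have [dg [Hg [L L0L [Y1 Y2 Cg]]]] := mollification ep0 al0 jl Y0.
set g := mols ep l (mols ep l (mols ep l g0)) in Cg.
have Yg : isY al L g by apply: isY_mono L0L _; do 2 apply: isY_mols => //.
pose h (p : R * E) := g (0, p.2).
pose dh i (p : R * E) := dg i (0, p.2); pose Hh i j (p : R * E) := Hg i j (0, p.2).
have Yh : isY al L h by exact: isY_initial.
have Ydh i : isY al L (dh i) by exact: isY_initial.
have YHh i j : isY al L (Hh i j) by exact: isY_initial.
have Ch : C2_slices h dh Hh by move=> t; exact: Cg.
have YG : exists K, isY al K (fun p => 1 * op q b dh Hh p + (-1) * h p).
  have A1 := isY_sum (fun i => isY_sum (fun j => isY_mul (Yq i j) (YHh i j))).
  have A2 := isY_sum (fun i => isY_mul (Yb i) (Ydh i)).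
  have := isY_lin 1 (-1) (isY_lin 1 1 A1 A2) Yh; set K := (X in isY _ X _) => A; exists K.
  by move: A; congr isY; apply/funext => p; rewrite /op [1 * _ + 1 * _](_ : _ = \sum_i \sum_j q p i j * Hh i j p + \sum_i b p 0 i * dh i p)// !mul1r.
have [K0 YG0] := YG.
have [v [dv [Hv [L' X S]]]] := bounded_coefs_solvable al01 lam01 La0 Eq Yq Yb YG0.
have [[X1 X2 X3] C2 v0 Bd Hol] := X.
pose z (p : R * E) := 1 * h p + 1 * v p; pose dz i (p : R * E) := 1 * dh i p + 1 * dv i p; pose Hz i j (p : R * E) := 1 * Hh i j p + 1 * Hv i j p.
have cz : continuous z by move=> p; apply: continuous_lin; [case: Yh => A _ _; exact: A|exact: X1].
have C2z : C2_slices z dz Hz by exact: C2_slices_lin.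
have Sz : solves_on after0 q b (fun=> 0) z dz Hz.
  move=> t x t0; have Dh : is_derive t 1 (fun s => h (s, x)) 0 by exact: (is_derive_cst (h (0, x)) t 1).
  have := is_deriveD (is_deriveMl 1 Dh) (is_deriveMl 1 (S t x t0)).
  by congr (is_derive _ _ _ _); rewrite /dz /Hz op_lin /z; ring.
have z0 x c dl : (forall y, `|y - x| <= 3 * (d%:R * ep) -> `|f y - c| <= dl) -> `|z (0, x) - c| <= dl.
  move=> H; rewrite /z v0// mulr0 addr0 mul1r /h /=.
  have cm1 := @mols_continuous _ _ ep l _ ep0 cg0; have cm2 := @mols_continuous _ _ ep l _ ep0 cm1.
  apply: (mols_local (rho := 0) (x := x) ep0 cm2); last by rewrite subrr normr0.
  apply: (mols_local (x := x) ep0 cm1); apply: (mols_local (x := x) ep0 cg0) => y yx; apply: H.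
  by apply: (le_trans yx); rewrite sl; clear; lra.
have Hc := mix_coefs (tau := 1) _ lam01 Eq Yq Yb.
have La1 : 0 <= 1 + La by rewrite addr_ge0.
have F0 : 0 <= F by apply: le_trans (HF 0).
exists z, dz, Hz, (L + L'); split=> //.
- split=> // [i|i j] p; apply: continuous_lin; try exact: X2; try exact: X3.
    by case: (Ydh i) => A _ _; exact: A.
  by case: (YHh i j) => A _ _; exact: A.
- have zn t x : t <= 0 -> z (t, x) = z (0, x) by move=> t0; rewrite /z !v0.
  move=> t x; split; last exact: zn.
  have [t0|t0] := leP 0 t; last first.
    by rewrite (zn _ _ (ltW t0)) -[z _]subr0; apply: z0 => y _; rewrite subr0.
  apply: (sup_bound_abs (al := al) (K := L + L') (q := q) (b := b) (g := fun=> 0) (dv := dz) (Hv := Hz) lam0 La1 F0) => //.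
  + move: (Hc ltac:(by rewrite ler01 lexx)).
    have -> : mixb 1 b = b by apply/funext => p; rewrite /mixb scale1r.
    by have -> : mixq 1 q = q by apply/funext => p; rewrite /mixq subrr scale1r raddf0 add0r; exact.
  + move=> p; rewrite /z !mul1r; apply: (le_trans (ler_normD _ _)); apply: lerD; first by case: Yh.
    by have [] := Bd p.
  + by move=> p _; rewrite normr0.
  + by move=> y; rewrite -[z _]subr0; apply: z0 => y' _; rewrite subr0.
- move=> i j t x y; rewrite /Hz !mul1r opprD addrACA mulrDl; apply: (le_trans (ler_normD _ _)).
  by apply: lerD => //; case: (YHh i j) => _ _; exact.
Qed.

End approximation.

(** * Limit over growing cylinders *)

Section limit_solution.
Context {R : realType} {d : nat}.
Local Notation E := 'rV[R]_d.
Local Notation e i := (delta_mx 0 i : 'rV[R]_d).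
Implicit Types (x y : E) (i j : 'I_d) (n m k : nat) (s t r T : R) (q : R * E -> 'M[R]_d) (b : R * E -> E).
Implicit Types (z w : R * E -> R) (dw dz : 'I_d -> R * E -> R) (Hw Hz : 'I_d -> 'I_d -> R * E -> R).

Lemma uniformly_continuous_on_box (f : E -> R) r (dl : R) : continuous f -> 0 <= r -> 0 < dl ->
  exists2 c : R, 0 < c & forall x y, `|x| <= r -> `|y - x| <= c -> `|f y - f x| <= dl.
Proof.
move=> cf r0 dl0; have K : compact (box (0 : E) r) by exact: compact_box.
pose P (c : R) x := forall y, `|y - x| <= c -> `|f y - f x| <= dl.
have : \forall c \near (0 : R), box (0 : E) r `<=` P c.
  apply: ((compact_near_coveringP (box (0 : E) r)).1 K R (nbhs (0 : R)) P) => x0 _.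
  have [h h0 H] := (continuous_epsP _ _).1 (cf x0) (dl / 2) ltac:(by rewrite divr_gt0).
  have h2 : 0 < h / 2 by rewrite divr_gt0.
  have Bc : \forall c \near (0 : R), `|c| < h / 2.
    by apply/nbhs_ballP; exists (h / 2) => // c; rewrite /ball /= sub0r normrN.
  have Bx : \forall x \near x0, `|x - x0| < h / 2.
    by apply/nbhs_ballP; exists (h / 2) => // x; rewrite -ball_normE /= distrC.
  near=> x c; rewrite /P /= => y yx.
  have c1 : `|c| < h / 2 by near: c.
  have x1 : `|x - x0| < h / 2 by near: x.
  have x2 : `|x - x0| < h by move: x1 h0; clear; lra.
  have y2 : `|y - x0| < h.
    rewrite -[y - x0](subrKA x); apply: (le_lt_trans (ler_normD _ _)).
    by have := ler_norm c; move: yx c1 x1; clear; lra.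
  rewrite (_ : f y - f x = (f y - f x0) - (f x - f x0)); last by ring.
  by apply: (le_trans (ler_normB _ _)); have := H x x2; have := H y y2; clear; lra.
move=> /nbhs_ballP[h /= h0 H]; exists (h / 2); first by rewrite divr_gt0.
move=> x y xr yx; have h2 : 0 < h / 2 by rewrite divr_gt0.
apply: (H (h / 2) _ x _ y yx); last by rewrite /box /= subr0.
by rewrite /ball /= sub0r normrN gtr0_norm//; move: h0; clear; lra.
Unshelve. all: by end_near. Qed.

Lemma bounded_on_box (f : E -> R) r : continuous f -> 0 <= r -> exists B : R, forall x, `|x| <= r -> f x <= B.
Proof.
move=> cf r0; have K : compact (box (0 : E) r) by exact: compact_box.
have [M [_ HM]] := compact_bounded (continuous_compact (continuous_subspaceT cf) K).
exists (M + 1) => x xr; apply: (le_trans (ler_norm _)); apply: (HM (M + 1)); first by rewrite ltrDl.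
by exists x => //; rewrite /box /= subr0.
Qed.

Definition lyapunov_upto T q b := exists phi dphi Hphi, exists2 lam : R, 0 <= lam &
  [/\ continuous phi, @is_C2 R d phi dphi Hphi, (forall x, 0 <= phi x) /\ coercive phi
    & forall t x, 0 < t <= T -> op q b (fun i p => dphi i p.2) (fun i j p => Hphi i j p.2) (t, x) <= lam * phi x].

(** [rho] is found before [w]: on the boundary of the large box [phi] is so big that the barrier
    contributes at most [dl] on the small one. So the equation and small initial values are needed
    on the large box only. *)
Lemma local_comparison T r (F dl : R) q b : lyapunov_upto T q b -> 0 <= r -> 0 <= F -> 0 < dl ->
  (forall t x, 0 < t <= T -> (q (t, x))^T = q (t, x) /\ psd (q (t, x))) ->
  exists2 rho : R, r <= rho & forall w dw Hw, continuous w -> C2_slices w dw Hw ->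
    (forall t x, 0 < t <= T -> `|x| < rho -> is_derive t 1 (fun s => w (s, x)) (op q b dw Hw (t, x) - w (t, x))) ->
    (forall x, `|x| <= rho -> w (0, x) <= dl) -> (forall p, w p <= F) ->
    forall t x, 0 <= t <= T -> `|x| <= r -> w (t, x) <= 2 * dl.
Proof.
move=> [phi [dphi [Hphi [lam lam0 [cphi C2 [p0 co] Hop]]]]] r0 F0 dl0 Hq.
have [B HB] := bounded_on_box cphi r0.
pose B1 := Num.max B 0; have B10 : 0 <= B1 by rewrite le_max lexx orbT.
pose X := F * expR (lam * T) * B1.
have X0 : 0 <= X by rewrite mulr_ge0// mulr_ge0// ltW// expR_gt0.
pose ml := X / dl + 1; have ml0 : 0 < ml by rewrite ltr_wpDl// divr_ge0// ltW.
have [r1 Hr1] := co ml.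
pose rho := Num.max r r1; have rrho : r <= rho by rewrite le_max lexx.
exists rho => // w dw Hw cw Cw Hd W0 WF t x tT xr; have /andP[t0 tT'] := tT.
have pml y : `|y| = rho -> ml <= phi y by move=> yE; apply: Hr1; rewrite yE le_max lexx orbT.
have cw' : {within cylinder 0 T 0 rho, continuous w} by exact: continuous_subspaceT.
have := @barrier_on_box R d T rho lam ml dl F w (fun p => op q b dw Hw p - w p) dw Hw q b phi dphi Hphi
  (ltW dl0) F0 ml0 lam0 cphi cw' (fun t _ => Cw t) Hd (fun t x tT _ => Hq t x tT) C2 (fun x _ => p0 x) pml
  (fun t x tT _ => Hop t x tT) W0 (fun t x _ _ => WF (t, x)) _ t x tT (le_trans xr rrho).
move=> /(_ _)/wrap[]; first by move=> s y _ _ wp; rewrite gerBl ltW.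
move=> /le_trans; apply; rewrite mulrDl mul1r lerD2l.
have A : expR (lam * t) * phi x <= expR (lam * T) * B1.
  apply: ler_pM => //.
    by rewrite ler_expR ler_wpM2l.
  by apply: (le_trans (HB x xr)); rewrite le_max lexx.
rewrite (_ : F / ml * _ * _ = F * (expR (lam * t) * phi x) / ml); last by ring.
rewrite ler_pdivrMr//; apply: (le_trans (ler_wpM2l F0 A)); rewrite mulrA -/X /ml mulrDr mulr1 mulrC divfK ?gt_eqF//.
by rewrite lerDl ltW.
Qed.

Lemma uconv_shift (U : Type) (A : set U) (f : nat -> U -> R) (g : U -> R) k :
  uconv A f g -> uconv A (fun n => f (n + k)%N) g.
Proof. by move=> H c c0; have [N HN] := H c c0; exists N => n p Nn; apply: HN; rewrite (leq_trans Nn)// leq_addr. Qed.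

Section cauchy_problem.
Variables (al lam F : R) (q : R * E -> 'M[R]_d) (b : R * E -> E) (La : nat -> R)
  (qn : nat -> R * E -> 'M[R]_d) (bn : nat -> R * E -> E) (f : E -> R).
Hypotheses (al01 : 0 < al < 1) (lam01 : 0 < lam <= 1) (La0 : forall n, 0 <= La n).
Hypotheses (Eq : forall n p, elliptic_mx lam (qn n p)) (Yq : forall n i j, isY al (La n) (fun p => qn n p i j))
  (Yb : forall n i, isY al (La n) (fun p => bn n p 0 i)).
Hypotheses (agree : forall n t x, 0 <= t <= n%:R -> `|x| <= n%:R -> qn n (t, x) = q (t, x) /\ bn n (t, x) = b (t, x)).
Hypotheses (lyap : forall T, lyapunov_upto T q b) (cf : continuous f) (fF : forall x, `|f x| <= F).

Let F0 : 0 <= F. Proof. by apply: le_trans (fF 0). Qed.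

Let lam0 : 0 < lam. Proof. by case/andP: lam01. Qed.

Let natge (c : R) : exists N : nat, forall n, (N <= n)%N -> c <= n%:R.
Proof. by exists (Num.truncn c).+1 => n Nn; apply: (le_trans (ltW (truncnS_gt c))); rewrite ler_nat. Qed.

Let ell t x : 0 <= t -> elliptic_mx lam (q (t, x)).
Proof.
move=> t0; have [N HN] := natge (t + `|x|); have := HN N (leqnn N) => h.
have [<- _] := agree (n := N) (t := t) (x := x) ltac:(rewrite t0; move: (normr_ge0 x) h; lra) ltac:(move: t0 h; lra).
exact: Eq.
Qed.

(** The outcome of [approximate_solution] at scale [1 / (n + 1)]; the Holder constant [K] may depend
    on [n]. *)
Definition approx n z dz Hz :=
  [/\ [/\ continuous z, forall i, continuous (dz i) & forall i j, continuous (Hz i j)],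
      C2_slices z dz Hz /\ solves_on after0 (qn n) (bn n) (fun=> 0) z dz Hz,
      forall t x, `|z (t, x)| <= F /\ (t <= 0 -> z (t, x) = z (0, x)),
      forall x c dl, (forall y, `|y - x| <= 3 * (d%:R * n.+1%:R^-1) -> `|f y - c| <= dl) -> `|z (0, x) - c| <= dl
    & exists K, forall i j t x y, `|Hz i j (t, x) - Hz i j (t, y)| <= K * `|x - y| `^ al].

Variables (z : nat -> R * E -> R) (dz : nat -> 'I_d -> R * E -> R) (Hz : nat -> 'I_d -> 'I_d -> R * E -> R).
Hypothesis Z : forall n, approx n (z n) (dz n) (Hz n).

Let initial_close r (c : R) : 0 <= r -> 0 < c -> exists N : nat, forall n x, (N <= n)%N -> `|x| <= r ->
  `|z n (0, x) - f x| <= c.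
Proof.
move=> r0 c0; have [h h0 H] := uniformly_continuous_on_box cf r0 c0.
have [N HN] := natge (3 * d%:R / h); exists N => n x Nn xr.
have [_ _ _ A _] := Z n; apply: A => y yx; apply: H => //; apply: (le_trans yx).
rewrite mulrA ler_pdivrMr// [h * _]mulrC -ler_pdivrMr//; apply: HN; exact: leqW.
Qed.

Let difference n m t x : 0 < t <= n%:R -> t <= m%:R -> `|x| <= n%:R -> `|x| <= m%:R ->
  is_derive t 1 (fun s => 1 * z n (s, x) + (-1) * z m (s, x))
    (op q b (fun i p => 1 * dz n i p + (-1) * dz m i p) (fun i j p => 1 * Hz n i j p + (-1) * Hz m i j p) (t, x)
     - (1 * z n (t, x) + (-1) * z m (t, x))).
Proof.
move=> /andP[t0 tn] tm xn xm; have [_ [_ Sn] _ _ _] := Z n; have [_ [_ Sm] _ _ _] := Z m.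
have := is_deriveD (is_deriveMl 1 (Sn t x t0)) (is_deriveMl (-1) (Sm t x t0)).
have [qnE bnE] := agree (n := n) (t := t) (x := x) ltac:(by rewrite (ltW t0)) xn.
have [qmE bmE] := agree (n := m) (t := t) (x := x) ltac:(by rewrite (ltW t0)) xm.
by congr (is_derive _ _ _ _); rewrite op_lin /op qnE qmE bnE bmE; ring.
Qed.

(** On a fixed box all late approximations solve the same equation. Their differences are bounded by
    [2 * F] and initially small, so [local_comparison] applies. *)
Let z_cauchy T r (c : R) : 0 <= r -> 0 < c -> exists N : nat, forall n m t x, (N <= n)%N -> (N <= m)%N ->
  t <= T -> `|x| <= r -> `|z n (t, x) - z m (t, x)| <= c.
Proof.
move=> r0 c0; have c2 : 0 < c / 2 by rewrite divr_gt0.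
have c4 : 0 < c / 4 by rewrite divr_gt0.
have F20 : 0 <= 2 * F by rewrite mulr_ge0.
have Hq t x : 0 < t <= T -> (q (t, x))^T = q (t, x) /\ psd (q (t, x)).
  by move=> /andP[t0 _]; have H := ell x (ltW t0); split; [case: H|exact: elliptic_psd (ltW lam0) H].
have [rho rrho LC] := local_comparison (lyap T) r0 F20 c2 Hq.
have rho0 : 0 <= rho by exact: le_trans rrho.
have [N1 H1] := initial_close rho0 c4; have [N2 H2] := natge (Num.max T rho).
have zero n m x : (maxn N1 N2 <= n)%N -> (maxn N1 N2 <= m)%N -> `|x| <= rho -> `|z n (0, x) - z m (0, x)| <= c / 2.
  rewrite !geq_max => /andP[n1 _] /andP[m1 _] xr.
  rewrite (_ : _ - _ = (z n (0, x) - f x) - (z m (0, x) - f x)); last by ring.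
  by apply: (le_trans (ler_normB _ _)); have := H1 n x n1 xr; have := H1 m x m1 xr; lra.
have half n m t x : (maxn N1 N2 <= n)%N -> (maxn N1 N2 <= m)%N -> 0 <= t <= T -> `|x| <= r -> z n (t, x) - z m (t, x) <= c.
  move=> Nn Nm tT xr; have [[cn _ _] [Cn _] Bn _ _] := Z n; have [[cm _ _] [Cm _] Bm _ _] := Z m.
  have big k : (maxn N1 N2 <= k)%N -> T <= k%:R /\ rho <= k%:R.
    by rewrite geq_max => /andP[_ /H2]; rewrite ge_max => /andP.
  have [Tn rn] := big n Nn; have [Tm rm] := big m Nm.
  have := LC _ _ _ _ (C2_slices_lin 1 (-1) Cn Cm) _ _ _ t x tT xr => /(_ _ _ _ _)/wrap[].
  - by move=> p; apply: continuous_lin; [exact: cn|exact: cm].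
  - move=> s y /andP[s0 sT] yr; apply: difference; rewrite ?s0 ?(le_trans sT)//.
      exact: le_trans (ltW yr) rn.
    exact: le_trans (ltW yr) rm.
  - by move=> y yr; rewrite mul1r mulN1r; apply: (le_trans (ler_norm _)); exact: zero.
  - move=> [s y]; rewrite mul1r mulN1r; apply: (le_trans (ler_norm _)); apply: (le_trans (ler_normB _ _)).
    by have [h1 _] := Bn s y; have [h2 _] := Bm s y; move: h1 h2; lra.
  by rewrite mul1r mulN1r (_ : 2 * (c / 2) = c)//; field.
exists (maxn N1 N2) => n m t x Nn Nm tT xr; have [t0|t0] := leP 0 t; last first.
  have [_ _ Bn _ _] := Z n; have [_ _ Bm _ _] := Z m.
  rewrite (Bn t x).2 ?(ltW t0)// (Bm t x).2 ?(ltW t0)//; apply: (le_trans (zero n m x Nn Nm (le_trans xr rrho))).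
  by move: c0; lra.
by rewrite ler_norml; have := half n m t x Nn Nm; have := half m n t x Nm Nn; rewrite t0 tT => /(_ isT xr) h1 /(_ isT xr); move: h1; lra.
Qed.

(** Inside the box of radius [r + 1] the coefficients coincide with those of index [N0]. The
    interior estimate for differences thus has a constant independent of [n] and [m]. *)
Let derivatives_cauchy T r D (c : R) : 0 <= r -> 0 < D <= 1 -> 0 < c ->
  exists N : nat, forall n m t x, (N <= n)%N -> (N <= m)%N -> D <= t <= T -> `|x| <= r ->
    (forall i j, `|Hz n i j (t, x) - Hz m i j (t, x)| <= c) /\ (forall i, `|dz n i (t, x) - dz m i (t, x)| <= c).
Proof.
move=> r0 D01 c0; have /andP[D0 D1] := D01; have [N0 HN0] := natge (Num.max T (r + 1)).
have := HN0 N0 (leqnn _); rewrite ge_max => /andP[T0 r10].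
have [C C0 IE] := @interior_estimate R d al lam (La N0) al01 lam0 (La0 N0).
pose S := c * D ^+ 2 / (C + 1).
have S0 : 0 < S by rewrite divr_gt0 ?ltr_wpDl// mulr_gt0// exprn_gt0.
have Sc : C * S / D ^+ 2 <= c.
  rewrite ler_pdivrMr ?exprn_gt0// /S mulrA ler_pdivrMr ?ltr_wpDl//.
  by have := mulr_gt0 c0 (exprn_gt0 2 D0); nra.
have r1 : 0 <= r + 1 by rewrite addr_ge0.
have [N1 HN1] := z_cauchy T r1 S0.
exists (maxn N0 N1) => n m t x; rewrite !geq_max => /andP[n0 n1] /andP[m0 m1] tT xr.
have big k : (N0 <= k)%N -> T <= k%:R /\ r + 1 <= k%:R by move=> /HN0; rewrite ge_max => /andP.
have [Tn rn] := big n n0; have [Tm rm] := big m m0.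
have [[cn _ _] [Cn _] _ _ [Kn Hn]] := Z n; have [[cm _ _] [Cm _] _ _ [Km Hm]] := Z m.
have := IE T (r + 1) S (`|1| * Kn + `|-1| * Km) q b _ _ _ (ltW S0) _ (C2_slices_lin 1 (-1) Cn Cm) _ _ _ _ t D x D01 tT.
move=> /(_ _ _ _ _ _ _)/wrap[].
- by move=> p; apply: continuous_lin; [exact: cn|exact: cm].
- move=> s y [/= /andP[s0 sT] yr]; rewrite addr0; apply: difference; rewrite ?s0 ?(le_trans sT)//.
    exact: le_trans (ltW yr) rn.
  exact: le_trans (ltW yr) rm.
- have eq s y : after0_box T (r + 1) (s, y) -> qn N0 (s, y) = q (s, y) /\ bn N0 (s, y) = b (s, y).
    by move=> [/= /andP[s0 sT] yr]; apply: agree; rewrite ?(ltW s0) ?(le_trans sT)//; exact: le_trans (ltW yr) r10.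
  split=> [[s y] sy|i j|i]; first by have [<- _] := eq s y sy; exact: Eq.
  + have [_ A2 A3] := Yq N0 i j; split=> [[s y] sy|s y y' sy sy'].
      by have [<- _] := eq s y sy; exact: A2.
    by have [<- _] := eq s y sy; have [<- _] := eq s y' sy'; exact: A3.
  + have [_ A2 A3] := Yb N0 i; split=> [[s y] sy|s y y' sy sy'].
      by have [_ <-] := eq s y sy; exact: A2.
    by have [_ <-] := eq s y sy; have [_ <-] := eq s y' sy'; exact: A3.
- by move=> [s y] [/= /andP[_ sT] yr]; rewrite mul1r mulN1r; apply: HN1 => //; exact: ltW.
- move=> i j s y y'; rewrite (_ : _ - _ = 1 * (Hz n i j (s, y) - Hz n i j (s, y')) + (-1) * (Hz m i j (s, y) - Hz m i j (s, y'))); last by ring.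
  by apply: (le_trans (lin_bound _ _ (Hn i j s y y') (Hm i j s y y'))); rewrite !mulrA -mulrDl.
- by move: D1 xr; lra.
move=> [A1 A2]; split=> [i j|i].
  by have := A1 i j; rewrite mul1r mulN1r => /le_trans; apply.
by have := A2 i; rewrite mul1r mulN1r => /le_trans; apply.
Qed.

Definition classical_on_after0 (u : R * E -> R) du Hu := forall t x, 0 < t ->
  [/\ forall i, is_derive x (e i) (fun y => u (t, y)) (du i (t, x)),
      forall i j, is_derive x (e i) (fun y => du j (t, y)) (Hu i j (t, x)),
      forall i, {for (t, x), continuous (du i)},
      forall i j, {for (t, x), continuous (Hu i j)}
    & is_derive t 1 (fun s => u (s, x)) (op q b du Hu (t, x) - u (t, x))].

Lemma approximations_converge : exists u du Hu,
  [/\ continuous u, forall p, `|u p| <= F, forall x, u (0, x) = f x & classical_on_after0 u du Hu].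
Proof.
pose u := limf z; pose du i := limf (fun n => dz n i); pose Hu i j := limf (fun n => Hz n i j).
pose A0 T r : set (R * E) := [set p | p.1 <= T /\ `|p.2| <= r].
pose A T r D : set (R * E) := [set p | D <= p.1 <= T /\ `|p.2| <= r].
have U0 T r : 0 <= r -> uconv (A0 T r) z u.
  move=> r0; apply: ucauchy_uconv => c c0; have [N HN] := z_cauchy T r0 c0.
  by exists N => n m [t x] Nn Nm [/= tT xr]; exact: HN.
have U1 T r D i : 0 <= r -> 0 < D <= 1 -> uconv (A T r D) (fun n => dz n i) (du i).
  move=> r0 D01; apply: ucauchy_uconv => c c0; have [N HN] := derivatives_cauchy T r0 D01 c0.
  by exists N => n m [t x] Nn Nm [/= tT xr]; have [_ A1] := HN n m t x Nn Nm tT xr.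
have U2 T r D i j : 0 <= r -> 0 < D <= 1 -> uconv (A T r D) (fun n => Hz n i j) (Hu i j).
  move=> r0 D01; apply: ucauchy_uconv => c c0; have [N HN] := derivatives_cauchy T r0 D01 c0.
  by exists N => n m [t x] Nn Nm [/= tT xr]; have [A1 _] := HN n m t x Nn Nm tT xr.
exists u, du, Hu.
have near_norm (t s D : R) x y : `|(s, y) - (t, x)| < D -> `|s - t| < D /\ `|y - x| < D.
  by rewrite prod_normE /= gt_max => /andP.
have yr (x y : E) (D : R) : D <= 1 -> `|y - x| < D -> `|y| <= `|x| + 1.
  by move=> D1 h; have := ler_normD (y - x) x; rewrite subrK; move: h D1; lra.
split.
- move=> [t x]; have r0 : 0 <= `|x| + 1 by rewrite addr_ge0.
  apply: (uconv_continuous ltr01 _ (U0 (t + 1) (`|x| + 1) r0)) => [[s y] /near_norm[h1 h2]|n].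
    by split=> /=; [move: h1; rewrite ltr_norml; lra|exact: yr h2].
  by have [[A1 _ _] _ _ _ _] := Z n; exact: A1.
- move=> [t x]; have r0 : 0 <= `|x| by [].
  apply: (uconv_le (U0 t `|x| r0)); first by split=> /=.
  by move=> n; have [_ _ A1 _ _] := Z n; have [] := A1 t x.
- move=> x; apply/eqP; rewrite -subr_eq0 -normr_le0; apply/ler_addgt0Pr => c c0; rewrite add0r.
  have c2 : 0 < c / 2 by rewrite divr_gt0.
  have r0 : 0 <= `|x| by [].
  have [N1 H1] := U0 0 `|x| r0 _ c2; have [N2 H2] := initial_close r0 c2; pose N := maxn N1 N2.
  have := H1 N (0, x) (leq_maxl _ _) ltac:(by split=> /=); have := H2 N x (leq_maxr _ _) (lexx _) => h1 h2.
  rewrite (_ : u (0, x) - f x = (z N (0, x) - f x) - (z N (0, x) - u (0, x))); last by ring.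
  by apply: (le_trans (ler_normB _ _)); move: h1 h2; lra.
(* [D] is the radius of a neighbourhood of [(t, x)] that stays away from the initial time. *)
move=> t x t0; pose D := Num.min 1 (t / 2); pose T := t + 1; pose r := `|x| + 1.
have D1 : D <= 1 by rewrite ge_min lexx.
have D2 : D <= t / 2 by rewrite ge_min lexx orbT.
have D0 : 0 < D by rewrite lt_min ltr01 divr_gt0.
have D01 : 0 < D <= 1 by rewrite D0.
have r0 : 0 <= r by rewrite addr_ge0.
have tA : D <= t <= T by apply/andP; split; [move: D2 t0|]; rewrite ?/T; lra.
have sA s : `|s - t| < D -> D <= s <= T by rewrite ltr_norml /T => h; apply/andP; split; move: h D1 D2 t0; lra.
have inA p : `|p - (t, x)| < D -> A T r D p.
  by case: p => s y /near_norm[h1 h2]; split=> /=; [exact: sA|exact: yr h2].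
have sub : uconv (A T r D) z u.
  by move=> c /(U0 T r r0)[N HN]; exists N => n p Nn [/= /andP[_ p1] p2]; apply: HN.
have sl (k : nat -> R * E -> R) g : uconv (A T r D) k g -> uconv [set y : E | `|y| <= r] (fun n y => k n (t, y)) (fun y => g (t, y)).
  by move=> H c /H[N HN]; exists N => n y Nn yr'; apply: HN => //; split.
have line (i : 'I_d) (a : R) : `|a| < D -> `|x + a *: e i| <= r.
  by move=> aD; apply: (yr x _ D D1); rewrite addrC addKr; apply: le_lt_trans aD; exact: norm_delta_le.
split.
- move=> i; apply: (@uconv_derive _ _ [set y : E | `|y| <= r] (fun n y => z n (t, y))
    (fun n y => dz n i (t, y)) _ (fun y => du i (t, y)) x (e i) D D0 (line i) _
    (sl _ _ sub) (sl _ _ (U1 T r D i r0 D01))).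
  by move=> n y _; have [_ [C _] _ _ _] := Z n; have [A1 _ _ _] := C t; exact: A1.
- move=> i j; apply: (@uconv_derive _ _ [set y : E | `|y| <= r] (fun n y => dz n j (t, y))
    (fun n y => Hz n i j (t, y)) _ (fun y => Hu i j (t, y)) x (e i) D D0 (line i) _
    (sl _ _ (U1 T r D j r0 D01)) (sl _ _ (U2 T r D i j r0 D01))).
  by move=> n y _; have [_ [C _] _ _ _] := Z n; have [_ _ A3 _] := C t; exact: A3.
- move=> i; apply: (uconv_continuous D0 inA (U1 T r D i r0 D01)) => n.
  by have [[_ A1 _] _ _ _ _] := Z n; exact: A1.
- move=> i j; apply: (uconv_continuous D0 inA (U2 T r D i j r0 D01)) => n.
  by have [[_ _ A1] _ _ _ _] := Z n; exact: A1.
have [N0 HN0] := natge (Num.max T r).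
have big k : (N0 <= k)%N -> T <= k%:R /\ r <= k%:R by move=> /HN0; rewrite ge_max => /andP.
have agr n s y : (N0 <= n)%N -> A T r D (s, y) -> qn n (s, y) = q (s, y) /\ bn n (s, y) = b (s, y).
  move=> /big[Tn rn] [/= /andP[Ds sT] y1]; apply: agree; last exact: le_trans rn.
  by rewrite (le_trans (ltW D0) Ds) (le_trans sT).
(* The sequence is shifted by [N0], since only from there on do the approximations solve the limit
   equation near [(t, x)]. *)
have := @solves_uconv _ _ (A T r D) (La N0) q b (fun _ _ => 0) (fun=> 0) (fun n => z (n + N0)%N) (fun n => dz (n + N0)%N)
  (fun n => Hz (n + N0)%N) u du Hu t D x (La0 N0) _ _ (uconv_cst _ _) (uconv_shift _ sub)
  (fun i => uconv_shift _ (U1 T r D i r0 D01)) (fun i j => uconv_shift _ (U2 T r D i j r0 D01)) D0 => /(_ _ _ _)/wrap[].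
- move=> [s y] sy; have [<- <-] := agr N0 s y (leqnn _) sy.
  by split=> [i j|i]; [have [_ A1 _] := Yq N0 i j|have [_ A1 _] := Yb N0 i]; exact: A1.
- move=> n s y sy; have [_ [_ S] _ _ _] := Z (n + N0)%N.
  have [qE bE] := agr (n + N0)%N s y (leq_addl _ _) sy; have [/= /andP[Ds _] _] := sy.
  by have := S s y (lt_le_trans D0 Ds); rewrite /op qE bE.
- by move=> s h; split=> /=; [exact: sA|rewrite /r lerDl].
by rewrite addr0.
Qed.

End cauchy_problem.
End limit_solution.

(** * Comparison of solutions of the Cauchy problem *)

Section comparison.
Context {R : realType} {d : nat}.
Local Notation E := 'rV[R]_d.
Local Notation e i := (delta_mx 0 i : 'rV[R]_d).
Implicit Types (x y : E) (i j : 'I_d) (n m k : nat) (s t r T : R) (q : R * E -> 'M[R]_d) (b : R * E -> E).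
Implicit Types (z w v u : R * E -> R) (dw dz dv du : 'I_d -> R * E -> R) (Hw Hz Hv Hu : 'I_d -> 'I_d -> R * E -> R).

Lemma cauchy_solution (al lam F : R) q b (La : nat -> R) (qn : nat -> R * E -> 'M[R]_d) (bn : nat -> R * E -> E) (f : E -> R) :
  0 < al < 1 -> 0 < lam <= 1 -> (forall n, 0 <= La n) ->
  (forall n p, elliptic_mx lam (qn n p)) -> (forall n i j, isY al (La n) (fun p => qn n p i j)) ->
  (forall n i, isY al (La n) (fun p => bn n p 0 i)) ->
  (forall n t x, 0 <= t <= n%:R -> `|x| <= n%:R -> qn n (t, x) = q (t, x) /\ bn n (t, x) = b (t, x)) ->
  (forall T, lyapunov_upto T q b) -> continuous f -> (forall x, `|f x| <= F) ->
  exists u du Hu, [/\ continuous u, forall p, `|u p| <= F, forall x, u (0, x) = f x & classical_on_after0 q b u du Hu].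
Proof.
move=> al01 lam01 La0 Eq Yq Yb agree lyap cf fF.
have ex n : exists w : (R * E -> R) * ('I_d -> R * E -> R) * ('I_d -> 'I_d -> R * E -> R),
    approx al F qn bn f n w.1.1 w.1.2 w.2.
  have ep0 : 0 < n.+1%:R^-1 :> R by rewrite invr_gt0.
  have [z [dz [Hz [K [A1 A2 A3 A4 A5]]]]] := approximate_solution al01 lam01 (La0 n) (Eq n) (Yq n) (Yb n) ep0 cf fF.
  by exists (z, dz, Hz); split=> //; exists K.
have [w Hw] := choice ex.
exact: (approximations_converge al01 lam01 La0 Eq Yq Yb agree lyap cf fF Hw).
Qed.

(** A common form for the constructed solution, for arbitrary classical ones and for constants.
    Boundedness is asked on bounded time intervals only, so that a bounded function times [expR t]
    qualifies. *)
Definition cauchy_sol q b (f : E -> R) w dw Hw :=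
  [/\ {within [set p : R * E | 0 <= p.1], continuous w},
      forall T, exists M : R, forall t x, 0 <= t <= T -> `|w (t, x)| <= M,
      forall x, w (0, x) = f x,
      forall t, 0 < t -> is_C2 (fun x => w (t, x)) (fun i x => dw i (t, x)) (fun i j x => Hw i j (t, x))
    & forall t x, 0 < t -> is_derive t 1 (fun s => w (s, x)) (op q b dw Hw (t, x))].

Lemma cauchy_sol_cst q b (c : R) : cauchy_sol q b (fun=> c) (fun=> c) (fun _ _ => 0) (fun _ _ _ => 0).
Proof.
split=> [|T|//|t t0|t x t0].
- by apply: continuous_subspaceT => p; exact: cst_continuous.
- by exists `|c|.
- exact: is_C2_cst.
- have := is_derive_cst c t 1; congr (is_derive _ _ _ _).
  by rewrite /op !big1 ?addr0// => i _; rewrite ?mulr0//; rewrite big1// => j _; rewrite mulr0.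
Qed.

Lemma comparison_principle q b (f g : E -> R) w dw Hw v dv Hv :
  (forall t x, 0 < t -> (q (t, x))^T = q (t, x) /\ psd (q (t, x))) -> (forall T, lyapunov_upto T q b) ->
  cauchy_sol q b f w dw Hw -> cauchy_sol q b g v dv Hv -> (forall x, f x <= g x) ->
  forall t x, 0 <= t -> w (t, x) <= v (t, x).
Proof.
move=> Hq ly [w1 w2 w3 w4 w5] [v1 v2 v3 v4 v5] fg T x T0.
have [phi [dphi [Hphi [lam lam0 [cphi C2 [p0 co] Hop]]]]] := ly T.
have [M HM] := w2 T; have [N HN] := v2 T.
rewrite -subr_le0.
pose dW i p := 1 * dw i p + (-1) * dv i p; pose HW i j p := 1 * Hw i j p + (-1) * Hv i j p.
apply: (@barrier_global R d T lam (M + N) (fun p => w p - v p) (op q b dW HW) dW HW q b phi dphi Hphi) => //.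
- have sub : [set p : R * E | 0 <= p.1 <= T] `<=` [set p | 0 <= p.1] by move=> p /= /andP[].
  by move=> p; apply: cvgB; [exact: (continuous_subspaceW sub w1)|exact: (continuous_subspaceW sub v1)].
- move=> t /andP[t0 _]; apply: (is_C2_ext (is_C2_lin 1 (-1) (w4 t t0) (v4 t t0))) => //.
  by move=> y; rewrite mul1r mulN1r.
- move=> t y /andP[t0 _]; have := is_deriveB (w5 t y t0) (v5 t y t0).
  by rewrite /dW /HW op_lin mul1r mulN1r.
- by move=> t y /andP[t0 _]; exact: Hq.
- by move=> y; rewrite w3 v3 subr_le0.
- move=> t y tT; have := HM t y tT; have := HN t y tT; rewrite !ler_norml; clear; lra.
- by rewrite T0 lexx.
Qed.

End comparison.

(** * Translation in time, and explicit derivatives against derivative operators *)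

Section classical_solutions.
Context {R : realType} {d : nat}.
Local Notation E := 'rV[R]_d.
Local Notation e i := (delta_mx 0 i : 'rV[R]_d).
Implicit Types (x y : E) (i j : 'I_d) (n m k : nat) (s t r T : R) (I : set R).
Implicit Types (Q : R * E -> 'M[R]_d) (b : R * E -> E) (f : E -> R) (u v : R * E -> R).

Definition delay (U : Type) s (g : R * E -> U) (p : R * E) : U := g (s + p.1, p.2).

Lemma op_delay Q b s (phi : E -> R) t x :
  op (delay s Q) (delay s b) (fun i p => D i phi p.2) (fun i j p => D2 i j phi p.2) (t, x) = A Q b (s + t) phi x.
Proof. by []. Qed.

Lemma is_C2_of_C2 (phi : E -> R) : C2 phi ->
  is_C2 phi (fun i => D i phi) (fun i j => D2 i j phi).
Proof.
move=> [_ C1 C2']; split=> [i x|i|i j x|i j].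
- by apply: derivableP; exact: (C1 i).1.
- exact: (C1 i).2.
- by apply: derivableP; exact: (C2' i j).1.
- exact: (C2' i j).2.
Qed.

Lemma norm_le_enorm x : `|x| <= enorm x.
Proof.
rewrite /enorm -(ger0_norm (normr_ge0 x)) -sqrtr_sqr; apply: ler_wsqrtr.
by apply: (le_trans (sqr_norm_le x)); apply: ler_sum => i _; rewrite expr2.
Qed.

(** The given [phi] is positive outside a cube and bounded below inside it, so adding a constant [c]
    makes it nonnegative. This leaves its derivatives unchanged and only adds [lam * c >= 0] on the
    favourable side. *)
Lemma lyapunov_delay I Q b s : (forall t, s <= t -> I t) -> lyapunov I Q b ->
  forall T, lyapunov_upto T (delay s Q) (delay s b).
Proof.
move=> HI ly T; have iJ : is_interval `[s, s + T]%classic by exact: interval_is_interval.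
have bJ : bounded_set `[s, s + T]%classic by apply: compact_bounded; exact: segment_compact.
have JI : `[s, s + T]%classic `<=` I by move=> t /=; rewrite in_itv/= => /andP[st _]; exact: HI.
have [phi [lam [Cphi lam0 co H]]] := ly _ iJ bJ JI.
have cphi : continuous phi by case: Cphi.
have [r Hr] := co 0; pose r' := Num.max r 0; have r'0 : 0 <= r' by rewrite le_max lexx orbT.
have cN : continuous (fun x => - phi x) by move=> x; exact: (continuousN (cphi x)).
have [B HB] := bounded_on_box cN r'0; pose c := Num.max B 0.
have c0 : 0 <= c by rewrite le_max lexx orbT.
have pc x : 0 <= 1 * phi x + 1 * c.
  rewrite !mul1r; have [xr|xr] := leP `|x| r'.
    have Bc : B <= c by rewrite /c le_max lexx.
    by have := HB x xr; move: Bc; clear; lra.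
  have : 0 < phi x by apply: Hr; apply: lt_le_trans (norm_le_enorm x); apply: le_lt_trans xr; rewrite le_max lexx.
  by move: c0; clear; lra.
exists (fun x => 1 * phi x + 1 * c), (fun i x => 1 * D i phi x + 1 * 0), (fun i j x => 1 * D2 i j phi x + 1 * 0), lam; first exact: ltW.
split.
- move=> x; have cc : {for x, continuous (fun _ : E => c)} by exact: cst_continuous.
  exact: (continuous_lin (cphi x) cc).
- by apply: is_C2_lin; [exact: is_C2_of_C2|exact: is_C2_cst].
- split=> // M; have [r1 H1] := co M; exists (r1 + 1) => x xr.
  have : M < phi x by apply: H1; apply: lt_le_trans (norm_le_enorm x); apply: lt_le_trans xr; rewrite ltrDl.
  by rewrite !mul1r; move: c0; clear; lra.
- move=> t x /andP[t0 tT]; have := H (s + t) x.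
  rewrite -op_delay => /(_ _)/wrap[]; first by rewrite /= in_itv/= lerDl lerD2l tT ltW.
  have -> : op (delay s Q) (delay s b) (fun i p => 1 * D i phi p.2 + 1 * 0) (fun i j p => 1 * D2 i j phi p.2 + 1 * 0) (t, x)
      = op (delay s Q) (delay s b) (fun i p => D i phi p.2) (fun i j p => D2 i j phi p.2) (t, x).
    by rewrite /op; congr (_ + _); apply: eq_bigr => i _; [apply: eq_bigr => j _|]; rewrite mulr0 addr0 mul1r.
  by have := mulr_ge0 (ltW lam0) c0; clear; lra.
Qed.

Lemma within_continuous_epsP (V : normedModType R) (A : set V) (g : V -> R) :
  {within A, continuous g} <-> forall x : V, A x -> forall c : R, 0 < c ->
    exists2 dl : R, 0 < dl & forall y : V, A y -> `|y - x| < dl -> `|g y - g x| <= c.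
Proof.
split=> [/subspace_continuousP H x Ax c c0|H].
  have /cvgrPdist_le/(_ c c0) := H x Ax.
  move=> /nbhs_ballP[dl /= dl0 Hd]; exists dl => // y Ay yx; rewrite distrC.
  by apply: (Hd y) => //; rewrite -ball_normE /= distrC.
apply/subspace_continuousP => x Ax; apply/cvgrPdist_le => c c0; have [dl dl0 Hd] := H x Ax c c0.
apply/nbhs_ballP; exists dl => // y; rewrite -ball_normE /= => yx Ay.
by rewrite distrC; apply: Hd => //; rewrite distrC.
Qed.

Lemma delay_norm s (p p' : R * E) : `|(s + p.1, p.2) - (s + p'.1, p'.2)| = `|p - p'|.
Proof.
case: p p' => [t x] [t' x'] /=; congr `|_|; congr pair => /=.
by rewrite opprD addrACA subrr add0r.
Qed.

Lemma cauchy_sol_of_classical Q b s f v : bounded_classical_solution Q b s f v ->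
  cauchy_sol (delay s Q) (delay s b) f (delay s v)
    (fun i p => D i (slice v (s + p.1)) p.2) (fun i j p => D2 i j (slice v (s + p.1)) p.2).
Proof.
move=> [[cv bv] [_ [Ht _] H1 H2] Heq H0].
have cs (g : R * E -> R) t : 0 < t -> {within open_slab s, continuous g} -> continuous (fun x : E => g (s + t, x)).
  move=> t0 /within_continuous_epsP H x; apply/continuous_epsP => c c0.
  have st : s < s + t by rewrite ltrDl.
  have [dl dl0 Hd] := H (s + t, x) st c c0; exists dl => // y yx; apply: Hd => //.
  by rewrite prod_normE /= gt_max subrr normr0 dl0.
split.
- apply/within_continuous_epsP => p p0 c c0.
  have sp : closed_slab s (s + p.1, p.2) by rewrite /closed_slab /= lerDl.
  have [dl dl0 Hd] := (within_continuous_epsP _ _).1 cv _ sp c c0.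
  exists dl => // p' p'0 pp'; apply: Hd; last by rewrite delay_norm.
  by rewrite /closed_slab /= lerDl.
- have [M [_ HM]] := bv; move=> T; exists (M + 1) => t x /andP[t0 _]; apply: (HM (M + 1)).
    by rewrite ltrDl.
  by rewrite /closed_slab /= lerDl.
- by move=> x; rewrite /delay /= addr0.
- move=> t t0; have st : s < s + t by rewrite ltrDl.
  split=> [i x|i|i j x|i j].
  + by apply: derivableP; exact: (H1 i).1 (s + t, x) st.
  + by have := cs _ _ t0 (H1 i).2.
  + by apply: derivableP; exact: (H2 i j).1 (s + t, x) st.
  + by have := cs _ _ t0 (H2 i j).2.
- move=> t x t0; have st : s < s + t by rewrite ltrDl.
  have D : is_derive (t + s) 1 (fun t => v (t, x)) (A Q b (s + t) (slice v (s + t)) x).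
    by rewrite addrC; apply: is_derive_derive1; [exact: Ht (s + t, x) st|exact: Heq].
  have := @is_derive_shiftr R R _ _ _ s _ D.
  by congr (is_derive _ _ _ _); apply/funext => r; rewrite /delay /= addrC.
Qed.

(** The functions [du] and [Hu] agree with [D] and [D2] after time [s] only, which is where
    continuity is asked. Continuity of [Dt u] is read off the equation, through continuity of the
    coefficients. *)
Lemma classical_of_cauchy Q b s f u du Hu : continuous (delay s u) ->
  cauchy_sol (delay s Q) (delay s b) f (delay s u) du Hu ->
  (exists M : R, forall t x, 0 <= t -> `|delay s u (t, x)| <= M) ->
  (forall t x, 0 < t -> forall i, {for (t, x), continuous (du i)}) ->
  (forall t x, 0 < t -> forall i j, {for (t, x), continuous (Hu i j)}) ->
  (forall t x, 0 < t -> (forall i j, {for (t, x), continuous (fun p => delay s Q p i j)}) /\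
     forall i, {for (t, x), continuous (fun p => delay s b p 0 i)}) ->
  bounded_classical_solution Q b s f u.
Proof.
move=> cu [_ _ u0 uC2 ut] [M HM] cdu cHu cQ.
have uE : u = delay (- s) (delay s u) by apply/funext => -[t x]; rewrite /delay /= addrA subrr add0r.
have cU : continuous u.
  move=> p; apply/continuous_epsP => c c0; rewrite uE.
  have [dl dl0 Hd] := (continuous_epsP _ _).1 (cu (- s + p.1, p.2)) c c0.
  by exists dl => // p' pp'; apply: Hd; rewrite delay_norm.
have pos t : s < t -> 0 < - s + t by rewrite addrC subr_gt0.
have Du i t x : s < t -> is_derive x (e i) (slice u t) (du i (- s + t, x)).
  move=> st; have [A1 _ _ _] := uC2 _ (pos t st); have := A1 i x.
  by rewrite /delay /= addrA subrr add0r.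
have D1 i t x : s < t -> D i (slice u t) x = du i (- s + t, x) by move=> st; have [_ A1] := Du i t x st.
have Du2 i j t x : s < t -> is_derive x (e i) (D j (slice u t)) (Hu i j (- s + t, x)).
  move=> st; have [_ _ A3 _] := uC2 _ (pos t st); have := A3 i j x.
  by rewrite (_ : D j (slice u t) = fun y => du j (- s + t, y))//; apply/funext => y; exact: D1.
have D2E i j t x : s < t -> D2 i j (slice u t) x = Hu i j (- s + t, x).
  by move=> st; have [_ A1] := Du2 i j t x st.
have opE t x : s < t -> A Q b t (slice u t) x = op (delay s Q) (delay s b) du Hu (- s + t, x).
  move=> st; rewrite /A /op /delay /= addrA subrr add0r; congr (_ + _); apply: eq_bigr => i _; last by rewrite D1.
  by apply: eq_bigr => j _; rewrite D2E.
have Dut t x : s < t -> is_derive t 1 (fun r => u (r, x)) (A Q b t (slice u t) x).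
  move=> st; rewrite opE//; have := ut _ x (pos t st); rewrite [- s + t]addrC => H.
  have := @is_derive_shiftr R R _ _ _ (- s) _ H.
  by congr (is_derive _ _ _ _); apply/funext => r; rewrite /delay /= addrC subrK.
have DtE t x : s < t -> Dt u (t, x) = A Q b t (slice u t) x.
  by move=> st; have [_ A1] := Dut t x st; rewrite /Dt derive1E.
have cw (g h : R * E -> R) : (forall p, open_slab s p -> g p = h (- s + p.1, p.2)) ->
    (forall t x, 0 < t -> {for (t, x), continuous h}) -> {within open_slab s, continuous g}.
  move=> gh ch; apply/within_continuous_epsP => p sp c c0.
  have [dl dl0 Hd] := (continuous_epsP _ _).1 (ch _ p.2 (pos _ sp)) c c0.
  exists dl => // p' sp' pp'; rewrite gh// gh//; apply: Hd; by rewrite delay_norm.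
split=> //.
- split; first exact: continuous_subspaceT.
  exists M; split=> [|K MK [t x] st]; first exact: num_real.
  apply: le_trans (ltW MK); rewrite uE; apply: HM.
  by rewrite addrC subr_ge0.
- split.
  + exact: continuous_subspaceT.
  + split=> [[t x] st|]; first by have [] := Dut t x st.
    apply: (cw _ (op (delay s Q) (delay s b) du Hu)) => [[t x] st|t x t0]; first by rewrite DtE// opE.
    have [q1 b1] := cQ t x t0.
    apply: (@continuousD _ _ _ (fun p => \sum_i \sum_j delay s Q p i j * Hu i j p) (fun p => \sum_i delay s b p 0 i * du i p)).
      by apply: continuous_big_sum => i; apply: continuous_big_sum => j; exact: (continuousM (q1 i j) (cHu t x t0 i j)).
    by apply: continuous_big_sum => i; exact: (continuousM (b1 i) (cdu t x t0 i)).
  + move=> i; split=> [[t x] st|]; first by have [] := Du i t x st.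
    by apply: (cw _ (du i)) => [[t x] st|t x t0]; [exact: D1|exact: cdu].
  + move=> i j; split=> [[t x] st|]; first by have [] := Du2 i j t x st.
    by apply: (cw _ (Hu i j)) => [[t x] st|t x t0]; [exact: D2E|exact: cHu].
- by move=> x; have := u0 x; rewrite /delay /= addr0.
Qed.

End classical_solutions.

(** * Removal of the damping term *)

Section exponential_scaling.
Context {R : realType} {d : nat}.
Local Notation E := 'rV[R]_d.
Local Notation e i := (delta_mx 0 i : 'rV[R]_d).
Implicit Types (x y : E) (i j : 'I_d) (n : nat) (s t r : R) (I : set R).
Implicit Types (z : R * E -> R) (dz : 'I_d -> R * E -> R) (Hz : 'I_d -> 'I_d -> R * E -> R).
Implicit Types (q : R * E -> 'M[R]_d) (b : R * E -> E).

Definition grow z (p : R * E) : R := expR p.1 * z p.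

Lemma grow_continuous z p : {for p, continuous z} -> {for p, continuous (grow z)}.
Proof.
move=> cz; have c1 : {for p, continuous (fun p : R * E => p.1)} by exact: cvg_fst.
exact: (continuousM (continuous_comp c1 (@continuous_expR R _)) cz).
Qed.

(** The product rule contributes [expR t * z], which cancels the damping term. *)
Lemma cauchy_sol_grow q b (F : R) (f : E -> R) z dz Hz : continuous z -> (forall p, `|z p| <= F) ->
  (forall x, z (0, x) = f x) -> classical_on_after0 q b z dz Hz ->
  cauchy_sol q b f (grow z) (fun i => grow (dz i)) (fun i j => grow (Hz i j)).
Proof.
move=> cz zF z0 H; split.
- by apply: continuous_subspaceT => p; apply: grow_continuous; exact: cz.
- move=> T; exists (expR T * F) => t x /andP[t0 tT]; rewrite /grow normrM (ger0_norm (expR_ge0 _)).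
  by apply: ler_pM => //; rewrite ler_expR.
- by move=> x; rewrite /grow expR0 mul1r.
- move=> t t0; split=> [i x|i x|i j x|i j x]; have [H1 H2 H3 H4 _] := H t x t0.
  + exact: (is_deriveMl (expR t) (H1 i)).
  + by apply: continuous_slice; apply: grow_continuous; exact: H3.
  + exact: (is_deriveMl (expR t) (H2 i j)).
  + by apply: continuous_slice; apply: grow_continuous; exact: H4.
- move=> t x t0; have [_ _ _ _ H5] := H t x t0.
  have oE : op q b (fun i => grow (dz i)) (fun i j => grow (Hz i j)) (t, x) = expR t * op q b dz Hz (t, x).
    rewrite /op mulrDr !mulr_sumr; congr (_ + _); apply: eq_bigr => i _; last by rewrite /grow /=; ring.
    by rewrite mulr_sumr; apply: eq_bigr => j _; rewrite /grow /=; ring.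
  have := is_deriveM (is_derive_expR t) H5.
  congr (is_derive _ _ _ _); rewrite oE /GRing.scale /=; ring.
Qed.

End exponential_scaling.

(** * Existence and the sup bound *)

Section existence.
Context {R : realType} {d : nat}.
Local Notation E := 'rV[R]_d.
Implicit Types (x y : E) (i j : 'I_d) (n : nat) (s t : R) (I : set R) (f : E -> R).
Implicit Types (Q : R * E -> 'M[R]_d) (b : R * E -> E) (u v : R * E -> R).

Lemma unbounded_interval_ge I s t : unbounded_interval I -> I s -> s <= t -> I t.
Proof.
move=> [->//|[a [->|->]]] /=; rewrite !in_itv/= !andbT => h st.
  exact: le_trans st.
exact: lt_le_trans st.
Qed.

(** Near [(t, x)] the coefficient coincides with a clamped one, whose continuity is part of
    [isY]. *)
Lemma delayed_coef_continuous (al s : R) I (g : R * E -> R) t x : 0 < al -> (forall t, s <= t -> I t) ->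
  parabolic_holder_loc al I g -> 0 < t -> {for (t, x), continuous (delay s g)}.
Proof.
move=> al0 HI Hg t0; pose n := t + 1 + (`|x| + 1).
have x0 := normr_ge0 x; have n0 : 0 <= n by rewrite /n; move: t0 x0; clear; lra.
have [L [cg _ _]] := clamped_isY al0 n0 HI Hg.
apply/continuous_epsP => c c0; have [dl dl0 H] := (continuous_epsP _ _).1 (cg (t, x)) c c0.
exists (Num.min dl (Num.min 1 t)); first by rewrite !lt_min dl0 ltr01.
have inb t' x' : `|t' - t| < Num.min 1 t -> `|x' - x| < 1 -> clampp s n (t', x') = (s + t', x').
  rewrite lt_min => /andP[h1 h2] h3; apply: clampp_id; rewrite /n.
    by move: h1 h2; rewrite !ltr_norml; move: t0 x0; clear; lra.
  by have := ler_normD (x' - x) x; rewrite subrK; move: h3 t0; clear; lra.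
have := inb t x; rewrite !subrr !normr0 lt_min ltr01 t0 => /(_ isT isT) E0.
move=> [t' x']; rewrite lt_min => /andP[h1 h2]; have := H (t', x') h1.
move: h2; rewrite prod_normE /= gt_max => /andP[h2 h3].
have h4 : `|x' - x| < 1 by apply: lt_le_trans h3 _; rewrite ge_min lexx.
by rewrite E0 inb.
Qed.

(** Comparison with the constants [F] and [- F], which are solutions because the operator has no
    zero-order term. *)
Lemma cauchy_sol_bound (F : R) (q : R * E -> 'M[R]_d) b f w dw Hw :
  (forall t x, 0 < t -> (q (t, x))^T = q (t, x) /\ psd (q (t, x))) -> (forall T, lyapunov_upto T q b) ->
  cauchy_sol q b f w dw Hw -> (forall x, `|f x| <= F) -> forall t x, 0 <= t -> `|w (t, x)| <= F.
Proof.
move=> Hq ly CS fF t x t0; rewrite ler_norml; apply/andP; split.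
  apply: (comparison_principle Hq ly (cauchy_sol_cst q b (- F)) CS) => // y.
  by have := fF y; rewrite ler_norml => /andP[].
apply: (comparison_principle Hq ly CS (cauchy_sol_cst q b F)) => // y.
by have := fF y; rewrite ler_norml => /andP[].
Qed.

Lemma supnorm_ge f x : bounded_fun f -> `|f x| <= supnorm f.
Proof.
move=> [M [_ HM]]; apply: sup_upper_bound; last by exists x.
split; first by exists `|f x|, x.
by exists (M + 1) => _ [y _ <-]; apply: (HM (M + 1)); rewrite ?ltrDl.
Qed.

Lemma cauchy_problem_solvable I Q b s f : unbounded_interval I -> holder_coefficients I Q b ->
  elliptic I Q -> lyapunov I Q b -> I s -> Cb f -> exists u, bounded_classical_solution Q b s f u.
Proof.
move=> hI [al [al01 HQ Hb]] hQ hphi hs [cf bf]; have [al0 _] := andP al01.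
have HI t : s <= t -> I t by exact: unbounded_interval_ge.
have [lam lam01 Ell] := uniform_ellipticity hQ; have [lam0 _] := andP lam01.
have ly := lyapunov_delay HI hphi.
have [La HLa] := choice (fun n => let: ex_intro2 L a c := clamped_coefs al0 (ler0n R n) HI HQ Hb in
  ex_intro (fun L => 0 <= L /\ _) L (conj a c)).
have Eq n p : elliptic_mx lam (Q (clampp s n%:R p)).
  apply: Ell; apply: HI; have [+ _] := clampp_in s p (ler0n R n).
  by rewrite /= in_itv/= => /andP[].
have ag n t x : 0 <= t <= n%:R -> `|x| <= n%:R ->
    Q (clampp s n%:R (t, x)) = delay s Q (t, x) /\ b (clampp s n%:R (t, x)) = delay s b (t, x).
  by move=> tn xn; rewrite clampp_id.
have [z [dz [Hz [cz zF z0 H]]]] := cauchy_solution (qn := fun n p => Q (clampp s n%:R p))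
  (bn := fun n p => b (clampp s n%:R p)) al01 lam01 (fun n => (HLa n).1) Eq
  (fun n => (HLa n).2.1) (fun n => (HLa n).2.2) ag ly cf (fun x => supnorm_ge x bf).
have CS := cauchy_sol_grow cz zF z0 H.
pose u := delay (- s) (grow z).
have uE : delay s u = grow z by apply/funext => -[t x]; rewrite /u /delay /= addKr.
have psdQ t x : 0 < t -> (delay s Q (t, x))^T = delay s Q (t, x) /\ psd (delay s Q (t, x)).
  move=> t0; have A1 : elliptic_mx lam (delay s Q (t, x)) by apply: Ell; apply: HI; rewrite /= lerDl ltW.
  by split; [case: A1|exact: elliptic_psd (ltW lam0) A1].
exists u; apply: (classical_of_cauchy (du := fun i => grow (dz i)) (Hu := fun i j => grow (Hz i j))); rewrite ?uE//.
- by move=> p; apply: grow_continuous; exact: cz.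
(* The bound on [z] says too little here, as [expR t] is unbounded; comparison with constants gives
   the global bound. *)
- by exists (supnorm f) => t x t0; apply: (cauchy_sol_bound psdQ ly CS) => // y; exact: supnorm_ge.
- by move=> t x t0 i; apply: grow_continuous; have [_ _ A1 _ _] := H t x t0; exact: A1.
- by move=> t x t0 i j; apply: grow_continuous; have [_ _ _ A1 _] := H t x t0; exact: A1.
- move=> t x t0; split=> [i j|i].
    exact: delayed_coef_continuous al0 HI (HQ i j) t0.
  exact: delayed_coef_continuous al0 HI (Hb i) t0.
Qed.

End existence.
Theorem theorem2p2 (R : realType) (d : nat) (hd : (1 <= d)%N) (I : set R)
    (Q : R * 'rV[R]_d -> 'M[R]_d) (b : R * 'rV[R]_d -> 'rV[R]_d)
    (hI : unbounded_interval I)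
    (hQb : holder_coefficients I Q b)
    (hQ : elliptic I Q)
    (hphi : lyapunov I Q b)
    (s : R) (hs : I s) (f : 'rV[R]_d -> R) (hf : Cb f) :
  exists u : R * 'rV[R]_d -> R,
    [/\ bounded_classical_solution Q b s f u,
        forall v : R * 'rV[R]_d -> R, bounded_classical_solution Q b s f v ->
          forall (t : R) (x : 'rV[R]_d), s <= t -> v (t, x) = u (t, x)
      & forall t : R, s <= t -> supnorm (slice u t) <= supnorm f].
Proof.
have HI t : s <= t -> I t by exact: unbounded_interval_ge.
have [lam /andP[lam0 _] Ell] := uniform_ellipticity hQ.
have ly := lyapunov_delay HI hphi.
have psdQ t x : 0 < t -> (delay s Q (t, x))^T = delay s Q (t, x) /\ psd (delay s Q (t, x)).
  move=> t0; have A1 : elliptic_mx lam (delay s Q (t, x)) by apply: Ell; apply: HI; rewrite /= lerDl ltW.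
  by split; [case: A1|exact: elliptic_psd (ltW lam0) A1].
have [u Hu] := cauchy_problem_solvable hI hQb hQ hphi hs hf; exists u.
have CSu := cauchy_sol_of_classical Hu.
have delayE (w : R * 'rV[R]_d -> R) t x : w (t, x) = delay s w (t - s, x).
  by rewrite /delay /= addrC subrK.
split=> // [v Hv t x st|t st].
  have CSv := cauchy_sol_of_classical Hv; rewrite (delayE v) (delayE u).
  (* Equal initial values allow the comparison in both orders. *)
  by apply/eqP; rewrite eq_le; apply/andP; split;
    [apply: (comparison_principle psdQ ly CSv CSu)|apply: (comparison_principle psdQ ly CSu CSv)];
    rewrite ?subr_ge0.
apply: ge_sup; first by exists `|slice u t 0|, 0.
move=> _ [x _ <-]; rewrite /slice (delayE u).
apply: (cauchy_sol_bound psdQ ly CSu) => [y|]; last by rewrite subr_ge0.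
by apply: supnorm_ge; case: hf.
Qed.
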